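(* Let $G$ be an infinite residually finite countable discrete group with Kazhdan's property $(T)$. Suppose that $(\pi_k,H_k)_{k\ge 0}$ lists every equivalence class of finite-dimensional irreducible unitary representations of $G$ exactly once, and, with $d_k=\dim H_k$, that $$\pi_0=1_G,\qquad 1=d_0\le d_1\le d_2\le\cdots,\qquad d_k\to\infty,\qquad R_0:=\sup_{k\ge1}\frac{d_k}{d_{k-1}}<\infty.$$ Let $b>R_0$ be an integer, let $J_k:H_{k-1}\to H_k$ ($k\ge1$) be Hilbert-space isometries (not assumed to be intertwining maps), and let $A$, with its projections $e^0,e^1\in A$, be the $C^*$-algebra constructed from these data as described in the context. Then every quasidiagonal tracial state $\mu$ on $A$ satisfies $$\mu(e^0)=\mu(e^1)=\tfrac12 .$$
   Context: Conventions. $M_n=B(\mathbb C^n)$; $\operatorname{tr}_n$ is the normalized trace on $M_n$. A tracial state $\lambda$ on a unital $C^*$-algebra $B$ is quasidiagonal if there are unital completely positive maps $\psi_j:B\to M_{N_j}$ ($j\in\mathbb N$) such that $\|\psi_j(ab)-\psi_j(a)\psi_j(b)\|\to0$ (operator norm) and $\operatorname{tr}_{N_j}(\psi_j(a))\to\lambda(a)$ for all $a,b\in B$. $1_G$ is the trivial one-dimensional representation. An overline denotes the conjugate Hilbert space, conjugate representation or conjugate operator: $\overline H$ is the conjugate of $H$, $\overline\pi(g)\overline\xi=\overline{\pi(g)\xi}$, $\overline J\,\overline\xi=\overline{J\xi}$. Construction of $A$. Put $V_\ell=(\mathbb C^b)^{\otimes\ell}$ with $V_0=\mathbb C$, so $V_{\ell+1}=\mathbb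 C^b\otimes V_\ell$, and let $(\delta_j)_{j=1}^b$ be the standard basis of $\mathbb C^b$. For $1\le i\le b$ define $\Delta_{\ell,i}:V_{\ell+1}\to V_\ell$ by $\Delta_{\ell,i}(\delta_j\otimes v)=\delta_{ij}v$ (Kronecker delta on the right). For $m\ge0$ let $$L_m=\bigoplus_{k=0}^m\overline H_k\otimes V_{m-k},\qquad E_m=L_m^{(0)}\oplus L_m^{(1)},$$ where $L_m^{(0)},L_m^{(1)}$ are two copies of $L_m$. For $\varepsilon\in\{0,1\}$ define the following operators in $B(E_m)$: - $e_m^\varepsilon$ is the orthogonal projection onto $L_m^{(\varepsilon)}$; - $F_m^\varepsilon$ is the orthogonal projection onto the top summand ($k=m$), $\overline H_m\otimes V_0$, of $L_m^{(\varepsilon)}$; - $\sigma_m(g)=\bigoplus_{\varepsilon=0}^1\bigoplus_{k=0}^m\overline\pi_k(g)\otimes1_{V_{m-k}}$ for $g\in G$; - $T_{m,i}^\varepsilon$ ($1\le i\le b$) is zero on the other copy $L_m^{(1-\varepsilon)}$ and on the top summand of $L_m^{(\varepsilon)}$, and for $1\le k\le m$ its restriction to the summand $\overline H_{k-1}\otimes V_{m-k+1}$ of $L_m^{(\varepsilon)}$ is $\overline J_k\otimes\Delta_{m-k,i}$, with values in the summand $\overline H_k\otimes V_{m-k}$ of $L_m^{(\varepsilon)}$; - $s_m$ is the canonical identity map from the top summand of copy $1$ onto the top summand of copy $0$, extended by zero (so $s_m^*s_m=F_m^1$ and $s_ms_m^*=F_m^0$). Dropping the subscript $m$ denotes the corresponding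 sequence in $\prod_{m\ge0}B(E_m)$ (the $C^*$-algebra of bounded sequences), e.g. $e^\varepsilon=(e_m^\varepsilon)_m$, $\sigma(g)=(\sigma_m(g))_m$. Let $\mathcal K=\bigoplus_{m\ge0}B(E_m)$ be the $c_0$-direct sum (sequences with norms tending to $0$). Then $$A=C^*\bigl(1,\mathcal K,e^\varepsilon,F^\varepsilon,T_i^\varepsilon,\sigma(g),s:\ \varepsilon\in\{0,1\},\,1\le i\le b,\,g\in G\bigr)\subseteq\prod_{m=0}^\infty B(E_m).$$ *)

(* Defs.v *)
From HB Require Import structures.
From mathcomp Require Import all_boot all_order all_algebra all_fingroup.
From mathcomp Require Import all_classical all_reals all_analysis.
From mathcomp Require Import complex.

Set Implicit Arguments.
Unset Strict Implicit.
Unset Printing Implicit Defensive.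

Import Order.TTheory GRing.Theory Num.Theory.
Import numFieldNormedType.Exports.

Local Open Scope classical_set_scope.
Local Open Scope complex_scope.
Local Open Scope ring_scope.
Local Open Scope sesquilinear_scope.

Definition residually_finite (G : groupType) : Prop :=
  forall g : G, g <> 1%g ->
    exists (Q : finGroupType) (f : {multiplicative G -> Q}), f g <> 1%g.

Definition form_norm (R : realType) (V : lmodType R[i])
    (f : {dot V for @Num.conj R[i]}) (x : V) : R :=
  Num.sqrt (complex.Re (f x x)).

(* The inner product is linear in its first argument. *)
Record hilbertSpace (R : realType) := HilbertSpace {
  hcarrier :> lmodType R[i];
  hdot : {dot hcarrier for @Num.conj R[i]};
  hcomplete : forall u : nat -> hcarrier,
    (forall eps : R, 0 < eps -> exists n0 : nat, forall m n : nat,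
       (n0 <= m)%N -> (n0 <= n)%N -> form_norm hdot (u m - u n) < eps) ->
    exists l : hcarrier, form_norm hdot (u n - l) @[n --> \oo] --> (0 : R)
}.

Definition hnorm (R : realType) (H : hilbertSpace R) (x : H) : R :=
  form_norm (@hdot R H) x.

Definition unitary_rep (R : realType) (G : groupType) (H : hilbertSpace R)
    (rho : G -> {linear H -> H}) : Prop :=
  [/\ forall x, rho 1%g x = x,
      forall g h x, rho (g * h)%g x = rho g (rho h x) &
      forall g x y, hdot H (rho g x) (rho g y) = hdot H x y].

(* Kazhdan pairs (Q, eps): compact subsets of a discrete group are finite. *)
Definition property_T (R : realType) (G : groupType) : Prop :=
  exists (Q : seq G) (eps : R), 0 < eps /\
    forall (H : hilbertSpace R) (rho : G -> {linear H -> H}),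
      unitary_rep rho ->
      (exists2 x : H, x <> 0 &
         forall g, g \in Q -> hnorm (rho g x - x) < eps * hnorm x) ->
      exists2 x : H, x <> 0 & forall g, rho g x = x.

(* Finite-dimensional Hilbert spaces are coordinatized as C^n, whose elements
   are column vectors; g acts by x |-> rho g *m x. *)
Definition mx_unitary_rep (R : realType) (G : groupType) (n : nat)
    (rho : G -> 'M[R[i]]_n) : Prop :=
  [/\ rho 1%g = 1%:M,
      forall g h, rho (g * h)%g = rho g *m rho h &
      forall g, rho g \is unitarymx].

(* Subspaces are row spaces in MathComp, so the column action is transposed:
   a row x^T of U is sent to (rho g *m x)^T. *)
Definition mx_irreducible_rep (R : realType) (G : groupType) (n : nat)
    (rho : G -> 'M[R[i]]_n) : Prop :=
  (0 < n)%N /\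
  forall U : 'M[R[i]]_n, (forall g, stablemx U (rho g)^T) ->
    U = 0 \/ row_full U.

Definition mx_unitary_equiv (R : realType) (G : groupType) (n1 n2 : nat)
    (rho1 : G -> 'M[R[i]]_n1) (rho2 : G -> 'M[R[i]]_n2) : Prop :=
  exists W : 'M[R[i]]_(n2, n1),
    [/\ W^t* *m W = 1%:M, W *m W^t* = 1%:M &
        forall g, W *m rho1 g = rho2 g *m W].

Definition lists_irreps (R : realType) (G : groupType) (d : nat -> nat)
    (pi : forall k, G -> 'M[R[i]]_(d k)) : Prop :=
  (forall k, mx_unitary_rep (pi k) /\ mx_irreducible_rep (pi k)) /\
  (forall (n : nat) (rho : G -> 'M[R[i]]_n),
     mx_unitary_rep rho -> mx_irreducible_rep rho ->
     exists! k, mx_unitary_equiv rho (pi k)).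

Definition sup_ratio (R : realType) (d : nat -> nat) : \bar R :=
  ereal_sup (range (fun k => ((d k.+1)%:R / (d k)%:R)%:E)).

Definition l2norm (R : realType) (n : nat) (x : 'cV[R[i]]_n) : R :=
  Num.sqrt (\sum_i Normc.normc (x i 0) ^+ 2).

Definition opnorm (R : realType) (p q : nat) (M : 'M[R[i]]_(p, q)) : R :=
  sup [set l2norm (M *m x) | x in [set x : 'cV[R[i]]_q | l2norm x <= 1]].

(* [0 <= z] in R[i] says that z is real and nonnegative. *)
Definition psdmx (R : realType) (n : nat) (M : 'M[R[i]]_n) : Prop :=
  forall x : 'cV[R[i]]_n, 0 <= (x^t* *m M *m x) 0 0.

Definition ntr (R : realType) (n : nat) (M : 'M[R[i]]_n) : R[i] :=
  \tr M / n%:R.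

Definition mxseq (R : realType) (N : nat -> nat) : Type :=
  forall m, 'M[R[i]]_(N m).

Section MxSeq.
Context {R : realType} {N : nat -> nat}.
Local Notation X := (mxseq R N).
Implicit Types a b c : X.

HB.instance Definition _ := gen_eqMixin X.
HB.instance Definition _ := gen_choiceMixin X.

Definition ms_zero : X := fun m => 0.
Definition ms_opp a : X := fun m => - a m.
Definition ms_add a b : X := fun m => a m + b m.
Definition ms_one : X := fun m => 1%:M.
Definition ms_mul a b : X := fun m => a m *m b m.
Definition ms_scale (z : R[i]) a : X := fun m => z *: a m.

Fact ms_addA : associative ms_add.
Proof. by move=> a b c; apply: functional_extensionality_dep => m; exact: addrA. Qed.
Fact ms_addC : commutative ms_add.
Proof. by move=> a b; apply: functional_extensionality_dep => m; exact: addrC. Qed.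
Fact ms_add0 : left_id ms_zero ms_add.
Proof. by move=> a; apply: functional_extensionality_dep => m; exact: add0r. Qed.
Fact ms_addN : left_inverse ms_zero ms_opp ms_add.
Proof. by move=> a; apply: functional_extensionality_dep => m; exact: addNr. Qed.
HB.instance Definition _ :=
  GRing.isZmodule.Build X ms_addA ms_addC ms_add0 ms_addN.

Fact ms_mulA : associative ms_mul.
Proof. by move=> a b c; apply: functional_extensionality_dep => m; exact: mulmxA. Qed.
Fact ms_mul1l : left_id ms_one ms_mul.
Proof. by move=> a; apply: functional_extensionality_dep => m; exact: mul1mx. Qed.
Fact ms_mul1r : right_id ms_one ms_mul.
Proof. by move=> a; apply: functional_extensionality_dep => m; exact: mulmx1. Qed.
Fact ms_mulDl : left_distributive ms_mul +%R.
Proof. by move=> a b c; apply: functional_extensionality_dep => m; exact: mulmxDl. Qed.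
Fact ms_mulDr : right_distributive ms_mul +%R.
Proof. by move=> a b c; apply: functional_extensionality_dep => m; exact: mulmxDr. Qed.
HB.instance Definition _ :=
  GRing.Zmodule_isPzRing.Build X ms_mulA ms_mul1l ms_mul1r ms_mulDl ms_mulDr.

Fact ms_scaleA z1 z2 a : ms_scale z1 (ms_scale z2 a) = ms_scale (z1 * z2) a.
Proof. by apply: functional_extensionality_dep => m; exact: scalerA. Qed.
Fact ms_scale1 : left_id 1 ms_scale.
Proof. by move=> a; apply: functional_extensionality_dep => m; exact: scale1r. Qed.
Fact ms_scaleDr : right_distributive ms_scale +%R.
Proof. by move=> z a b; apply: functional_extensionality_dep => m; exact: scalerDr. Qed.
Fact ms_scaleDl a : {morph ms_scale^~ a : z1 z2 / z1 + z2}.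
Proof. by move=> z1 z2; apply: functional_extensionality_dep => m; exact: scalerDl. Qed.
HB.instance Definition _ := GRing.Zmodule_isLmodule.Build R[i] X
  ms_scaleA ms_scale1 ms_scaleDr ms_scaleDl.

Definition ms_adj a : X := fun m => (a m)^t*.

Definition ms_bounded a : Prop :=
  exists K : R, forall m, opnorm (a m) <= K.

Definition ms_c0 a : Prop := opnorm (a m) @[m --> \oo] --> (0 : R).

Record unital_Cstar_subalg (B : set X) : Prop := {
  csub_bounded : forall a, B a -> ms_bounded a;
  csub_one : B 1;
  csub_add : forall a b, B a -> B b -> B (a + b);
  csub_scale : forall (z : R[i]) a, B a -> B (z *: a);
  csub_mul : forall a b, B a -> B b -> B (a * b);
  csub_adj : forall a, B a -> B (ms_adj a);
  csub_closed : forall a,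
    (forall eps : R, 0 < eps ->
       exists2 c, B c & forall m, opnorm (a m - c m) <= eps) -> B a
}.

Definition Cstar_gen (S : set X) : set X := smallest unital_Cstar_subalg S.

(* Maps out of a subalgebra B are total functions on sequences; only their
   values on B are constrained. *)
Definition linear_on (B : set X) (V : lmodType R[i]) (f : X -> V) : Prop :=
  forall (z : R[i]) a b, B a -> B b -> f (z *: a + b) = z *: f a + f b.

Definition tracial_state (B : set X) (mu : X -> R[i]) : Prop :=
  [/\ linear_on B (mu : X -> R[i]^o),
      mu 1 = 1,
      forall a, B a -> 0 <= mu (ms_adj a * a) &
      forall a b, B a -> B b -> mu (a * b) = mu (b * a)].

(* The positive elements of M_k(B) are the Y^* Y with Y in M_k(B). *)
Definition ucp (B : set X) (n : nat) (psi : X -> 'M[R[i]]_n) : Prop :=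
  [/\ linear_on B psi,
      psi 1 = 1%:M &
      forall (k : nat) (Y : 'I_k -> 'I_k -> X), (forall i j, B (Y i j)) ->
        psdmx (\mxblock_(i < k, j < k)
                 psi (\sum_(l < k) ms_adj (Y l i) * Y l j))].

Definition quasidiagonal (B : set X) (mu : X -> R[i]) : Prop :=
  exists (D : nat -> nat) (psi : forall j, X -> 'M[R[i]]_(D j)),
    [/\ forall j, (0 < D j)%N,
        forall j, ucp B (psi j),
        forall a b, B a -> B b ->
          opnorm (psi j (a * b) - psi j a *m psi j b) @[j --> \oo] --> (0 : R) &
        forall a, B a ->
          (ntr (psi j a) : R[i]^o) @[j --> \oo] --> (mu a : R[i]^o)].

End MxSeq.

Section Construction.
Context {R : realType} {G : groupType} {d : nat -> nat}.
Context (pi : forall k, G -> 'M[R[i]]_(d k)).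
Context (J : forall k, 'M[R[i]]_(d k.+1, d k)).
Context (b : nat).

(* Orthonormal basis of E_m: a basis vector is given by a copy (false for 0,
   true for 1), a level k <= m, a basis vector of conj(H_k) = C^(d k), and a word
   j_1 .. j_(m-k) standing for delta_(j_1) (x) .. (x) delta_(j_(m-k)). *)
Definition Ebasis (m : nat) : finType :=
  (bool * {k : 'I_m.+1 & ('I_(d k) * (m - k).-tuple 'I_b)%type})%type.

Definition copy_of m (x : Ebasis m) : bool := x.1.
Definition level_of m (x : Ebasis m) : nat := tag x.2.
Definition hpart m (x : Ebasis m) : {k : nat & 'I_(d k)} :=
  Tagged (fun k : nat => 'I_(d k)) (tagged x.2).1.
Definition word_of m (x : Ebasis m) : seq 'I_b := (tagged x.2).2.

Definition Edim (m : nat) : nat := #|Ebasis m|.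

Definition Eop m (f : Ebasis m -> Ebasis m -> R[i]) : 'M[R[i]]_(Edim m) :=
  \matrix_(i, j) f (enum_val i) (enum_val j).

(* Coefficient at basis vector x of the image of basis vector y under the
   operator that maps H_k to H_(s k) by M k, for every k. *)
Definition hcoef (s : nat -> nat) (M : forall k, 'M[R[i]]_(d (s k), d k))
    (x y : {k : nat & 'I_(d k)}) : R[i] :=
  \sum_(p : 'I_(d (s (tag y))) | x == Tagged (fun k => 'I_(d k)) p)
    M (tag y) p (tagged y).

Definition seq_e (eps : bool) : mxseq R Edim := fun m =>
  Eop (fun x y : Ebasis m => ((x == y) && (copy_of x == eps))%:R).

Definition seq_F (eps : bool) : mxseq R Edim := fun m =>
  Eop (fun x y : Ebasis m =>
    [&& x == y, copy_of x == eps & level_of x == m]%:R).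

(* In the conjugate basis, a conjugate operator has the conjugate matrix. *)
Definition seq_sigma (g : G) : mxseq R Edim := fun m =>
  Eop (fun x y : Ebasis m =>
    ((copy_of x == copy_of y) && (word_of x == word_of y))%:R *
    hcoef (s := id) (fun k => map_mx Num.conj (pi k g)) (hpart x) (hpart y)).

(* The word condition is the matrix of Delta_i, and it vanishes on the top
   summand (empty word).  [J k] is the isometry H_k -> H_(k+1). *)
Definition seq_T (eps : bool) (i : 'I_b) : mxseq R Edim := fun m =>
  Eop (fun x y : Ebasis m =>
    [&& copy_of x == eps, copy_of y == eps & word_of y == i :: word_of x]%:R *
    hcoef (s := succn) (fun k => map_mx Num.conj (J k)) (hpart x) (hpart y)).

Definition seq_s : mxseq R Edim := fun m =>
  Eop (fun x y : Ebasis m =>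
    [&& ~~ copy_of x, copy_of y, x.2 == y.2 & level_of y == m]%:R).

Definition algA : set (mxseq R Edim) := Cstar_gen
  ([set 1] `|` [set a | ms_c0 a] `|` range seq_e `|` range seq_F
   `|` [set seq_T p.1 p.2 | p in [set: bool * 'I_b]]
   `|` range seq_sigma `|` [set seq_s]).

End Construction.

Arguments Edim d b m : clear implicits.
Arguments seq_e {R} d b eps.
Arguments seq_F {R} d b eps.
Arguments seq_sigma {R G d} pi b g.
Arguments seq_s {R} d b.
Arguments algA {R G d} pi J b.

(* Main.v *)
From HB Require Import structures.
Require Import Defs.
From mathcomp Require Import all_boot all_order all_algebra all_fingroup.
From mathcomp Require Import all_classical all_reals all_analysis.
From mathcomp Require Import complex ring lra.

Set Implicit Arguments.
Unset Strict Implicit.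
Unset Printing Implicit Defensive.

Import Order.TTheory GRing.Theory Num.Theory.
Import numFieldNormedType.Exports.

Local Open Scope classical_set_scope.
Local Open Scope complex_scope.
Local Open Scope ring_scope.
Local Open Scope sesquilinear_scope.

(**
Let p_l^e be the projection onto level l of copy e.  The invariant projection of sigma (x) pi_k
is a projection q_k = q_k^0 + q_k^1 in M_(d_k)(A): property (T) makes it a norm limit of powers of
an average of sigma(g) (x) pi_k(g), at a rate independent of k.  Hence the approximately
multiplicative maps Psi_j of a quasidiagonal trace are asymptotically multiplicative on all the
q_k^e simultaneously, and likewise on the compressions
  tau_(k,i)^e = (d_(k+1) / d_k)^(1/2) q_(k+1) (T_i^e (x) J_k) q_k,
which satisfy the relations tau_i tau_j^* = delta_ij q_(k+1)^e and
sum_i tau_i^* tau_i + q_k F^e = q_k^e, while s exchanges q_k F^0 and q_k F^1.  For fixed j, Psi_j(q_k^e)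
is close to a projection, whose rank vanishes for large k because its trace is at most D_j / d_k.
Given a partial isometry between the two copies at level k + 1, the relations yield one at level k,
so by downward induction the two ranks agree for every k, whence mu(p_k^0) = mu(p_k^1).

No mass escapes to infinity: T_i p_(>=K) T_i^* - R_0^(-1) p_(>=K+1) has nonnegative trace against
positive elements commuting with sigma, and with (T) a quasidiagonal trace inherits this
positivity.  Thus mu(p_(>=K)) >= (b / R_0) mu(p_(>=K+1)), the tails tend to 0, and
mu(e^0) = sum_k mu(p_k^0) = sum_k mu(p_k^1) = mu(e^1).
*)

(** * Linear algebra over C^n *)

(** The downward induction starts at a level depending on D_j, so its length is unbounded in j and
    it must not lose precision on the way. Two features ensure this. The tolerance in the relations
    is uniform in k, because approximate multiplicativity is measured against matrices over A of
    every size, and q_k is approximated at a rate free of k. And what passes from one level to the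
    next is an equality of integers: the glued operator is only an approximate partial isometry, but
    it determines the ranks exactly, and the next step starts afresh from exact projections at
    distance 2 delta. Hence one smallness condition on delta, depending on b alone, serves all
    levels.

    In the tail estimate the element itself need not be positive; only its trace on each block of
    the commutant is. To transport this to psi_j, the average of sigma (x) conj(sigma_m) over long
    words is made into a form that is positive up to a multiple of kappa^k. Applying psi_j and
    flipping the tensor factors gives a matrix over A, almost positive at every level m, to which
    psi_j is applied a second time. This produces traces of psi_j(g^* a h) psi_j(h^* g), each close
    to D_j mu(a). *)

Section RealInnerProduct.
Context {R : realType}.
Local Notation C := (R[i]).
Implicit Types (n p q : nat).

(** The real part is a symmetric real-bilinear form with the same norm, so estimates can be expanded
    over [R]; complex orthogonality is recovered by testing on complex multiples. *)
Definition rdot n (x y : 'cV[C]_n) : R := complex.Re ((y^t* *m x) 0 0).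

Lemma conj_realC (x : R) : (x%:C : C)^* = x%:C.
Proof. exact: conjc_real. Qed.

Lemma rdot_def n (x y : 'cV[C]_n) : rdot x y = complex.Re ((y^t* *m x) 0 0).
Proof. by []. Qed.

Lemma rdotE n (x y : 'cV[C]_n) : rdot x y = \sum_i complex.Re (x i 0 * (y i 0)^*).
Proof.
rewrite /rdot mxE raddf_sum; apply: eq_bigr => i _.
by rewrite !mxE mulrC.
Qed.

Lemma rdotC n (x y : 'cV[C]_n) : rdot x y = rdot y x.
Proof.
rewrite !rdotE; apply: eq_bigr => i _.
by case: (x i 0) => a b; case: (y i 0) => c d /=; ring.
Qed.

Lemma rdotDl n (x y z : 'cV[C]_n) : rdot (x + y) z = rdot x z + rdot y z.
Proof. by rewrite /rdot mulmxDr mxE raddfD. Qed.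

Lemma rdotDr n (x y z : 'cV[C]_n) : rdot x (y + z) = rdot x y + rdot x z.
Proof. by rewrite rdotC rdotDl !(rdotC x). Qed.

Lemma rdotNl n (x y : 'cV[C]_n) : rdot (- x) y = - rdot x y.
Proof. by rewrite /rdot mulmxN mxE raddfN. Qed.

Lemma rdotNr n (x y : 'cV[C]_n) : rdot x (- y) = - rdot x y.
Proof. by rewrite rdotC rdotNl rdotC. Qed.

Lemma rdotZl n (c : R) (x y : 'cV[C]_n) : rdot (c%:C *: x) y = c * rdot x y.
Proof.
rewrite /rdot -scalemxAr mxE.
by case: ((y^t* *m x) 0 0) => u v /=; rewrite mul0r subr0.
Qed.

Lemma rdotZr n (c : R) (x y : 'cV[C]_n) : rdot x (c%:C *: y) = c * rdot x y.
Proof. by rewrite rdotC rdotZl rdotC. Qed.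

Lemma rdot0l n (x : 'cV[C]_n) : rdot 0 x = 0.
Proof. by rewrite /rdot mulmx0 mxE. Qed.

Lemma rdot0r n (x : 'cV[C]_n) : rdot x 0 = 0.
Proof. by rewrite rdotC rdot0l. Qed.

Lemma rdot_suml n I (r : seq I) (P : pred I) (F : I -> 'cV[C]_n) y :
  rdot (\sum_(i <- r | P i) F i) y = \sum_(i <- r | P i) rdot (F i) y.
Proof.
by elim/big_rec2: _ => [|i a b _ <-]; rewrite ?rdot0l ?rdotDl.
Qed.

Lemma trmxC_mul p q n (A : 'M[C]_(p, q)) (B : 'M[C]_(q, n)) :
  (A *m B)^t* = B^t* *m A^t*.
Proof. by rewrite trmx_mul map_mxM. Qed.

Lemma trmxC_add p q (A B : 'M[C]_(p, q)) : (A + B)^t* = A^t* + B^t*.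
Proof. by rewrite raddfD /= map_mxD. Qed.

Lemma trmxC_opp p q (A : 'M[C]_(p, q)) : (- A)^t* = - A^t*.
Proof. by rewrite raddfN /= map_mxN. Qed.

Lemma trmxC_scale p q c (A : 'M[C]_(p, q)) : (c *: A)^t* = c^* *: A^t*.
Proof. by rewrite linearZ /= map_mxZ. Qed.

Lemma trmxC_scalar p c : (c%:M : 'M[C]_p)^t* = (c^*)%:M.
Proof. by rewrite tr_scalar_mx map_scalar_mx. Qed.

Lemma trmxC_sum p q I (r : seq I) (P : pred I) (F : I -> 'M[C]_(p, q)) :
  (\sum_(i <- r | P i) F i)^t* = \sum_(i <- r | P i) (F i)^t*.
Proof.
elim/big_rec2: _ => [|i a b _ <-]; first by rewrite trmx0 map_mx0.
by rewrite trmxC_add.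
Qed.

Lemma rdot_adjr p q (M : 'M[C]_(p, q)) x y : rdot (M *m x) y = rdot x (M^t* *m y).
Proof. by rewrite /rdot trmxC_mul trmxCK mulmxA. Qed.

Lemma rdot_adjl p q (M : 'M[C]_(p, q)) x y : rdot x (M *m y) = rdot (M^t* *m x) y.
Proof. by rewrite rdotC rdot_adjr rdotC. Qed.

Lemma l2norm_ge0 n (x : 'cV[C]_n) : 0 <= l2norm x.
Proof. exact: sqrtr_ge0. Qed.

Lemma l2norm_sqrE n (x : 'cV[C]_n) : l2norm x ^+ 2 = \sum_i Normc.normc (x i 0) ^+ 2.
Proof. by rewrite /l2norm sqr_sqrtr // sumr_ge0 // => i _; exact: sqr_ge0. Qed.

Lemma l2norm_sqr n (x : 'cV[C]_n) : l2norm x ^+ 2 = rdot x x.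
Proof.
rewrite /l2norm sqr_sqrtr; last by apply: sumr_ge0 => i _; exact: sqr_ge0.
rewrite rdotE; apply: eq_bigr => i _; case: (x i 0) => a b /=.
by rewrite sqr_sqrtr ?addr_ge0 ?sqr_ge0 //; ring.
Qed.

Lemma rdot_ge0 n (x : 'cV[C]_n) : 0 <= rdot x x.
Proof. by rewrite -l2norm_sqr sqr_ge0. Qed.

Lemma l2norm_eq0 n (x : 'cV[C]_n) : l2norm x = 0 -> x = 0.
Proof.
move=> x0; apply/matrixP => i j; rewrite ord1 mxE {j}.
have : l2norm x ^+ 2 = 0 by rewrite x0 expr0n.
rewrite /l2norm sqr_sqrtr; last by apply: sumr_ge0 => k _; exact: sqr_ge0.
move/eqP; rewrite psumr_eq0; last by move=> k _; exact: sqr_ge0.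
by move/allP => /(_ i (mem_index_enum i)) /=; rewrite sqrf_eq0 => /eqP /Normc.eq0_normc.
Qed.

Lemma l2norm0 n : l2norm (0 : 'cV[C]_n) = 0.
Proof. by apply/eqP; rewrite -sqrf_eq0 l2norm_sqr rdot0l. Qed.

Lemma rdot_le n (x y : 'cV[C]_n) : rdot x y <= l2norm x * l2norm y.
Proof.
have [y0|y0] := eqVneq (l2norm y) 0.
  by rewrite (l2norm_eq0 y0) rdot0r l2norm0 mulr0.
(* The test vector is |y|^2 times the component of x orthogonal to y, which avoids a division. *)
have := rdot_ge0 ((l2norm y)%:C *: ((l2norm y)%:C *: x) - (rdot x y)%:C *: y).
have yp : 0 < l2norm y by rewrite lt_neqAle eq_sym y0 l2norm_ge0.
rewrite !(rdotDl, rdotDr, rdotNl, rdotNr, rdotZl, rdotZr) (rdotC y x).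
rewrite -!l2norm_sqr => h.
have {}h : 0 <= l2norm y ^+ 2 * ((l2norm x * l2norm y) ^+ 2 - rdot x y ^+ 2).
  by move: h; congr (_ <= _); ring.
have {}h : rdot x y ^+ 2 <= (l2norm x * l2norm y) ^+ 2.
  by move: h; rewrite pmulr_rge0 ?exprn_gt0 // subr_ge0.
apply: le_trans (ler_norm _) _.
by rewrite -(@ler_pXn2r _ 2) ?nnegrE ?mulr_ge0 ?l2norm_ge0 // real_normK ?num_real.
Qed.

Lemma rdot_abs_le n (x y : 'cV[C]_n) : `|rdot x y| <= l2norm x * l2norm y.
Proof.
rewrite ler_norml rdot_le andbT lerNl -rdotNl (le_trans (rdot_le _ _)) //.
suff -> : l2norm (- x) = l2norm x by [].
by apply/eqP; rewrite -(@eqrXn2 _ 2) ?l2norm_ge0 // !l2norm_sqr rdotNl rdotNr opprK.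
Qed.

Lemma l2normD n (x y : 'cV[C]_n) : l2norm (x + y) <= l2norm x + l2norm y.
Proof.
rewrite -(@ler_pXn2r _ 2) ?nnegrE ?addr_ge0 ?l2norm_ge0 //.
rewrite l2norm_sqr rdotDl !rdotDr (rdotC y x) sqrrD !l2norm_sqr.
rewrite addrA lerD2r -addrA lerD2l -mulr2n.
by rewrite lerMn2r rdot_le orbT.
Qed.

Lemma l2normZ n (c : R) (x : 'cV[C]_n) : l2norm (c%:C *: x) = `|c| * l2norm x.
Proof.
apply/eqP; rewrite -(@eqrXn2 _ 2) ?mulr_ge0 ?l2norm_ge0 //.
by rewrite exprMn !l2norm_sqr rdotZl rdotZr real_normK ?num_real // mulrA.
Qed.

Lemma l2normZc n (c : C) (x : 'cV[C]_n) : l2norm (c *: x) = Normc.normc c * l2norm x.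
Proof.
have c0 : 0 <= Normc.normc c by case: c => ? ?; exact: sqrtr_ge0.
apply/eqP; rewrite -(@eqrXn2 _ 2) ?mulr_ge0 ?l2norm_ge0 //.
rewrite exprMn !l2norm_sqr /rdot -scalemxAr trmxC_scale -scalemxAl scalerA mxE.
rewrite {c0}; case: c => a b /=; case: (_ 0 0) => u v /=.
by rewrite sqr_sqrtr ?addr_ge0 ?sqr_ge0 //; apply/eqP; ring.
Qed.

Lemma l2normN n (x : 'cV[C]_n) : l2norm (- x) = l2norm x.
Proof.
by apply/eqP; rewrite -(@eqrXn2 _ 2) ?l2norm_ge0 // !l2norm_sqr rdotNl rdotNr opprK.
Qed.

Lemma l2norm_sum n I (r : seq I) (P : pred I) (F : I -> 'cV[C]_n) :
  l2norm (\sum_(i <- r | P i) F i) <= \sum_(i <- r | P i) l2norm (F i).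
Proof.
elim/big_rec2: _ => [|i a b _ h]; first by rewrite l2norm0.
by apply: le_trans (l2normD _ _) _; rewrite lerD2l.
Qed.

Lemma l2norm_coord n (x : 'cV[C]_n) i : Normc.normc (x i 0) <= l2norm x.
Proof.
have c0 c : 0 <= Normc.normc (c : C) by case: c => ? ?; exact: sqrtr_ge0.
rewrite -(@ler_pXn2r _ 2) ?nnegrE ?l2norm_ge0 //.
rewrite /l2norm sqr_sqrtr; last by apply: sumr_ge0 => k _; exact: sqr_ge0.
by rewrite (bigD1 i) //= lerDl; apply: sumr_ge0 => k _; exact: sqr_ge0.
Qed.

Lemma rdot_ext n (x : 'cV[C]_n) : (forall y, rdot x y = 0) -> x = 0.
Proof.
by move=> h; apply: l2norm_eq0; apply/eqP; rewrite -sqrf_eq0 l2norm_sqr h.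
Qed.

Lemma rdot_delta n (x : 'cV[C]_n) i : rdot x (delta_mx i 0) = complex.Re (x i 0).
Proof. by rewrite /rdot trmx_delta map_delta_mx -rowE mxE. Qed.

Lemma l2norm_delta n (i : 'I_n) : l2norm (delta_mx i 0 : 'cV[C]_n) = 1.
Proof.
by apply/eqP; rewrite -(@eqrXn2 _ 2) ?l2norm_ge0 // l2norm_sqr rdot_delta mxE !eqxx expr1n.
Qed.

End RealInnerProduct.

Section OperatorNorm.
Context {R : realType}.
Local Notation C := (R[i]).
Implicit Types (n p q : nat) (c : R).

Lemma mulmx_col_sum p q (M : 'M[C]_(p, q)) (x : 'cV[C]_q) :
  M *m x = \sum_j x j 0 *: col j M.
Proof.
apply/matrixP => i k; rewrite ord1 mxE summxE; apply: eq_bigr => j _.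
by rewrite !mxE mulrC.
Qed.

Lemma mx_bounded p q (M : 'M[C]_(p, q)) :
  exists2 K : R, 0 <= K & forall x, l2norm (M *m x) <= K * l2norm x.
Proof.
exists (\sum_j l2norm (col j M)); first by apply: sumr_ge0 => j _; exact: l2norm_ge0.
move=> x; rewrite mulmx_col_sum (le_trans (l2norm_sum _ _ _)) // mulr_suml.
apply: ler_sum => j _; rewrite l2normZc mulrC ler_wpM2l ?l2norm_ge0 //.
exact: l2norm_coord.
Qed.

Lemma opnorm_has_sup p q (M : 'M[C]_(p, q)) :
  has_sup [set l2norm (M *m x) | x in [set x : 'cV[C]_q | l2norm x <= 1]].
Proof.
split; first by exists (l2norm (M *m 0)); exists 0 => //=; rewrite l2norm0.
have [K K0 hK] := mx_bounded M; exists K => _ [x /= x1 <-].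
by rewrite (le_trans (hK x)) // ler_piMr.
Qed.

Lemma opnorm_ge0 p q (M : 'M[C]_(p, q)) : 0 <= opnorm M.
Proof.
rewrite (le_trans (l2norm_ge0 (M *m 0))) //; apply: sup_upper_bound.
  exact: opnorm_has_sup.
by exists 0 => //=; rewrite l2norm0.
Qed.

Lemma le_opnorm p q (M : 'M[C]_(p, q)) x : l2norm (M *m x) <= opnorm M * l2norm x.
Proof.
have [x0|x0] := eqVneq (l2norm x) 0.
  by rewrite (l2norm_eq0 x0) mulmx0 !l2norm0 mulr0.
have xp : 0 < l2norm x by rewrite lt_neqAle eq_sym x0 l2norm_ge0.
rewrite -ler_pdivrMr //.
have -> : l2norm (M *m x) / l2norm x = l2norm (M *m (((l2norm x)^-1)%:C *: x)).
  by rewrite -scalemxAr l2normZ ger0_norm ?invr_ge0 ?l2norm_ge0 // mulrC.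
apply: sup_upper_bound; first exact: opnorm_has_sup.
exists (((l2norm x)^-1)%:C *: x) => //=.
by rewrite l2normZ ger0_norm ?invr_ge0 ?l2norm_ge0 // mulVf.
Qed.

Lemma opnorm_le p q (M : 'M[C]_(p, q)) c :
  0 <= c -> (forall x, l2norm (M *m x) <= c * l2norm x) -> opnorm M <= c.
Proof.
move=> c0 h; apply: ge_sup; first by have [] := opnorm_has_sup M.
by move=> _ [x /= x1 <-]; rewrite (le_trans (h x)) // ler_piMr.
Qed.

Lemma opnorm_bound p q (M : 'M[C]_(p, q)) c x :
  opnorm M <= c -> l2norm (M *m x) <= c * l2norm x.
Proof. by move=> h; rewrite (le_trans (le_opnorm M x)) // ler_wpM2r ?l2norm_ge0. Qed.

Lemma opnorm0 p q : opnorm (0 : 'M[C]_(p, q)) = 0.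
Proof.
apply/eqP; rewrite eq_le opnorm_ge0 andbT; apply: opnorm_le => // x.
by rewrite mul0mx l2norm0 mul0r.
Qed.

Lemma opnormD p q (A B : 'M[C]_(p, q)) : opnorm (A + B) <= opnorm A + opnorm B.
Proof.
apply: opnorm_le => [|x]; first by rewrite addr_ge0 ?opnorm_ge0.
rewrite mulmxDl (le_trans (l2normD _ _)) // mulrDl.
by apply: lerD; exact: le_opnorm.
Qed.

Lemma opnormN p q (A : 'M[C]_(p, q)) : opnorm (- A) = opnorm A.
Proof.
rewrite /opnorm; congr (sup (image _ _)); apply/funext => x.
by rewrite mulNmx l2normN.
Qed.

Lemma opnormB p q (A B : 'M[C]_(p, q)) : opnorm (A - B) <= opnorm A + opnorm B.
Proof. by rewrite -(opnormN B); exact: opnormD. Qed.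

Lemma opnormBC p q (A B : 'M[C]_(p, q)) : opnorm (A - B) = opnorm (B - A).
Proof. by rewrite -opnormN opprB. Qed.

Lemma opnorm_dist p q (A B D : 'M[C]_(p, q)) :
  opnorm (A - D) <= opnorm (A - B) + opnorm (B - D).
Proof. by have := opnormD (A - B) (B - D); rewrite addrA subrK. Qed.

Lemma opnorm_sum p q I (r : seq I) (P : pred I) (F : I -> 'M[C]_(p, q)) :
  opnorm (\sum_(i <- r | P i) F i) <= \sum_(i <- r | P i) opnorm (F i).
Proof.
elim/big_rec2: _ => [|i a b _ h]; first by rewrite opnorm0.
by apply: le_trans (opnormD _ _) _; rewrite lerD2l.
Qed.

Lemma opnormM p q n (A : 'M[C]_(p, q)) (B : 'M[C]_(q, n)) :
  opnorm (A *m B) <= opnorm A * opnorm B.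
Proof.
apply: opnorm_le => [|x]; first by rewrite mulr_ge0 ?opnorm_ge0.
rewrite -mulmxA (le_trans (le_opnorm _ _)) // -mulrA ler_wpM2l ?opnorm_ge0 //.
exact: le_opnorm.
Qed.

Lemma opnormM_le p q n (A : 'M[C]_(p, q)) (B : 'M[C]_(q, n)) a b :
  opnorm A <= a -> opnorm B <= b -> opnorm (A *m B) <= a * b.
Proof.
move=> ha hb; apply: le_trans (opnormM _ _) _.
by apply: ler_pM; rewrite ?opnorm_ge0.
Qed.

Lemma opnormZ p q (c : R) (A : 'M[C]_(p, q)) : opnorm (c%:C *: A) <= `|c| * opnorm A.
Proof.
apply: opnorm_le => [|x]; first by rewrite mulr_ge0 ?opnorm_ge0.
by rewrite -scalemxAl l2normZ -mulrA ler_wpM2l // le_opnorm.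
Qed.

Lemma opnorm_adj_le p q (A : 'M[C]_(p, q)) : opnorm (A^t*) <= opnorm A.
Proof.
apply: opnorm_le => [|x]; first exact: opnorm_ge0.
have [y0|y0] := eqVneq (l2norm (A^t* *m x)) 0.
  by rewrite y0 mulr_ge0 ?opnorm_ge0 ?l2norm_ge0.
have yp : 0 < l2norm (A^t* *m x) by rewrite lt_neqAle eq_sym y0 l2norm_ge0.
rewrite -(ler_pM2r yp) -expr2 l2norm_sqr rdot_adjl trmxCK mulmxA -mulmxA.
rewrite (le_trans (rdot_le _ _)) // mulrAC ler_wpM2r ?l2norm_ge0 //.
exact: le_opnorm.
Qed.

Lemma opnorm_adj p q (A : 'M[C]_(p, q)) : opnorm (A^t*) = opnorm A.
Proof.
apply/eqP; rewrite eq_le opnorm_adj_le /=.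
by have := opnorm_adj_le (A^t*); rewrite trmxCK.
Qed.

Lemma opnorm1 n : opnorm (1%:M : 'M[C]_n) <= 1.
Proof. by apply: opnorm_le => // x; rewrite mul1mx mul1r. Qed.

Lemma opnorm_sqr_le p q (A : 'M[C]_(p, q)) c :
  0 <= c -> opnorm (A^t* *m A) <= c ^+ 2 -> opnorm A <= c.
Proof.
move=> c0 h; apply: opnorm_le => // x.
rewrite -(@ler_pXn2r _ 2) ?nnegrE ?mulr_ge0 ?l2norm_ge0 //.
rewrite l2norm_sqr rdot_adjl mulmxA (le_trans (rdot_le _ _)) //.
rewrite (_ : (c * l2norm x) ^+ 2 = c ^+ 2 * l2norm x * l2norm x); last by ring.
by rewrite ler_wpM2r ?l2norm_ge0 //; exact: opnorm_bound.
Qed.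

Lemma opnorm_isom p q (A : 'M[C]_(p, q)) : A^t* *m A = 1%:M -> opnorm A <= 1.
Proof. by move=> h; apply: opnorm_sqr_le => //; rewrite h expr1n opnorm1. Qed.

Lemma opnorm_mxtrace n (A : 'M[C]_n) :
  `|complex.Re (\tr A)| <= n%:R * opnorm A.
Proof.
rewrite /mxtrace raddf_sum (le_trans (ler_norm_sum _ _ _)) //.
rewrite -[X in X%:R * _](card_ord n) mulr_natl -sumr_const.
apply: ler_sum => i _ /=.
have -> : complex.Re (A i i) = rdot (A *m delta_mx i 0) (delta_mx i 0).
  by rewrite rdot_delta -colE mxE.
by rewrite (le_trans (rdot_abs_le _ _)) // !l2norm_delta mulr1 (le_trans (le_opnorm _ _)) // l2norm_delta mulr1.
Qed.

End OperatorNorm.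

Opaque rdot l2norm opnorm.

(** * Norms of positive matrices, rounding to projections, comparison of ranks *)

Section NearProjections.
Context {R : realType}.
Local Notation C := (R[i]).
Implicit Types (n p q r : nat) (c : R).

(** In the application u = <Ex, x>, v = |Ex|^2 and w = <E Ex, Ex>. *)
Lemma quadratic_bound (c u v w : R) : 0 < c -> w <= c * v ->
  0 <= u - c^-1 * v + (- (c^-1 * v) - - (c^-1 * (c^-1 * w))) -> v <= c * u.
Proof.
move=> c0 hw h.
have h3 : c^-1 * (c^-1 * w) <= c^-1 * v.
  by rewrite ler_pM2l ?invr_gt0 // mulrC ler_pdivrMr // mulrC.
have h4 : c^-1 * v <= u by lra.
by rewrite mulrC ler_pdivrMr // in h4; rewrite mulrC.
Qed.

(** Positivity of E at x - c^-1 E x, with the term cubic in E bounded by E <= c at the vector E x,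
    gives |E x|^2 <= c <E x, x>. No spectral decomposition is involved. *)
Lemma opnorm_psd n (E : 'M[C]_n) c : 0 < c -> E^t* = E ->
  (forall x, 0 <= rdot (E *m x) x) -> (forall x, rdot (E *m x) x <= c * rdot x x) ->
  opnorm E <= c.
Proof.
move=> c0 Eh E0 Ec; apply: opnorm_le => [|x]; first exact: ltW.
set y := E *m x.
have yE : y = E *m x by []; move: y yE => y yE.
have h := E0 (x - c^-1%:C *: y).
have ysq : rdot (E *m y) x = rdot y y by rewrite rdot_adjr Eh yE.
rewrite mulmxBr -scalemxAr -yE !(rdotDl, rdotDr, rdotNl, rdotNr, rdotZl, rdotZr) ysq in h.
have h1 := Ec y; have h2 := Ec x; rewrite -yE in h2; clear E0 Ec Eh.
have {h h1 ysq} h := quadratic_bound c0 h1 h.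
rewrite -(@ler_pXn2r _ 2) ?nnegrE ?mulr_ge0 ?l2norm_ge0 ?(ltW c0) //.
rewrite exprMn !l2norm_sqr; apply: le_trans h _.
by rewrite expr2 -mulrA ler_pM2l.
Qed.

Lemma opnorm_diag n (D : 'rV[C]_n) c : 0 <= c ->
  (forall i, Normc.normc (D 0 i) <= c) -> opnorm (diag_mx D) <= c.
Proof.
move=> c0 h; apply: opnorm_le => // x.
rewrite -(@ler_pXn2r _ 2) ?nnegrE ?mulr_ge0 ?l2norm_ge0 //.
rewrite exprMn !l2norm_sqrE mulr_sumr; apply: ler_sum => i _.
rewrite mul_diag_mx mxE Normc.normcM exprMn ler_wpM2r ?sqr_ge0 //.
by rewrite ler_pXn2r ?nnegrE //; case: (D 0 i) => ? ?; exact: sqrtr_ge0.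
Qed.

Lemma opnorm_entry n (D : 'rV[C]_n) i : Normc.normc (D 0 i) <= opnorm (diag_mx D).
Proof.
have := le_opnorm (diag_mx D) (delta_mx i 0); rewrite l2norm_delta mulr1.
apply: le_trans; have := l2norm_coord (diag_mx D *m delta_mx i 0) i.
by rewrite mul_diag_mx !mxE !eqxx mulr1.
Qed.

Lemma half_mul_le (z e : R) : 2^-1 * z <= e -> z <= 2 * e.
Proof. by lra. Qed.

Lemma half_le_dist1 (z : R) : z <= 2^-1 -> 2^-1 <= `|z - 1|.
Proof. by move=> h; rewrite distrC; apply: le_trans (ler_norm _); lra. Qed.

Lemma hermitian_diag n (Y : 'M[C]_n) : Y^t* = Y ->
  exists (P : 'M[C]_n) (l : 'I_n -> R), [/\ P *m P^t* = 1%:M, P^t* *m P = 1%:M &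
    Y = P^t* *m diag_mx (\row_i (l i)%:C) *m P].
Proof.
move=> Yh; have Yherm : Y \is hermsymmx by apply/is_hermitianmxP; rewrite expr0 scale1r Yh.
have Pu : spectralmx Y \is unitarymx by exact: spectral_unitarymx.
exists (spectralmx Y), (fun i => complex.Re (spectral_diag Y 0 i)); split.
- exact/unitarymxP.
- by rewrite -invmx_unitary // mulVmx // unitarymx_unit.
have -> : \row_i (complex.Re (spectral_diag Y 0 i))%:C = spectral_diag Y.
  apply/rowP => i; rewrite mxE.
  have /mxOverP /(_ 0 i) := hermitian_spectral_diag_real Yherm.
  by move/complex_realP => [x ->].
by rewrite -invmx_unitary //; apply/orthomx_spectralP; exact: hermitian_normalmx.
Qed.

(** The eigenvalues are nonnegative, so the largest is at most their sum. A positive matrix of small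
    trace is thus small in norm, whatever its size. *)
Lemma opnorm_psd_trace n (Y : 'M[C]_n) : Y^t* = Y ->
  (forall x, 0 <= rdot (Y *m x) x) -> opnorm Y <= complex.Re (\tr Y).
Proof.
move=> /hermitian_diag [P [l [PP PP' ->]]] Y0.
have l0 i : 0 <= l i.
  have := Y0 (P^t* *m delta_mx i 0); congr (_ <= _).
  have Px : P *m (P^t* *m delta_mx i 0) = delta_mx i 0 :> 'cV_n by rewrite mulmxA PP mul1mx.
  rewrite -!mulmxA Px rdot_adjr trmxCK Px.
  by rewrite rdot_delta -colE !mxE eqxx mulr1n.
rewrite mxtrace_mulC mulmxA PP mul1mx mxtrace_diag raddf_sum /=.
have -> : \sum_i complex.Re ((\row_i (l i)%:C : 'rV[C]_n) 0 i) = \sum_i l i.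
  by apply: eq_bigr => i _; rewrite mxE.
have s0 : 0 <= \sum_i l i by apply: sumr_ge0.
apply: (@le_trans _ _ (1 * (\sum_i l i) * 1)); last by rewrite mul1r mulr1.
apply: opnormM_le; last exact: opnorm_isom.
apply: opnormM_le; first by rewrite opnorm_adj; exact: opnorm_isom.
apply: opnorm_diag => // i; rewrite mxE /= expr0n /= addr0 sqrtr_sqr ger0_norm //.
by rewrite (bigD1 i) //= lerDl sumr_ge0.
Qed.

(** Diagonalize and round the eigenvalues at 1/2. An eigenvalue l satisfies |l| |l - 1| <= eta, and
    the factor other than the distance to the rounded value is at least 1/2, so rounding moves l by
    at most 2 eta, with no smallness condition on eta. The rows of [U] are the rows of the
    diagonalizing unitary that are kept, so [r] is the rank. *)
Lemma near_projection n (Y : 'M[C]_n) eta : Y^t* = Y -> opnorm (Y *m Y - Y) <= eta ->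
  exists r (U : 'M[C]_(r, n)), U *m U^t* = 1%:M /\ opnorm (U^t* *m U - Y) <= 2 * eta.
Proof.
move=> Yh hY; have eta0 : 0 <= eta := le_trans (opnorm_ge0 _) hY.
have [P [l [PP PP' Yeq]]] := hermitian_diag Yh.
set sp := \row_i (l i)%:C in Yeq.
have spE i : sp 0 i = (l i)%:C by rewrite mxE.
have Pn : opnorm P <= 1 by apply: opnorm_isom.
have Pn' : opnorm (P^t*) <= 1 by rewrite opnorm_adj.
have hl i : `|l i ^+ 2 - l i| <= eta.
  have -> : `|l i ^+ 2 - l i| = Normc.normc ((\row_j ((l j) ^+ 2 - l j)%:C) 0 i).
    by rewrite mxE /= expr0n /= addr0 sqrtr_sqr.
  apply: le_trans (opnorm_entry _ i) _.
  have -> : diag_mx (\row_j ((l j) ^+ 2 - l j)%:C) = P *m (Y *m Y - Y) *m P^t*.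
    rewrite mulmxBr mulmxBl Yeq !mulmxA PP mul1mx -!mulmxA (mulmxA P (P^t*)) PP mul1mx.
    rewrite !mulmx1 !mul_diag_mx.
    apply/matrixP => i' j'; rewrite !mxE.
    by case: (i' == j'); rewrite /= ?mulr1n ?mulr0n // ?mulr0 ?subrr //; simpc; congr (_ +i* _); ring.
  rewrite (le_trans (opnormM_le (opnormM_le Pn hY) Pn')) //.
  by rewrite mul1r mulr1.
pose A := [pred i : 'I_n | 2^-1 < l i].
pose U := rowsub (enum_val : 'I_#|A| -> 'I_n) P.
exists #|A|, U; split.
  apply/matrixP => i j; rewrite mxE.
  have /matrixP /(_ (enum_val i) (enum_val j)) := PP.
  rewrite !mxE (inj_eq enum_val_inj) => <-.
  by apply: eq_bigr => k _; rewrite !mxE.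
have -> : U^t* *m U = P^t* *m diag_mx (\row_i ((2^-1 < l i)%R%:R : R)%:C) *m P.
  apply/matrixP => i j; rewrite mul_mx_diag !mxE.
  under eq_bigr do rewrite !mxE.
  rewrite -(big_enum_val (fun k => (P k i)^* * P k j)) big_mkcond.
  apply: eq_bigr => k _; rewrite !mxE !inE.
  by case: ifP => _; rewrite ?mulr1 ?mulr0 ?mul0r.
rewrite Yeq -mulmxBl -mulmxBr.
apply: (@le_trans _ _ (1 * (2 * eta) * 1)); last by rewrite mul1r mulr1.
apply: opnormM_le => //; apply: opnormM_le => //.
have -> : diag_mx (\row_i ((2^-1 < l i)%R%:R : R)%:C) - diag_mx sp =
          diag_mx (\row_i (((2^-1 < l i)%R%:R : R) - l i)%:C).
  rewrite -raddfB; congr diag_mx; apply/rowP => i; rewrite !mxE.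
  by rewrite raddfB.
apply: opnorm_diag => [|i]; first by rewrite mulr_ge0.
rewrite mxE /= expr0n /= addr0 sqrtr_sqr.
have := hl i; rewrite expr2 -[X in _ - X]mulr1 -mulrBr normrM.
case: ltP => hi /=.
  rewrite (distrC 1) => h; have l0 : 2^-1 <= `|l i| by rewrite (le_trans (ltW hi)) // ler_norm.
  by apply: half_mul_le; apply: le_trans h; rewrite ler_wpM2r.
rewrite sub0r normrN => h.
have l0 := half_le_dist1 hi.
by apply: half_mul_le; apply: le_trans h; rewrite mulrC ler_wpM2l.
Qed.

Lemma l2norm_isom p q (A : 'M[C]_(p, q)) x : A^t* *m A = 1%:M ->
  l2norm (A *m x) = l2norm x.
Proof.
move=> h; apply/eqP; rewrite -(@eqrXn2 _ 2) ?l2norm_ge0 // !l2norm_sqr.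
by rewrite rdot_adjl mulmxA h mul1mx.
Qed.

Lemma mx_inj_leq p q (M : 'M[C]_(p, q)) :
  (forall x : 'cV_q, M *m x = 0 -> x = 0) -> (q <= p)%N.
Proof.
move=> h; have : row_free M^T.
  rewrite -kermx_eq0; apply/eqP/row_matrixP => i; rewrite row0.
  have /(congr1 trmx) : row i (kermx M^T) *m M^T = 0 by rewrite -row_mul mulmx_ker row0.
  by rewrite trmx_mul trmxK trmx0 => /h /(congr1 trmx); rewrite trmxK trmx0.
by rewrite /row_free => /eqP <-; exact: rank_leq_col.
Qed.

(** If U1 V U0^* kills y, put x = U0^* y and z = V x. Then U1 z = 0, so V V^* z is small against z,
    while V^* z is close to x. The inequalities [c1] to [c4] yield (3/4)|x| <= |V^* z| and |V^* z|^2
    <= (1/4)(5/4)|x|^2, which forces x = 0. *)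
Lemma near_isometry_rank_le n0 n1 r0 r1 (U0 : 'M[C]_(r0, n0)) (U1 : 'M[C]_(r1, n1))
    (V : 'M[C]_(n1, n0)) :
  U0 *m U0^t* = 1%:M ->
  opnorm (V^t* *m V - U0^t* *m U0) <= 4^-1 ->
  opnorm (V *m V^t* - U1^t* *m U1) <= 4^-1 -> (r0 <= r1)%N.
Proof.
move=> hU0 h0 h1; apply: (@mx_inj_leq _ _ (U1 *m V *m U0^t*)) => y My.
pose x := U0^t* *m y; pose z := V *m x.
have xy : l2norm x = l2norm y by apply: l2norm_isom; rewrite trmxCK.
have Ux : U0^t* *m U0 *m x = x by rewrite /x mulmxA -(mulmxA (U0^t*)) hU0 mulmx1.
have Uz : U1 *m z = 0 by rewrite /z /x !mulmxA.
have b0 : l2norm (V^t* *m z - x) <= 4^-1 * l2norm x.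
  by rewrite /z mulmxA -[X in _ - X]Ux -mulmxBl; exact: opnorm_bound.
have b1 : l2norm (V *m V^t* *m z) <= 4^-1 * l2norm z.
  rewrite -[X in l2norm X](_ : (V *m V^t* - U1^t* *m U1) *m z = _).
    exact: opnorm_bound.
  by rewrite mulmxBl -(mulmxA (U1^t*)) Uz mulmx0 subr0.
have x0 := l2norm_ge0 x; have z0 := l2norm_ge0 z.
have v0 := l2norm_ge0 (V^t* *m z).
have c1 : l2norm (V^t* *m z) ^+ 2 <= 4^-1 * l2norm z ^+ 2.
  rewrite l2norm_sqr rdot_adjl trmxCK mulmxA (le_trans (rdot_le _ _)) //.
  by rewrite expr2 mulrA ler_wpM2r.
have c2 : l2norm z ^+ 2 <= l2norm (V^t* *m z) * l2norm x.
  by rewrite l2norm_sqr {1}/z rdot_adjr rdotC rdot_le.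
have c3 : 3 / 4 * l2norm x <= l2norm (V^t* *m z).
  have := l2normD (V^t* *m z - x) (- (V^t* *m z)).
  rewrite addrAC subrr sub0r !l2normN; lra.
have c4 : l2norm (V^t* *m z) <= 5 / 4 * l2norm x.
  have := l2normD (V^t* *m z - x) x; rewrite subrK; lra.
have : l2norm x ^+ 2 <= 0 by nra.
move=> h; apply: l2norm_eq0; rewrite -xy; apply/eqP.
by rewrite -sqrf_eq0 eq_le h sqr_ge0.
Qed.

Lemma near_isometry_rank n0 n1 r0 r1 (U0 : 'M[C]_(r0, n0)) (U1 : 'M[C]_(r1, n1))
    (V : 'M[C]_(n1, n0)) :
  U0 *m U0^t* = 1%:M -> U1 *m U1^t* = 1%:M ->
  opnorm (V^t* *m V - U0^t* *m U0) <= 4^-1 ->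
  opnorm (V *m V^t* - U1^t* *m U1) <= 4^-1 -> r0 = r1.
Proof.
move=> h0 h1 h2 h3; apply/eqP; rewrite eqn_leq (near_isometry_rank_le h0 h2 h3) /=.
by apply: (@near_isometry_rank_le _ _ _ _ U1 U0 (V^t*)); rewrite ?trmxCK.
Qed.

End NearProjections.

(** * Completeness of scalars and matrices *)

Section Completeness.
Context {R : realType}.
Local Notation C := (R[i]).

(** [nu] is an arbitrary real-valued function, to be instantiated with the real norm, [Normc.normc],
    [l2norm] and [opnorm] alike. *)
Definition cauchy_in (T : zmodType) (nu : T -> R) (u : nat -> T) : Prop :=
  forall eps : R, 0 < eps -> exists n0 : nat, forall m n, (n0 <= m)%N -> (n0 <= n)%N ->
    nu (u m - u n) < eps.

Definition tends_in (T : zmodType) (nu : T -> R) (u : nat -> T) (l : T) : Prop :=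
  forall eps : R, 0 < eps -> exists n0 : nat, forall n, (n0 <= n)%N -> nu (u n - l) < eps.

Lemma cauchy_real (u : nat -> R) : cauchy_in Num.norm u ->
  exists l, tends_in Num.norm u l.
Proof.
move=> hu; have /cvg_ex [l hl] : cvg (u @ \oo).
  apply: cauchy_cvg; apply/cauchy_ballP => eps eps0.
  have [n0 h] := hu _ eps0; exists ([set u n | n in [set n | (n0 <= n)%N]], [set u n | n in [set n | (n0 <= n)%N]]) => /=.
    by split; exists n0 => // n hn; exists n.
  by move=> [_ _] /= [[m hm <-] [n hn <-]]; exact: h.
exists l => eps eps0; move/cvgrPdist_lt : hl => /(_ _ eps0) [n0 _ h].
by exists n0 => n hn; rewrite distrC; exact: h.
Qed.

Lemma normc_ge_abs (z : C) :
  (`|complex.Re z| <= Normc.normc z) /\ (`|complex.Im z| <= Normc.normc z).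
Proof.
case: z => a b /=; rewrite -!sqrtr_sqr !ler_sqrt ?addr_ge0 ?sqr_ge0 //.
by rewrite lerDl lerDr !sqr_ge0.
Qed.

Lemma normc_le_sum (z : C) :
  Normc.normc z <= `|complex.Re z| + `|complex.Im z|.
Proof.
case: z => a b /=; rewrite -(@ler_pXn2r _ 2) ?nnegrE ?sqrtr_ge0 ?addr_ge0 //.
rewrite sqr_sqrtr ?addr_ge0 ?sqr_ge0 // sqrrD !real_normK ?num_real //.
by rewrite -addrA lerD2l lerDr mulrn_wge0 // mulr_ge0.
Qed.

Lemma cauchy_complex (u : nat -> C) : cauchy_in (@Normc.normc R) u ->
  exists l, tends_in (@Normc.normc R) u l.
Proof.
move=> hu.
have [a ha] : exists l, tends_in Num.norm (fun n => complex.Re (u n)) l.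
  apply: cauchy_real => eps /hu [n0 h]; exists n0 => m n hm hn.
  by rewrite -raddfB (le_lt_trans _ (h m n hm hn)) //; have [] := normc_ge_abs (u m - u n).
have [b hb] : exists l, tends_in Num.norm (fun n => complex.Im (u n)) l.
  apply: cauchy_real => eps /hu [n0 h]; exists n0 => m n hm hn.
  by rewrite -raddfB (le_lt_trans _ (h m n hm hn)) //; have [] := normc_ge_abs (u m - u n).
exists (a +i* b) => eps eps0; have e2 : 0 < eps / 2 by rewrite divr_gt0.
have [n0 h0] := ha _ e2; have [n1 h1] := hb _ e2.
exists (maxn n0 n1) => n; rewrite geq_max => /andP[hn0 hn1].
rewrite (le_lt_trans (normc_le_sum _)) //= !raddfB /=.
by rewrite [ltRHS]splitr ltrD ?h0 ?h1.
Qed.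

Lemma cauchy_mx p q (u : nat -> 'M[C]_(p, q)) :
  (forall i j, cauchy_in (@Normc.normc R) (fun n => u n i j)) ->
  exists l : 'M[C]_(p, q), forall i j, tends_in (@Normc.normc R) (fun n => u n i j) (l i j).
Proof.
move=> hu; have /choice [f hf] (ij : 'I_p * 'I_q) :
    exists l, tends_in (@Normc.normc R) (fun n => u n ij.1 ij.2) l.
  by apply: cauchy_complex; exact: hu.
by exists (\matrix_(i, j) f (i, j)) => i j; rewrite mxE; exact: (hf (i, j)).
Qed.

End Completeness.

(** * Spectral gap and Schur's lemma *)

Section KazhdanGap.
Context {R : realType}.
Local Notation C := (R[i]).

Lemma l2norm_le_sum n (x : 'cV[C]_n) : l2norm x <= \sum_i Normc.normc (x i 0).
Proof.
have -> : l2norm x = l2norm (\sum_i x i 0 *: (delta_mx i 0 : 'cV[C]_n)).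
  by congr l2norm; rewrite {1}[x]matrix_sum_delta; apply: eq_bigr => i _; rewrite big_ord1.
apply: le_trans (l2norm_sum _ _ _) _; apply: ler_sum => i _.
by rewrite l2normZc l2norm_delta mulr1.
Qed.

Lemma tends_in_l2norm n (u : nat -> 'cV[C]_n) (l : 'cV[C]_n) :
  (forall i, tends_in (@Normc.normc R) (fun k => u k i 0) (l i 0)) ->
  tends_in (@l2norm R n) u l.
Proof.
move=> h eps eps0; pose e := eps / n.+1%:R.
have e0 : 0 < e by rewrite divr_gt0.
have /choice [f hf] i := h i e e0.
exists (\max_i f i)%N => k hk; apply: le_lt_trans (l2norm_le_sum _) _.
apply: (@le_lt_trans _ _ (\sum_(i < n) e)).
  apply: ler_sum => i _; rewrite !mxE; apply/ltW/hf.
  by apply: leq_trans hk; exact: leq_bigmax.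
rewrite sumr_const card_ord -mulr_natl /e mulrA ltr_pdivrMr // mulrC.
by rewrite ltr_pM2l // ltr_nat.
Qed.

Lemma cauchy_l2norm n (u : nat -> 'cV[C]_n) :
  cauchy_in (@l2norm R n) u -> exists l, tends_in (@l2norm R n) u l.
Proof.
move=> hu; have [i j|l hl] := @cauchy_mx _ _ _ u.
  move=> eps /hu [n0 h]; exists n0 => k m hk hm; rewrite (ord1 j).
  by apply: le_lt_trans (h _ _ hk hm); have := l2norm_coord (u k - u m) i; rewrite !mxE.
by exists l; apply: tends_in_l2norm => i; exact: hl.
Qed.

Lemma rdot_trmx n (x y : 'rV[C]_n) : rdot x^T y^T = complex.Re ((x *m y^t*) 0 0).
Proof.
by rewrite rdotE mxE raddf_sum; apply: eq_bigr => i _; rewrite !mxE.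
Qed.

Lemma form_norm_dotmx n (x : 'rV[C]_n) : form_norm (@dotmx C n) x = l2norm x^T.
Proof.
apply/eqP; rewrite -(@eqrXn2 _ 2) ?l2norm_ge0 ?sqrtr_ge0 // l2norm_sqr.
have -> : form_norm (@dotmx C n) x = Num.sqrt (complex.Re (dotmx x x)) by [].
by rewrite dotmxE -rdot_trmx sqr_sqrtr ?rdot_ge0.
Qed.

Lemma dotmx_complete n (u : nat -> 'rV[C]_n) :
  (forall eps : R, 0 < eps -> exists n0 : nat, forall k m : nat,
     (n0 <= k)%N -> (n0 <= m)%N -> form_norm (@dotmx C n) (u k - u m) < eps) ->
  exists l : 'rV[C]_n, form_norm (@dotmx C n) (u k - l) @[k --> \oo] --> (0 : R).
Proof.
move=> hu; have [eps|l hl] := @cauchy_l2norm n (fun k => (u k)^T).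
  move=> /hu [n0 h]; exists n0 => k m hk hm.
  by rewrite -raddfB -form_norm_dotmx; exact: h.
exists l^T; apply/cvgrPdist_lt => eps eps0; have [n0 h] := hl _ eps0.
exists n0 => // k hk; rewrite sub0r normrN form_norm_dotmx raddfB /= trmxK.
by rewrite ger0_norm ?l2norm_ge0 //; exact: h.
Qed.

(** [property_T] speaks of [hilbertSpace], so finite-dimensional spaces are repackaged here. The
    form [dotmx] lives on row vectors, whence the transposes in the sequel. *)
Definition fin_hilbert n : hilbertSpace R :=
  HilbertSpace (hcarrier := 'rV[C]_n) (hdot := @dotmx C n) (@dotmx_complete n).

(** Take K of maximal rank among matrices whose row space lies in P; a vector of P outside this row
    space would raise the rank. *)
Lemma subspace_mx n (P : 'rV[C]_n -> Prop) :
  P 0 -> (forall a u v, P u -> P v -> P (a *: u + v)) ->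
  exists K : 'M[C]_n, forall u, P u <-> (u <= K)%MS.
Proof.
move=> P0 PD.
pose Q r := `[< exists2 K : 'M[C]_n, \rank K = r & forall u : 'rV_n, (u <= K)%MS -> P u >].
have Q0 : exists r, Q r.
  exists 0%N; apply/asboolP; exists 0; first by rewrite mxrank0.
  by move=> u; rewrite submx0 => /eqP ->.
have Qn r : Q r -> (r <= n)%N by move=> /asboolP [K <- _]; exact: rank_leq_row.
have [r /asboolP [K Kr KP] Kmax] := ex_maxnP Q0 Qn.
exists K => u; split=> [Pu|]; last exact: KP.
have : (\rank (K + u)%MS <= r)%N.
  apply: Kmax; apply/asboolP; exists (K + u)%MS => // v /sub_addsmxP [[a b] /= ->].
  rewrite (mx11_scalar b) mul_scalar_mx addrC; apply: PD => //.
  by apply: KP; exact: submxMl.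
rewrite -Kr => le; have := mxrank_leqif_sup (addsmxSl K u).
move=> /leqifP; case: ifP => [h _|_].
  by apply: submx_trans h; exact: addsmxSr.
by rewrite ltnNge le.
Qed.

(** The multiple c = 1 gives the real part and c = i the imaginary part. *)
Lemma rdot_complex n (x u : 'cV[C]_n) :
  (forall c : C, rdot x (c *: u) = 0) -> u^t* *m x = 0.
Proof.
move=> h; apply/matrixP => i j; rewrite !ord1 [RHS]mxE {i j}.
have := h 1; have := h 'i%C; rewrite !rdot_def !trmxC_scale -!scalemxAl.
move: (u^t* *m x) => w; rewrite !mxE; case: (w 0 0) => a b /=; rewrite !(oppr0, mul0r, mul1r, sub0r, subr0, mulN1r, opprK).
by move=> -> ->.
Qed.

(** Property (T) is applied to the subrepresentation on the orthogonal complement of the invariant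
    vectors. It has no nonzero invariant vector, so none of its nonzero vectors, in particular not
    x, is almost invariant. *)
Lemma no_invariant_displacement (G : groupType) n (rho : G -> 'M[C]_n)
    (Q : seq G) (eps : R) :
  (forall (H : hilbertSpace R) (rho : G -> {linear H -> H}),
      unitary_rep rho ->
      (exists2 x : H, x <> 0 &
         forall g, g \in Q -> hnorm (rho g x - x) < eps * hnorm x) ->
      exists2 x : H, x <> 0 & forall g, rho g x = x) ->
  mx_unitary_rep rho -> forall x : 'cV[C]_n, x <> 0 ->
  (forall u, (forall g, rho g *m u = u) -> rdot x u = 0) ->
  exists2 g, g \in Q & eps * l2norm x <= l2norm (rho g *m x - x).
Proof.
move=> HT [rho1 rhoM rhoU] x x0 xinv; apply: contrapT => hcontra.
have small g : g \in Q -> l2norm (rho g *m x - x) < eps * l2norm x.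
  by move=> gQ; rewrite ltNge; apply/negP => h; apply: hcontra; exists g.
have [K KP] : exists K : 'M[C]_n, forall u : 'rV_n,
    (forall g, u *m (rho g)^T = u) <-> (u <= K)%MS.
  apply: subspace_mx => [g|a u v hu hv g]; first by rewrite mul0mx.
  by rewrite mulmxDl -scalemxAl hu hv.
have TU g : (rho g)^T *m ((rho g)^T)^t* = 1%:M.
  by apply/unitarymxP; rewrite trmx_unitary.
have KT g : K *m (rho g)^T = K.
  apply/row_matrixP => i; rewrite row_mul.
  by have /KP -> : (row i K <= K)%MS by exact: row_sub.
have TK g : (rho g)^T *m K^t* = K^t*.
  by rewrite -[in LHS](KT g) trmxC_mul mulmxA TU mul1mx.
(* The rows of [V] are an orthonormal basis of the complement of the invariant vectors, and [M g]
   below is the representation in this basis. It acts on rows from the right, and the transposition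
   in [M] restores the order of products. *)
pose L := kermx (K^t*); pose V := schmidt (row_base L).
have VU : V *m V^t* = 1%:M by apply/unitarymxP/schmidt_unitarymx/rank_leq_col.
have VL : (V :=: L)%MS.
  apply: eqmx_trans (eq_row_base L); apply: eqmx_schmidt_free; exact: row_base_free.
have VK p (w : 'M[C]_(p, n)) : w *m K^t* = 0 -> w *m V^t* *m V = w.
  move=> hw; have : (w <= V)%MS by rewrite VL; apply/sub_kermxP.
  by case/submxP => a ->; rewrite -(mulmxA a) VU mulmx1.
have V0 : V *m K^t* = 0 by apply/sub_kermxP; rewrite -/L -VL submx_refl.
pose M g := V *m (rho g)^T *m V^t*.
have MV g : M g *m V = V *m (rho g)^T by apply: VK; rewrite -mulmxA TK.
have MM g h : M (g * h)%g = M h *m M g.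
  have -> : M h *m M g = M h *m V *m (rho g)^T *m V^t* by rewrite /M !mulmxA.
  by rewrite MV /M rhoM trmx_mul !mulmxA.
pose rhoH g : {linear fin_hilbert (\rank L) -> fin_hilbert (\rank L)} := mulmxr (M g).
have rhoHE g (y : 'rV_(\rank L)) : rhoH g y = y *m M g by [].
have [||y y0 yinv] := HT (fin_hilbert (\rank L)) rhoH.
- split=> [y|g h y|g y z].
  + by rewrite rhoHE /M rho1 trmx1 mulmx1 VU mulmx1.
  + have step (z : 'rV_(\rank L)) : z *m M (g * h)%g = z *m M h *m M g.
      by rewrite MM mulmxA.
    exact: step.
  + rewrite !rhoHE /= !dotmxE trmxC_mul mulmxA -(mulmxA y).
    suff -> : M g *m (M g)^t* = 1%:M by rewrite mulmx1.
    rewrite {2}/M trmxC_mul trmxCK mulmxA MV trmxC_mul mulmxA -(mulmxA V).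
    by rewrite TU mulmx1.
- have xK : x^T *m K^t* = 0.
    apply/matrixP => i j; rewrite ord1 [RHS]mxE {i}.
    have /rdot_complex h : forall c, rdot x (c *: (row j K)^T) = 0.
      move=> c; apply: xinv => g; rewrite -scalemxAr; congr (_ *: _).
      by apply: trmx_inj; rewrite trmx_mul trmxK -row_mul KT.
    have := congr1 (fun N : 'M[C]_1 => N 0 0) h; rewrite [in RHS]mxE => h0.
    rewrite -[RHS]h0 !mxE; apply: eq_bigr => k _; by rewrite !mxE mulrC.
  have nE (w : 'rV[C]_n) : w *m K^t* = 0 ->
      hnorm (w *m V^t* : fin_hilbert (\rank L)) = l2norm w^T.
    move=> hw; rewrite -form_norm_dotmx /hnorm /form_norm /= !dotmxE.
    by rewrite trmxC_mul trmxCK mulmxA VK.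
  exists (x^T *m V^t*) => [h|g gQ].
    by apply: x0; apply: trmx_inj; rewrite -(VK _ _ xK) h mul0mx trmx0.
  rewrite rhoHE (_ : _ - _ = (rho g *m x - x)^T *m V^t*); last first.
    by rewrite raddfB /= mulmxBl trmx_mul /M !mulmxA VK.
  rewrite !nE ?trmxK //; first exact: small.
  by rewrite raddfB /= mulmxBl xK subr0 trmx_mul -mulmxA TK.
pose u := y *m V.
(* The invariant vector found by property (T), seen in the full space, lies both among the invariant
   vectors and in their complement. *)
have uK : (u <= K)%MS by apply/KP => g; rewrite /u -mulmxA -MV mulmxA -rhoHE yinv.
have u0 : u = 0.
  case/submxP: uK => a ua; apply: trmx_inj; rewrite trmx0; apply: l2norm_eq0; apply/eqP.
  rewrite -sqrf_eq0 l2norm_sqr rdot_trmx.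
  by rewrite {2}ua trmxC_mul mulmxA /u -(mulmxA y) V0 mulmx0 mul0mx mxE.
apply: y0; have : u *m V^t* = y by rewrite /u -mulmxA VU mulmx1.
by rewrite u0 mul0mx.
Qed.

(** One [kappa] for representations of every dimension: this uniformity is what property (T)
    contributes to the whole argument. [S] is a list, so repetitions count. *)
Definition gap_bound (G : groupType) (S : seq G) (kappa : R) : Prop :=
  forall n (rho : G -> 'M[C]_n), mx_unitary_rep rho -> forall x : 'cV[C]_n,
    (forall u, (forall g, rho g *m u = u) -> rdot x u = 0) ->
    l2norm (\sum_(g <- S) rho g *m x) <= kappa * (size S)%:R * l2norm x.

(** Some g in Q moves x by at least eps |x|, so the parallelogram law gives |x + g x| <= t |x| with
    t^2 = 4 - eps^2. The identity is added to Q in order to have x to pair with g x; the other s - 2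
    terms are bounded trivially, and (t + s - 2) / s is the stated [kappa]. Cutting eps at 1 keeps t
    >= 1, so that [kappa] is nonnegative. *)
Lemma kazhdan_gap (G : groupType) : property_T R G ->
  exists (S : seq G) (kappa : R),
    [/\ (0 < size S)%N, 0 <= kappa, kappa < 1 & gap_bound S kappa].
Proof.
move=> [Q [eps0 [eps00 HT]]]; pose eps := Num.min eps0 1.
have epsp : 0 < eps by rewrite lt_min eps00 ltr01.
have eps1 : eps <= 1 by rewrite ge_min lexx orbT.
pose t := Num.sqrt (4 - eps ^+ 2).
have t2 : t ^+ 2 = 4 - eps ^+ 2 by rewrite sqr_sqrtr //; nra.
have t0 : 0 <= t by exact: sqrtr_ge0.
have tlt : t < 2 by nra.
pose s : R := (size Q).+1%:R.
have s1 : 1 <= s by rewrite ler1n.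
exists (1%g :: Q), (1 - (2 - t) / s); split=> //.
- rewrite subr_ge0 ler_pdivrMr ?(lt_le_trans ltr01) // mul1r.
  have : 1 <= t by nra.
  by lra.
- by rewrite ltrBlDr ltrDl divr_gt0 ?subr_gt0 // (lt_le_trans ltr01).
move=> n rho rhoR x xinv; have [rho1 rhoM rhoU] := rhoR.
have [->|/eqP x0] := eqVneq x 0.
  rewrite big1 ?l2norm0 ?mulr0 // => g _; exact: mulmx0.
have [g gQ hg] := no_invariant_displacement HT rhoR x0 xinv.
have nrm h : l2norm (rho h *m x) = l2norm x.
  apply: l2norm_isom; have /unitarymxP := rhoU h => /mulmx1C; exact.
rewrite big_cons rho1 mul1mx (big_rem g) //= addrA.
have hxg : l2norm (x + rho g *m x) <= t * l2norm x.
  rewrite -(@ler_pXn2r _ 2) ?nnegrE ?mulr_ge0 ?l2norm_ge0 // exprMn t2.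
  have e1 : l2norm (x + rho g *m x) ^+ 2 + l2norm (rho g *m x - x) ^+ 2 = 4 * l2norm x ^+ 2.
    have := nrm g => /(congr1 (fun z => z ^+ 2)); rewrite !l2norm_sqr => e.
    rewrite !(rdotDl, rdotDr, rdotNl, rdotNr) e (rdotC x (rho g *m x)).
    by move: (rdot x x) (rdot _ x) => a b; ring.
  have e2 : (eps * l2norm x) ^+ 2 <= l2norm (rho g *m x - x) ^+ 2.
    rewrite ler_pXn2r ?nnegrE ?mulr_ge0 ?l2norm_ge0 ?(ltW epsp) //.
    by apply: le_trans hg; rewrite ler_wpM2r ?l2norm_ge0 // ge_min lexx.
  rewrite exprMn in e2; move: e1 e2; move: (l2norm _ ^+ 2) (l2norm (_ - _) ^+ 2) (l2norm x ^+ 2) => a b c.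
  by move: (eps ^+ 2) => e; lra.
apply: le_trans (l2normD _ _) _.
have hrest : l2norm (\sum_(h <- rem g Q) rho h *m x) <= (s - 2) * l2norm x.
  apply: le_trans (l2norm_sum _ _ _) _.
  under eq_bigr do rewrite nrm.
  rewrite big_const_seq count_predT iter_addr addr0.
  have sQ : (0 < size Q)%N by case: (Q) gQ.
  rewrite size_rem // -[X in X <= _]mulr_natl; apply: ler_wpM2r; first exact: l2norm_ge0.
  by rewrite /s; case: (size Q) sQ => // k _ /=; rewrite -!natr1; lra.
apply: le_trans (lerD hxg hrest) _.
have sn : s != 0 by rewrite gt_eqF // (lt_le_trans ltr01).
rewrite -/s [X in _ <= X * _](_ : _ = s - (2 - t)); last by rewrite mulrBl mul1r mulfVK.
rewrite -mulrDl ler_wpM2r ?l2norm_ge0 //.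
by lra.
Qed.

End KazhdanGap.

Section Schur.
Context {R : realType} {G : groupType}.
Local Notation C := (R[i]).

Lemma schur_scalar n (rho : G -> 'M[C]_n) (B : 'M[C]_n) :
  mx_irreducible_rep rho -> (forall g, B *m rho g = rho g *m B) ->
  exists c : C, B = c%:M.
Proof.
move=> [n0 irr] comm.
have [a ha] := eigenvalue_closed B^T n0.
exists a; have [g| |full] := irr (eigenspace B^T a).
- apply/eigenspaceP; rewrite -mulmxA -trmx_mul comm trmx_mul mulmxA.
  have /eigenspaceP -> := submx_refl (eigenspace B^T a).
  by rewrite -scalemxAl.
- by move=> h; case/eigenvalueP: ha => v /eigenspaceP; rewrite /= -/(eigenspace _ _) h submx0 => ->.
have /eigenspaceP : (1%:M <= eigenspace B^T a)%MS by exact: submx_full.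
by rewrite mul1mx scalemx1 => /(congr1 trmx); rewrite trmxK tr_scalar_mx.
Qed.

Lemma unitary_rep_invl n (rho : G -> 'M[C]_n) g :
  mx_unitary_rep rho -> (rho g)^t* *m rho g = 1%:M.
Proof. by move=> [_ _ /(_ g) /unitarymxP /mulmx1C]. Qed.

Lemma adj_gram_diag p q (B : 'M[C]_(p, q)) j :
  exists2 c : R, 0 <= c & (B^t* *m B) j j = c%:C.
Proof.
exists (\sum_i Normc.normc (B i j) ^+ 2); first by apply: sumr_ge0 => i _; exact: sqr_ge0.
rewrite mxE raddf_sum; apply: eq_bigr => i _; rewrite !mxE.
case: (B i j) => a b /=; rewrite sqr_sqrtr ?addr_ge0 ?sqr_ge0 //.
by simpc; congr (_ +i* _); ring.
Qed.

Lemma adj_gram_eq0 p q (B : 'M[C]_(p, q)) : B^t* *m B = 0 -> B = 0.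
Proof.
move=> h; apply/matrixP => i j; rewrite mxE.
have : B *m delta_mx j 0 = 0 :> 'cV_p.
  apply: l2norm_eq0; apply/eqP; rewrite -sqrf_eq0 l2norm_sqr rdot_adjl mulmxA h.
  by rewrite mul0mx rdot0l.
by rewrite -colE => /matrixP /(_ i 0); rewrite !mxE.
Qed.

(** By unitarity the adjoint of B intertwines in the other direction, so B^* B and B B^* are
    scalars. If B were nonzero the two scalars would agree and a multiple of B would be a unitary
    equivalence. *)
Lemma schur_inequivalent n1 n2 (rho1 : G -> 'M[C]_n1) (rho2 : G -> 'M[C]_n2)
    (B : 'M[C]_(n2, n1)) :
  mx_unitary_rep rho1 -> mx_irreducible_rep rho1 ->
  mx_unitary_rep rho2 -> mx_irreducible_rep rho2 ->
  ~ mx_unitary_equiv rho1 rho2 ->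
  (forall g, B *m rho1 g = rho2 g *m B) -> B = 0.
Proof.
move=> U1 I1 U2 I2 neq comm.
have comm' g : rho1 g *m B^t* = B^t* *m rho2 g.
  have [_ _ /(_ g) /unitarymxP h1] := U1; have h2 := unitary_rep_invl g U2.
  have := congr1 (fun M => M^t*) (comm g); rewrite !trmxC_mul.
  move=> /(congr1 (fun M => rho1 g *m M *m rho2 g)).
  by rewrite !mulmxA h1 mul1mx -!mulmxA h2 mulmx1 => ->.
have [g|c hc] := @schur_scalar _ rho1 (B^t* *m B) I1.
  by rewrite -mulmxA comm !mulmxA comm'.
have [g|c' hc'] := @schur_scalar _ rho2 (B *m B^t*) I2.
  by rewrite -mulmxA -comm' !mulmxA comm.
apply: contrapT => /eqP Bn0; apply: neq.
have cc' : c = c'.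
  have : c *: B = c' *: B.
    by rewrite -!mul_scalar_mx -hc' -mulmxA hc mul_mx_scalar mul_scalar_mx.
  move/eqP; rewrite -subr_eq0 -scalerBl scaler_eq0 (negbTE Bn0) orbF subr_eq0.
  by move/eqP.
case: I1 => n1p _.
have [r r0 hr] := adj_gram_diag B (Ordinal n1p).
have {hr} cr : c = r%:C by rewrite -hr hc mxE eqxx mulr1n.
have rp : 0 < r.
  rewrite lt_neqAle r0 andbT eq_sym; apply: contraNneq Bn0 => rz.
  by apply/eqP/adj_gram_eq0; rewrite hc cr rz (_ : 0%:C = 0 :> C) // raddf0.
pose s := (Num.sqrt r)^-1.
have ss : s%:C * s%:C * r%:C = 1.
  rewrite -!rmorphM /= /s -expr2 exprVn sqr_sqrtr // mulVf ?gt_eqF //.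
exists (s%:C *: B); split=> [||g].
- by rewrite trmxC_scale -scalemxAl -scalemxAr scalerA hc cr conj_realC scale_scalar_mx ss.
- by rewrite trmxC_scale -scalemxAl -scalemxAr scalerA hc' -cc' cr conj_realC scale_scalar_mx ss.
- by rewrite -scalemxAl -scalemxAr comm.
Qed.

End Schur.

(** * Matrices over sequences *)

Section BlockVectors.
Context {R : realType}.
Local Notation C := (R[i]).

Lemma mxcol_adj p (p_ : 'I_p -> nat) (x : 'cV[C]_(\sum_i p_ i)) :
  x^t* = \mxrow_i (submxcol x i)^t*.
Proof.
by apply/matrixP => i j; rewrite !mxE tagnat.sig2K.
Qed.

Lemma mxblock_form p q (p_ : 'I_p -> nat) (q_ : 'I_q -> nat)
    (A : forall i j, 'M[C]_(p_ i, q_ j))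
    (x : 'cV[C]_(\sum_j q_ j)) (y : 'cV[C]_(\sum_i p_ i)) :
  y^t* *m (\mxblock_(i, j) A i j) *m x =
  \sum_i \sum_j (submxcol y i)^t* *m A i j *m submxcol x j.
Proof.
rewrite -mulmxA -{1}(submxcolK x) mul_mxblock_mxrow mxcol_adj mul_mxrow_mxcol.
by apply: eq_bigr => i _; rewrite mulmx_sumr; apply: eq_bigr => j _; rewrite mulmxA.
Qed.

Lemma rdot_mxblock p q (p_ : 'I_p -> nat) (q_ : 'I_q -> nat)
    (A : forall i j, 'M[C]_(p_ i, q_ j)) x y :
  rdot ((\mxblock_(i, j) A i j) *m x) y =
  \sum_i \sum_j rdot (A i j *m submxcol x j) (submxcol y i).
Proof.
rewrite rdot_def mulmxA mxblock_form summxE raddf_sum; apply: eq_bigr => i _.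
rewrite summxE raddf_sum; apply: eq_bigr => j _.
by rewrite rdot_def mulmxA.
Qed.

Lemma mxblock_adj p q (p_ : 'I_p -> nat) (q_ : 'I_q -> nat)
    (A : forall i j, 'M[C]_(p_ i, q_ j)) :
  (\mxblock_(i, j) A i j)^t* = \mxblock_(i, j) (A j i)^t*.
Proof. by apply/matrixP => i j; rewrite !mxE. Qed.

Lemma rdot_submxcol p (p_ : 'I_p -> nat) (x y : 'cV[C]_(\sum_i p_ i)) :
  rdot x y = \sum_i rdot (submxcol x i) (submxcol y i).
Proof.
rewrite rdot_def mxcol_adj -{1}(submxcolK x) mul_mxrow_mxcol summxE raddf_sum.
by apply: eq_bigr => i _; rewrite rdot_def.
Qed.

Lemma l2norm_submxcol p (p_ : 'I_p -> nat) (x : 'cV[C]_(\sum_i p_ i)) i :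
  l2norm (submxcol x i) <= l2norm x.
Proof.
rewrite -(@ler_pXn2r _ 2) ?nnegrE ?l2norm_ge0 // !l2norm_sqr rdot_submxcol.
by rewrite (bigD1 i) //= lerDl sumr_ge0 // => j _; exact: rdot_ge0.
Qed.

End BlockVectors.

Section MatricesOverSequences.
Context {R : realType} {N : nat -> nat}.
Local Notation C := (R[i]).
Local Notation X := (mxseq R N).
Implicit Types (a c : X) (p q r n m : nat).

Lemma ms_sumE I (s : seq I) (P : pred I) (F : I -> X) m :
  (\sum_(i <- s | P i) F i) m = \sum_(i <- s | P i) F i m.
Proof. by elim/big_rec2: _ => // i u v _ <-. Qed.

Lemma ms_scaleAl (z : C) a c : z *: (a * c) = (z *: a) * c.
Proof. by apply: functional_extensionality_dep => m; exact: scalemxAl. Qed.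

Lemma ms_scaleAr (z : C) a c : z *: (a * c) = a * (z *: c).
Proof. by apply: functional_extensionality_dep => m; exact: scalemxAr. Qed.

Lemma ms_adjK : involutive (@ms_adj R N).
Proof. by move=> a; apply: functional_extensionality_dep => m; exact: trmxCK. Qed.

Lemma ms_adjM a c : ms_adj (a * c) = ms_adj c * ms_adj a.
Proof. by apply: functional_extensionality_dep => m; exact: trmxC_mul. Qed.

Lemma ms_adjD a c : ms_adj (a + c) = ms_adj a + ms_adj c.
Proof. by apply: functional_extensionality_dep => m; exact: trmxC_add. Qed.

Lemma ms_adjZ (z : C) a : ms_adj (z *: a) = z^* *: ms_adj a.
Proof. by apply: functional_extensionality_dep => m; exact: trmxC_scale. Qed.

Lemma ms_adj1 : ms_adj (1 : X) = 1.
Proof.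
apply: functional_extensionality_dep => m.
by rewrite /ms_adj (_ : (1 : X) m = 1%:M) // trmxC_scalar rmorph1.
Qed.

Lemma ms_adj0 : ms_adj (0 : X) = 0.
Proof.
apply: functional_extensionality_dep => m.
by rewrite /ms_adj (_ : (0 : X) m = 0) // trmx0 map_mx0.
Qed.

Lemma ms_adj_sum I (s : seq I) (P : pred I) (F : I -> X) :
  ms_adj (\sum_(i <- s | P i) F i) = \sum_(i <- s | P i) ms_adj (F i).
Proof. by elim/big_rec2: _ => [|i u v _ <-]; rewrite ?ms_adj0 ?ms_adjD. Qed.

Definition adjX p q (a : 'M[X]_(p, q)) : 'M[X]_(q, p) := \matrix_(i, j) ms_adj (a j i).

(** This is M (x) 1, a scalar matrix over the algebra of sequences. *)
Definition scal p q (M : 'M[C]_(p, q)) : 'M[X]_(p, q) := \matrix_(i, j) (M i j *: (1 : X)).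

(** The amplification of [f] to matrices, flattened to one complex matrix with blocks of size D. It
    serves both for evaluation at a level and for completely positive maps. *)
Definition bmap D (f : X -> 'M[C]_D) p q (a : 'M[X]_(p, q)) :
    'M[C]_(\sum_(i < p) D, \sum_(j < q) D) :=
  \mxblock_(i < p, j < q) f (a i j).

Definition lev m p q (a : 'M[X]_(p, q)) := bmap (fun x : X => x m) a.

Definition blks D p q (M : 'M[C]_(p, q)) : 'M[C]_(\sum_(i < p) D, \sum_(j < q) D) :=
  \mxblock_(i < p, j < q) ((M i j)%:M : 'M[C]_D).

Lemma adjXK p q (a : 'M[X]_(p, q)) : adjX (adjX a) = a.
Proof. by apply/matrixP => i j; rewrite !mxE ms_adjK. Qed.

Lemma adjXM p q r (a : 'M[X]_(p, q)) (c : 'M[X]_(q, r)) :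
  adjX (a *m c) = adjX c *m adjX a.
Proof.
apply/matrixP => i j; rewrite !mxE ms_adj_sum; apply: eq_bigr => k _.
by rewrite !mxE ms_adjM.
Qed.

Lemma adjXD p q (a c : 'M[X]_(p, q)) : adjX (a + c) = adjX a + adjX c.
Proof. by apply/matrixP => i j; rewrite !mxE ms_adjD. Qed.

Lemma adjX_scal p q (M : 'M[C]_(p, q)) : adjX (scal M) = scal (M^t*).
Proof. by apply/matrixP => i j; rewrite !mxE ms_adjZ ms_adj1. Qed.

Lemma adjX_scalar p a : adjX (a%:M : 'M[X]_p) = (ms_adj a)%:M.
Proof.
apply/matrixP => i j; rewrite !mxE eq_sym.
by case: (i == j); rewrite ?mulr1n ?mulr0n ?ms_adj0.
Qed.

Lemma scalM p q r (M : 'M[C]_(p, q)) (M' : 'M[C]_(q, r)) :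
  scal (M *m M') = scal M *m scal M'.
Proof.
apply/matrixP => i j; rewrite !mxE scaler_suml; apply: eq_bigr => k _.
by rewrite !mxE -ms_scaleAl mul1r scalerA.
Qed.

Lemma scal1 p : scal (1%:M : 'M[C]_p) = 1%:M.
Proof.
apply/matrixP => i j; rewrite !mxE.
by case: (i == j); rewrite ?mulr1n ?mulr0n ?scale1r ?scale0r.
Qed.

Lemma scal_mulE p q r (M : 'M[C]_(p, q)) (a : 'M[X]_(q, r)) i j :
  (scal M *m a) i j = \sum_k M i k *: a k j.
Proof. by rewrite mxE; apply: eq_bigr => k _; rewrite !mxE -ms_scaleAl mul1r. Qed.

Lemma scal_scalar_comm p q a (M : 'M[C]_(p, q)) :
  scal M *m a%:M = a%:M *m scal M.
Proof.
apply/matrixP => i j; rewrite scal_mulE mxE (bigD1 j) //= big1 ?addr0; last first.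
  by move=> k kj; rewrite mxE (negbTE kj) mulr0n scaler0.
rewrite (bigD1 i) //= big1 ?addr0; last first.
  by move=> k ki; rewrite mxE eq_sym (negbTE ki) mulr0n mul0r.
by rewrite !mxE !eqxx !mulr1n -ms_scaleAr mulr1.
Qed.

Lemma blks1 D p : blks D (1%:M : 'M[C]_p) = 1%:M.
Proof.
have hR (i j : 'I_p) (k l : 'I_D) : i = j -> k = l ->
    tagnat.Rank (p_ := fun=> D) i k = tagnat.Rank (p_ := fun=> D) j l by move=> -> ->.
apply/matrixP => s t; rewrite !mxE.
have [->|st] := eqVneq s t; first by rewrite !eqxx.
have [e1|_] := eqVneq (tagnat.sig1 s) (tagnat.sig1 t); last by rewrite mul0rn.
rewrite mulr1n; suff /negbTE -> : (tagnat.sig2 s : 'I_D) != tagnat.sig2 t by [].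
apply: contraNneq st => e2; apply/eqP.
by rewrite -(tagnat.sig2K s) -(tagnat.sig2K t); exact: hR.
Qed.

Lemma levM m p q r (a : 'M[X]_(p, q)) (c : 'M[X]_(q, r)) :
  lev m (a *m c) = lev m a *m lev m c.
Proof.
rewrite /lev /bmap mul_mxblock; apply: eq_mxblock => i j.
by rewrite mxE ms_sumE.
Qed.

Lemma levD m p q (a c : 'M[X]_(p, q)) : lev m (a + c) = lev m a + lev m c.
Proof. by rewrite /lev /bmap -mxblockD; apply: eq_mxblock => i j; rewrite mxE. Qed.

Lemma levN m p q (a : 'M[X]_(p, q)) : lev m (- a) = - lev m a.
Proof. by rewrite /lev /bmap -mxblockN; apply: eq_mxblock => i j; rewrite mxE. Qed.

Lemma levB m p q (a c : 'M[X]_(p, q)) : lev m (a - c) = lev m a - lev m c.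
Proof. by rewrite levD levN. Qed.

Lemma lev_adj m p q (a : 'M[X]_(p, q)) : lev m (adjX a) = (lev m a)^t*.
Proof. by rewrite /lev /bmap mxblock_adj; apply: eq_mxblock => i j; rewrite mxE. Qed.

Lemma lev_scal m p q (M : 'M[C]_(p, q)) : lev m (scal M) = blks (N m) M.
Proof.
rewrite /lev /bmap /blks; apply: eq_mxblock => i j; rewrite mxE.
by rewrite -scalemx1.
Qed.

Lemma lev1 m p : lev m (1%:M : 'M[X]_p) = 1%:M.
Proof. by rewrite -scal1 lev_scal blks1. Qed.

(** A bound for the norm of matrices over the product algebra; in relational form it avoids a
    supremum over levels. *)
Definition mxbnd p q (a : 'M[X]_(p, q)) (K : R) := forall m, opnorm (lev m a) <= K.

End MatricesOverSequences.

Section SubalgebraMatrices.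
Context {R : realType} {N : nat -> nat}.
Local Notation C := (R[i]).
Local Notation X := (mxseq R N).
Context (B : set X) (HB : unital_Cstar_subalg B).
Implicit Types (p q r n m : nat).

Definition inB p q (a : 'M[X]_(p, q)) : Prop := forall i j, B (a i j).

Lemma B0 : B 0.
Proof. by rewrite -(scale0r (1 : X)); apply: (csub_scale HB); exact: csub_one. Qed.

Lemma B_sum I (s : seq I) (P : pred I) (F : I -> X) :
  (forall i, P i -> B (F i)) -> B (\sum_(i <- s | P i) F i).
Proof.
move=> h; elim/big_rec: _ => [|i x Pi hx]; first exact: B0.
by apply: (csub_add HB) => //; exact: h.
Qed.

Lemma BN a : B a -> B (- a).
Proof. by move=> h; rewrite -scaleN1r; exact: (csub_scale HB). Qed.

Lemma inBD p q (a c : 'M[X]_(p, q)) : inB a -> inB c -> inB (a + c).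
Proof. by move=> ha hc i j; rewrite mxE; exact: (csub_add HB). Qed.

Lemma inBN p q (a : 'M[X]_(p, q)) : inB a -> inB (- a).
Proof. by move=> ha i j; rewrite mxE; exact: BN. Qed.

Lemma inBB p q (a c : 'M[X]_(p, q)) : inB a -> inB c -> inB (a - c).
Proof. by move=> ha hc; apply: inBD => //; exact: inBN. Qed.

Lemma inBM p q r (a : 'M[X]_(p, q)) (c : 'M[X]_(q, r)) :
  inB a -> inB c -> inB (a *m c).
Proof.
move=> ha hc i j; rewrite mxE; apply: B_sum => k _; exact: (csub_mul HB).
Qed.

Lemma inB_adj p q (a : 'M[X]_(p, q)) : inB a -> inB (adjX a).
Proof. by move=> ha i j; rewrite mxE; exact: (csub_adj HB). Qed.

Lemma inB_scal p q (M : 'M[C]_(p, q)) : inB (scal M).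
Proof. by move=> i j; rewrite mxE; apply: (csub_scale HB); exact: csub_one. Qed.

Lemma inB_scalar p a : B a -> inB (a%:M : 'M[X]_p).
Proof.
by move=> ha i j; rewrite mxE; case: (i == j); rewrite ?mulr1n ?mulr0n //; exact: B0.
Qed.

Lemma inB1 p : inB (1%:M : 'M[X]_p).
Proof. by apply: inB_scalar; exact: csub_one. Qed.

Lemma inB_sum p q I (s : seq I) (P : pred I) (F : I -> 'M[X]_(p, q)) :
  (forall i, P i -> inB (F i)) -> inB (\sum_(i <- s | P i) F i).
Proof.
move=> h; elim/big_rec: _ => [|i x Pi hx]; first by move=> i j; rewrite mxE; exact: B0.
by apply: inBD => //; exact: h.
Qed.

Lemma inB_row p q1 q2 (a : 'M[X]_(p, q1)) (c : 'M[X]_(p, q2)) :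
  inB a -> inB c -> inB (row_mx a c).
Proof. by move=> ha hc i j; rewrite mxE; case: (fintype.split j). Qed.

Lemma adjX_row p q1 q2 (a : 'M[X]_(p, q1)) (c : 'M[X]_(p, q2)) :
  adjX (row_mx a c) = col_mx (adjX a) (adjX c).
Proof. by apply/matrixP => i j; rewrite !mxE; case: (fintype.split i) => k; rewrite mxE. Qed.

Lemma linear_on0 (V : lmodType C) (f : X -> V) : linear_on B f -> f 0 = 0.
Proof.
move=> h; have := h 0 0 0 B0 B0; rewrite scale0r addr0 scale0r add0r => e.
by have := h (-1) 0 0 B0 B0; rewrite scaleN1r oppr0 addr0 scaleN1r addNr.
Qed.

Lemma linear_onD (V : lmodType C) (f : X -> V) a c : linear_on B f ->
  B a -> B c -> f (a + c) = f a + f c.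
Proof. by move=> h ha hc; have := h 1 a c ha hc; rewrite !scale1r. Qed.

Lemma linear_onZ (V : lmodType C) (f : X -> V) z a : linear_on B f ->
  B a -> f (z *: a) = z *: f a.
Proof.
by move=> h ha; have := h z a 0 ha B0; rewrite addr0 (linear_on0 h) addr0.
Qed.

Lemma linear_onN (V : lmodType C) (f : X -> V) a : linear_on B f ->
  B a -> f (- a) = - f a.
Proof. by move=> h ha; rewrite -[- a]scaleN1r (linear_onZ _ h) // scaleN1r. Qed.

Lemma linear_onB (V : lmodType C) (f : X -> V) a c : linear_on B f ->
  B a -> B c -> f (a - c) = f a - f c.
Proof.
by move=> h ha hc; rewrite (linear_onD h) ?(linear_onN h) //; exact: BN.
Qed.

Lemma linear_on_sum (V : lmodType C) (f : X -> V) I (s : seq I) (P : pred I) (F : I -> X) :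
  linear_on B f -> (forall i, P i -> B (F i)) ->
  f (\sum_(i <- s | P i) F i) = \sum_(i <- s | P i) f (F i).
Proof.
move=> h hF; suff [] : B (\sum_(i <- s | P i) F i) /\
  f (\sum_(i <- s | P i) F i) = \sum_(i <- s | P i) f (F i) by [].
elim/big_rec2: _ => [|i x y Pi [By e]]; first by split; [exact: B0|exact: linear_on0].
by split; [apply: (csub_add HB); auto|rewrite (linear_onD h) ?e //; exact: hF].
Qed.

Section Bmap.
Context {D : nat} (f : X -> 'M[C]_D) (Hf : linear_on B f).

Lemma bmapD p q (a c : 'M[X]_(p, q)) : inB a -> inB c ->
  bmap f (a + c) = bmap f a + bmap f c.
Proof.
move=> ha hc; rewrite /bmap -mxblockD; apply: eq_mxblock => i j.
by rewrite mxE (linear_onD Hf).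
Qed.

Lemma bmapN p q (a : 'M[X]_(p, q)) : inB a -> bmap f (- a) = - bmap f a.
Proof.
move=> ha; rewrite /bmap -mxblockN; apply: eq_mxblock => i j.
by rewrite mxE (linear_onN Hf).
Qed.

Lemma bmapB p q (a c : 'M[X]_(p, q)) : inB a -> inB c ->
  bmap f (a - c) = bmap f a - bmap f c.
Proof. by move=> ha hc; rewrite bmapD ?bmapN //; exact: inBN. Qed.

Lemma bmap0 p q : bmap f (0 : 'M[X]_(p, q)) = 0.
Proof.
rewrite /bmap -[RHS]mxblock0; apply: eq_mxblock => i j.
by rewrite mxE (linear_on0 Hf).
Qed.

Lemma bmap_sum p q I (s : seq I) (F : I -> 'M[X]_(p, q)) :
  (forall i, inB (F i)) ->
  bmap f (\sum_(i <- s) F i) = \sum_(i <- s) bmap f (F i).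
Proof.
move=> h; elim: s => [|i s IH]; first by rewrite !big_nil bmap0.
by rewrite !big_cons bmapD ?IH //; apply: inB_sum.
Qed.

Lemma bmap_scal_mul p q r (M : 'M[C]_(p, q)) (a : 'M[X]_(q, r)) : inB a ->
  bmap f (scal M *m a) = blks D M *m bmap f a.
Proof.
move=> ha; rewrite /bmap /blks mul_mxblock; apply: eq_mxblock => i j.
rewrite scal_mulE (linear_on_sum _ Hf) => [|k _]; last exact: (csub_scale HB).
by apply: eq_bigr => k _; rewrite (linear_onZ _ Hf) // mul_scalar_mx.
Qed.

End Bmap.

Lemma opnorm_mxblock p q (D1 D2 : nat) (A : 'I_p -> 'I_q -> 'M[C]_(D1, D2)) :
  opnorm (\mxblock_(i < p, j < q) A i j) <= \sum_i \sum_j opnorm (A i j).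
Proof.
apply: opnorm_le => [|x].
  by apply: sumr_ge0 => i _; apply: sumr_ge0 => j _; exact: opnorm_ge0.
have [y0|y0] := eqVneq (l2norm ((\mxblock_(i < p, j < q) A i j) *m x)) 0.
  rewrite y0 mulr_ge0 ?l2norm_ge0 //.
  by apply: sumr_ge0 => i _; apply: sumr_ge0 => j _; exact: opnorm_ge0.
set y := _ *m x; have yp : 0 < l2norm y by rewrite lt_neqAle eq_sym y0 l2norm_ge0.
rewrite -(ler_pM2r yp) -expr2 l2norm_sqr {1}/y rdot_mxblock.
rewrite 2!mulr_suml; apply: ler_sum => i _; rewrite 2!mulr_suml; apply: ler_sum => j _.
apply: le_trans (rdot_le _ _) _; apply: ler_pM; rewrite ?l2norm_ge0 //.
  apply: le_trans (le_opnorm _ _) _; apply: ler_wpM2l; first exact: opnorm_ge0.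
  exact: l2norm_submxcol.
exact: l2norm_submxcol.
Qed.

Lemma opnorm_submxblock p q D1 D2 (A : 'I_p -> 'I_q -> 'M[C]_(D1, D2)) i j :
  opnorm (A i j) <= opnorm (\mxblock_(i < p, j < q) A i j).
Proof.
apply: opnorm_le => [|x]; first exact: opnorm_ge0.
pose x' := \mxcol_(k < q) (if k == j then x else 0).
have e : A i j *m x = submxcol ((\mxblock_(i < p, j < q) A i j) *m x') i.
  rewrite mul_mxblock_mxrow mxcolK (bigD1 j) //= eqxx big1 ?addr0 // => k kj.
  by rewrite (negbTE kj) mulmx0.
rewrite e; apply: le_trans (l2norm_submxcol _ _) _.
apply: le_trans (le_opnorm _ _) _; apply: ler_wpM2l; first exact: opnorm_ge0.
rewrite -(@ler_pXn2r _ 2) ?nnegrE ?l2norm_ge0 // !l2norm_sqr rdot_submxcol.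
rewrite (bigD1 j) //= mxcolK eqxx big1 ?addr0 // => k kj.
by rewrite mxcolK (negbTE kj) rdot0l.
Qed.

Lemma inB_bounded p q (a : 'M[X]_(p, q)) : inB a -> exists2 K, 0 < K & mxbnd a K.
Proof.
move=> ha; have /choice [f hf] (ij : 'I_p * 'I_q) :
    exists K : R, forall m, opnorm (a ij.1 ij.2 m) <= K.
  exact: (csub_bounded HB (ha ij.1 ij.2)).
exists (1 + \sum_i \sum_j `|f (i, j)|).
  rewrite ltr_wpDr //; apply: sumr_ge0 => i _; apply: sumr_ge0 => j _; exact: normr_ge0.
move=> m; apply: le_trans (opnorm_mxblock _) _; rewrite ler_wpDl //.
apply: ler_sum => i _; apply: ler_sum => j _.
by apply: le_trans (hf (i, j) m) _; exact: ler_norm.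
Qed.

Lemma inB_closed p q (a : 'M[X]_(p, q)) :
  (forall eps : R, 0 < eps -> exists2 c, inB c & mxbnd (a - c) eps) -> inB a.
Proof.
move=> h i j; apply: (csub_closed HB) => eps /h [c hc hac].
exists (c i j) => // m; apply: le_trans (hac m).
apply: le_trans (opnorm_submxblock (fun i j => (a - c) i j m) i j).
by rewrite !mxE.
Qed.

End SubalgebraMatrices.

Section LevelNorms.
Context {R : realType} {N : nat -> nat}.
Local Notation C := (R[i]).
Local Notation X := (mxseq R N).
Implicit Types (p q r n m : nat).

Lemma normc_le_opnorm p q (M : 'M[C]_(p, q)) i j : Normc.normc (M i j) <= opnorm M.
Proof.
have := le_opnorm M (delta_mx j 0); rewrite l2norm_delta mulr1.
by apply: le_trans; have := l2norm_coord (M *m delta_mx j 0) i; rewrite -colE mxE.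
Qed.

Lemma opnorm_eq0 p q (M : 'M[C]_(p, q)) :
  (forall eps : R, 0 < eps -> opnorm M <= eps) -> M = 0.
Proof.
move=> h; apply/matrixP => i j; rewrite mxE; apply: Normc.eq0_normc.
apply/eqP; rewrite eq_le; apply/andP; split; last by case: (M i j) => ? ?; exact: sqrtr_ge0.
apply/ler_addgt0Pr => eps eps0; rewrite add0r.
by apply: le_trans (h _ eps0); exact: normc_le_opnorm.
Qed.

Lemma lev0 m p q : lev m (0 : 'M[X]_(p, q)) = 0.
Proof. by rewrite /lev /bmap -[RHS]mxblock0; apply: eq_mxblock => i j; rewrite mxE. Qed.

Lemma lev_inj p q (a c : 'M[X]_(p, q)) : (forall m, lev m a = lev m c) -> a = c.
Proof.
move=> h; apply/matrixP => i j; apply: functional_extensionality_dep => m.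
have /(congr1 (fun M => submxblock M i j)) := h m.
by rewrite /lev /bmap !mxblockK.
Qed.

Lemma mxbndM p q r (a : 'M[X]_(p, q)) (c : 'M[X]_(q, r)) K L :
  mxbnd a K -> mxbnd c L -> mxbnd (a *m c) (K * L).
Proof. by move=> ha hc m; rewrite levM; exact: opnormM_le. Qed.

Lemma mxbnd1M p q r (a : 'M[X]_(p, q)) (c : 'M[X]_(q, r)) :
  mxbnd a 1 -> mxbnd c 1 -> mxbnd (a *m c) 1.
Proof. by move=> ha hc; have := mxbndM ha hc; rewrite mulr1. Qed.

Lemma mxbndD p q (a c : 'M[X]_(p, q)) K L :
  mxbnd a K -> mxbnd c L -> mxbnd (a + c) (K + L).
Proof. by move=> ha hc m; rewrite levD; apply: le_trans (opnormD _ _) _; exact: lerD. Qed.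

Lemma mxbnd_adj p q (a : 'M[X]_(p, q)) K : mxbnd a K -> mxbnd (adjX a) K.
Proof. by move=> ha m; rewrite lev_adj opnorm_adj. Qed.

Lemma mxbnd_le p q (a : 'M[X]_(p, q)) K L : K <= L -> mxbnd a K -> mxbnd a L.
Proof. by move=> KL ha m; exact: le_trans (ha m) KL. Qed.

Lemma mxbnd_isom p q (a : 'M[X]_(p, q)) : adjX a *m a = 1%:M -> mxbnd a 1.
Proof. by move=> h m; apply: opnorm_isom; rewrite -lev_adj -levM h lev1. Qed.

Lemma mxbnd_scal p q (M : 'M[C]_(p, q)) : M^t* *m M = 1%:M -> mxbnd (scal M : 'M[X]_(p, q)) 1.
Proof. by move=> h; apply: mxbnd_isom; rewrite adjX_scal -scalM h scal1. Qed.

Lemma blks_scalar D p (z : C) : blks D (z%:M : 'M[C]_p) = z%:M.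
Proof.
have -> : z%:M = z *: 1%:M :> 'M[C]_p by rewrite scalemx1.
have -> : blks D (z *: 1%:M : 'M[C]_p) = z *: blks D 1%:M.
  apply/matrixP => i j; by rewrite !mxE !mulrnAr.
by rewrite blks1 scalemx1.
Qed.

Lemma opnorm_scalar n (c : R) : opnorm (c%:C%:M : 'M[C]_n) <= `|c|.
Proof.
rewrite -scalemx1; apply: le_trans (opnormZ _ _) _.
by rewrite -[X in _ <= X]mulr1 ler_wpM2l // opnorm1.
Qed.

Lemma lev_scalc m p q (c : R) (a : 'M[X]_(p, q)) :
  lev m (scal c%:C%:M *m a) = c%:C *: lev m a.
Proof. by rewrite levM lev_scal blks_scalar mul_scalar_mx. Qed.

Lemma mxbnd_scalc p q (c : R) (a : 'M[X]_(p, q)) K :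
  0 <= c -> mxbnd a K -> mxbnd (scal c%:C%:M *m a) (c * K).
Proof.
move=> c0 ha m; rewrite lev_scalc; apply: le_trans (opnormZ _ _) _.
by rewrite ger0_norm // ler_wpM2l.
Qed.

End LevelNorms.

Section StackedVectors.
Context {R : realType} {N : nat -> nat}.
Local Notation C := (R[i]).
Local Notation X := (mxseq R N).
Context {D : nat} (f : X -> 'M[C]_D).

(** Built block by block, because the dimension \sum_(i < p + q) D is not literally a sum of two
    dimensions, as [col_mx] would require. *)
Definition jn p q (x : 'cV[C]_(\sum_(i < p) D)) (y : 'cV[C]_(\sum_(i < q) D)) :
    'cV[C]_(\sum_(i < p + q) D) :=
  \mxcol_(i < p + q) match fintype.split i with
                     | inl j => submxcol x j | inr j => submxcol y j end.

Lemma split_lshift p q (i : 'I_p) : fintype.split (lshift q i) = inl i.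
Proof. exact: (unsplitK (inl i)). Qed.

Lemma split_rshift p q (i : 'I_q) : fintype.split (rshift p i) = inr i.
Proof. exact: (unsplitK (inr i)). Qed.

Lemma bmap_row_jn p q1 q2 (a : 'M[X]_(p, q1)) (c : 'M[X]_(p, q2)) x y :
  bmap f (row_mx a c) *m jn x y = bmap f a *m x + bmap f c *m y.
Proof.
rewrite /bmap mul_mxblock_mxrow -{2}(submxcolK x) -{2}(submxcolK y).
rewrite !mul_mxblock_mxrow -mxcolD; apply: eq_mxcol => i.
rewrite big_split_ord; congr (_ + _); apply: eq_bigr => j _.
  by rewrite row_mxEl split_lshift.
by rewrite row_mxEr split_rshift.
Qed.

Lemma bmap_col_jn p1 p2 q (a : 'M[X]_(p1, q)) (c : 'M[X]_(p2, q)) x :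
  bmap f (col_mx a c) *m x = jn (bmap f a *m x) (bmap f c *m x).
Proof.
rewrite -(submxcolK x) /bmap !mul_mxblock_mxrow /jn; apply: eq_mxcol => i.
case: (split_ordP i) => j ->; rewrite ?split_lshift ?split_rshift mxcolK.
  by apply: eq_bigr => k _; rewrite col_mxEu.
by apply: eq_bigr => k _; rewrite col_mxEd.
Qed.

Lemma form_submxcol p (p_ : 'I_p -> nat) (x y : 'cV[C]_(\sum_i p_ i)) :
  x^t* *m y = \sum_i (submxcol x i)^t* *m submxcol y i.
Proof. by rewrite mxcol_adj -{1}(submxcolK y) mul_mxrow_mxcol. Qed.

Lemma form_jn p q (x x' : 'cV[C]_(\sum_(i < p) D)) (y y' : 'cV[C]_(\sum_(i < q) D)) :
  (jn x y)^t* *m jn x' y' = x^t* *m x' + y^t* *m y'.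
Proof.
rewrite !form_submxcol big_split_ord; congr (_ + _); apply: eq_bigr => i _.
  by rewrite !mxcolK !split_lshift.
by rewrite !mxcolK !split_rshift.
Qed.

Lemma rdot_jn p q (x x' : 'cV[C]_(\sum_(i < p) D)) (y y' : 'cV[C]_(\sum_(i < q) D)) :
  rdot (jn x y) (jn x' y') = rdot x x' + rdot y y'.
Proof. by rewrite !rdot_def form_jn mxE raddfD. Qed.

End StackedVectors.

(** * Square roots in matrix algebras over a C*-algebra of sequences *)

Section SquareRoot.
Context {R : realType} {N : nat -> nat}.
Local Notation C := (R[i]).
Local Notation X := (mxseq R N).
Context (B : set X) (HB : unital_Cstar_subalg B).
Implicit Types (p q r n m : nat).

Lemma opnorm_le_sum p q (M : 'M[C]_(p, q)) :
  opnorm M <= \sum_i \sum_j Normc.normc (M i j).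
Proof.
have n0 (z : C) : 0 <= Normc.normc z by case: z => ? ?; exact: sqrtr_ge0.
apply: opnorm_le => [|x]; first by apply: sumr_ge0 => i _; exact: sumr_ge0.
apply: le_trans (l2norm_le_sum _) _; rewrite mulr_suml; apply: ler_sum => i _.
rewrite mulr_suml mxE; elim/big_ind2: _ => [|u1 u2 v1 v2 h1 h2|j _].
- by rewrite Normc.normc0.
- by apply: le_trans (le_normcD _ _) _; exact: lerD.
- by rewrite Normc.normcM ler_wpM2l // l2norm_coord.
Qed.

Lemma tends_in_opnorm p q (u : nat -> 'M[C]_(p, q)) (l : 'M[C]_(p, q)) :
  (forall i j, tends_in (@Normc.normc R) (fun k => u k i j) (l i j)) ->
  tends_in (@opnorm R p q) u l.
Proof.
move=> h eps eps0; pose e := eps / (p * q).+1%:R.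
have e0 : 0 < e by rewrite divr_gt0.
have /choice [f hf] (ij : 'I_p * 'I_q) := h ij.1 ij.2 e e0.
exists (\max_ij f ij)%N => k hk; apply: le_lt_trans (opnorm_le_sum _) _.
apply: (@le_lt_trans _ _ (\sum_(i < p) \sum_(j < q) e)).
  apply: ler_sum => i _; apply: ler_sum => j _; rewrite !mxE; apply/ltW/(hf (i, j)).
  by apply: leq_trans hk; exact: (leq_bigmax (i, j)).
rewrite !sumr_const !card_ord -mulrnA -mulr_natl /e mulrA ltr_pdivrMr // mulrC.
by rewrite ltr_pM2l // ltr_nat mulnC.
Qed.

(** Limits are taken level by level. The rate [delta] does not depend on the level, so the
    convergence is uniform and closedness of B applies. *)
Lemma mxseq_complete p q (u : nat -> 'M[X]_(p, q)) (delta : nat -> R) :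
  (forall n, inB B (u n)) ->
  (forall eps : R, 0 < eps -> exists n, delta n < eps) ->
  (forall n k, (n <= k)%N -> mxbnd (u k - u n) (delta n)) ->
  exists2 v, inB B v & forall n, mxbnd (v - u n) (delta n).
Proof.
move=> uB d0 hu.
have cau m : cauchy_in (@opnorm R _ _) (fun n => lev m (u n)).
  move=> eps eps0; have e2 : 0 < eps / 2 by rewrite divr_gt0.
  have [n hn] := d0 _ e2; exists n => k l hk hl.
  apply: le_lt_trans (opnorm_dist _ (lev m (u n)) _) _; rewrite [ltRHS]splitr.
  apply: ltrD; [|rewrite opnormBC]; rewrite -levB; apply: le_lt_trans hn; exact: hu.
have hex m : exists l, tends_in (@opnorm R _ _) (fun n => lev m (u n)) l.
  have [i j|l hl] := @cauchy_mx _ _ _ (fun n => lev m (u n)).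
    move=> eps eps0; have [n0 h] := cau m eps eps0; exists n0 => k n hk hn; apply: le_lt_trans (h _ _ hk hn).
    by have := normc_le_opnorm (lev m (u k) - lev m (u n)) i j; rewrite !mxE.
  by exists l; apply: tends_in_opnorm.
pose l m := projT1 (cid (hex m)).
have hl m : tends_in (@opnorm R _ _) (fun n => lev m (u n)) (l m) := projT2 (cid (hex m)).
pose v : 'M[X]_(p, q) := \matrix_(i, j) (fun m => submxblock (l m) i j).
have lv m : lev m v = l m.
  rewrite -[RHS]submxblockK /lev /bmap; apply: eq_mxblock => i j.
  by rewrite mxE.
have hv n : mxbnd (v - u n) (delta n).
  move=> m; rewrite levB lv; apply/ler_addgt0Pr => eps eps0.
  have [n0 hn0] := hl m _ eps0; pose k := maxn n n0.
  apply: le_trans (opnorm_dist _ (lev m (u k)) _) _; rewrite addrC; apply: lerD.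
    by rewrite -levB; apply: hu; exact: leq_maxl.
  by rewrite opnormBC; apply/ltW/hn0; exact: leq_maxr.
exists v => //; apply: (inB_closed HB) => eps /d0 [n hn].
by exists (u n) => //; apply: mxbnd_le (hv n); exact: ltW.
Qed.

Lemma sqrt_error_bound (a b : R) : 0 <= a -> 0 <= b ->
  a + a + (b * a + a * 1) <= a * (4 + 2 * b).
Proof. by move=> a0 b0; have := mulr_ge0 a0 b0; lra. Qed.

Section Iteration.
Context {n : nat} (y : 'M[X]_n) (rho : R).
Context (yB : inB B y) (yh : adjX y = y) (rho0 : 0 <= rho) (rho1 : rho < 1).
Context (yn : mxbnd y rho).

(** A fixed point v of v = (y + v^2) / 2 satisfies (1 - v)^2 = 1 - y. Square roots are needed
    because complete positivity is given only on elements of the form Y^* Y. *)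
Fixpoint sqrt_iter k : 'M[X]_n :=
  if k is k'.+1 then scal (2^-1)%:C%:M *m (y + sqrt_iter k' *m sqrt_iter k') else 0.

Lemma scalc_comm (c : R) (a : 'M[X]_n) : scal c%:C%:M *m a = a *m scal c%:C%:M.
Proof.
apply: lev_inj => m; rewrite !levM lev_scal blks_scalar.
by rewrite mul_scalar_mx mul_mx_scalar.
Qed.

Lemma sqrt_iter_inB k : inB B (sqrt_iter k).
Proof.
elim: k => [|k IH] /=; first by move=> i j; rewrite mxE; exact: B0.
by apply: (inBM HB); [exact: inB_scal|apply: (inBD HB) => //; exact: (inBM HB)].
Qed.

Lemma sqrt_iter_adj k : adjX (sqrt_iter k) = sqrt_iter k.
Proof.
elim: k => [|k IH] /=; first by apply/matrixP => i j; rewrite !mxE ms_adj0.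
by rewrite adjXM adjXD adjXM IH yh adjX_scal trmxC_scalar conj_realC scalc_comm.
Qed.

Lemma sqrt_iter_bnd k : mxbnd (sqrt_iter k) rho.
Proof.
elim: k => [|k IH] /=.
  by move=> m; rewrite lev0 opnorm0.
apply: mxbnd_le (mxbnd_scalc _ (mxbndD yn (mxbndM IH IH))) => //.
by move: rho rho0 rho1 => r r0 r1; nra.
Qed.

Lemma sqrt_iter_comm_gen k (z : 'M[X]_n) :
  y *m z = z *m y -> sqrt_iter k *m z = z *m sqrt_iter k.
Proof.
move=> yz; elim: k => [|k IH] /=; first by rewrite mul0mx mulmx0.
rewrite -mulmxA mulmxDl yz -mulmxA IH mulmxA IH -mulmxA -mulmxDr.
by rewrite !mulmxA scalc_comm.
Qed.

Lemma sqrt_iter_comm k l : sqrt_iter k *m sqrt_iter l = sqrt_iter l *m sqrt_iter k.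
Proof. by apply: sqrt_iter_comm_gen; rewrite (sqrt_iter_comm_gen l (erefl _)). Qed.

(** Since the iterates commute, the next increment is half the product of the increment and the sum
    of two iterates; the sum has norm at most 2 rho, so the increment shrinks by the factor rho. *)
Lemma sqrt_iter_step k : mxbnd (sqrt_iter k.+1 - sqrt_iter k) (rho ^+ k).
Proof.
elim: k => [|k IH].
  rewrite (_ : sqrt_iter 0 = 0) // subr0 expr0.
  by apply: mxbnd_le (sqrt_iter_bnd 1); exact: ltW.
have -> : sqrt_iter k.+2 - sqrt_iter k.+1 =
    scal (2^-1)%:C%:M *m ((sqrt_iter k.+1 - sqrt_iter k) *m (sqrt_iter k.+1 + sqrt_iter k)).
  have e1 : sqrt_iter k.+2 =
    scal (2^-1)%:C%:M *m (y + sqrt_iter k.+1 *m sqrt_iter k.+1) by [].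
  have e2 : sqrt_iter k.+1 = scal (2^-1)%:C%:M *m (y + sqrt_iter k *m sqrt_iter k) by [].
  rewrite e1 [X in _ - X]e2 -mulmxBr opprD addrACA subrr add0r; congr (_ *m _).
  rewrite mulmxBl !mulmxDr (sqrt_iter_comm k.+1 k) opprD !addrA.
  by rewrite addrK.
apply: mxbnd_le (mxbnd_scalc _ (mxbndM IH (mxbndD (sqrt_iter_bnd _) (sqrt_iter_bnd _)))) => //.
rewrite exprSr [X in X <= _](_ : _ = rho ^+ k * rho); last by move: (rho ^+ k) rho => a r; lra.
by [].
Qed.

Lemma sqrt_iter_cauchy k l : (k <= l)%N ->
  mxbnd (sqrt_iter l - sqrt_iter k) (rho ^+ k / (1 - rho)).
Proof.
have r1 : 0 < 1 - rho by rewrite subr_gt0.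
move=> /subnK <-; move: (l - k)%N => j.
suff h : mxbnd (sqrt_iter (j + k) - sqrt_iter k) ((rho ^+ k - rho ^+ (j + k)) / (1 - rho)).
  apply: mxbnd_le h; rewrite ler_pM2r ?invr_gt0 // lerBlDr lerDl exprn_ge0 //.
elim: j => [|j IH].
  by rewrite add0n !subrr mul0r => m; rewrite lev0 opnorm0.
have := mxbndD (sqrt_iter_step (j + k)) IH; rewrite addrA subrK addSn.
apply: mxbnd_le; rewrite exprS; move: (rho ^+ (j + k)) (rho ^+ k) => a b.
by rewrite -(ler_pM2r r1) mulrDl !mulfVK ?gt_eqF //; nra.
Qed.

Lemma sqrt_one_minus : exists w, [/\ inB B w, adjX w = w & w *m w = 1%:M - y].
Proof.
have r1 : 0 < 1 - rho by rewrite subr_gt0.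
pose delta k := rho ^+ k / (1 - rho).
have d0 (eps : R) : 0 < eps -> exists k, delta k < eps.
  move=> eps0; have := @cvg_geometric _ (1 - rho)^-1 rho.
  rewrite ger0_norm // => /(_ rho1) /cvgrPdist_lt /(_ _ eps0) [k _ /(_ k (leqnn k))].
  rewrite sub0r normrN ger0_norm /geometric /= => [h|]; first by exists k; rewrite /delta mulrC.
  by rewrite mulr_ge0 ?exprn_ge0 // invr_ge0 ltW.
have [v vB hv] := mxseq_complete sqrt_iter_inB d0 sqrt_iter_cauchy.
have d_ge0 k : 0 <= delta k by rewrite divr_ge0 ?exprn_ge0 // ltW.
have vn m : opnorm (lev m v) <= delta 0%N.
  by have := hv 0%N m; rewrite /= subr0.
exists (1%:M - v); split.
- by apply: (inBB HB) => //; exact: inB1.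
- apply: lev_inj => m; rewrite lev_adj levB lev1 trmxC_add trmxC_opp trmxC_scalar rmorph1.
  congr (_ - _); rewrite -lev_adj; apply/eqP; rewrite -subr_eq0; apply/eqP.
  apply: opnorm_eq0 => eps eps0; have [k hk] := d0 _ (divr_gt0 eps0 (ltr0Sn _ 1)).
  apply: le_trans (opnorm_dist _ (lev m (sqrt_iter k)) _) _.
  rewrite -{1}(sqrt_iter_adj k) !lev_adj -trmxC_opp -trmxC_add opnorm_adj.
  rewrite (opnormBC (lev m (sqrt_iter k))) -!levB.
  by apply: le_trans (lerD (hv k m) (hv k m)) _; rewrite [leRHS]splitr lerD // ltW.
apply: lev_inj => m; rewrite levM !levB lev1.
set V := lev m v; set Y := lev m y.
suff h : V + V = Y + V *m V.
  have -> : Y = V + V - V *m V by rewrite h addrK.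
  rewrite mulmxBl mul1mx mulmxBr mulmx1 !opprB opprD -!addrA; congr (_ + _).
  by rewrite addrCA.
apply/eqP; rewrite -subr_eq0; apply/eqP.
apply: opnorm_eq0 => eps eps0.
(* At step k the fixed-point equation fails by at most (3 + delta 0) delta k; [K] is a generous
   bound for this factor. *)
pose K := 4 + 2 * delta 0%N; have Kp : 0 < K by rewrite /K ltr_pwDl // mulr_ge0.
have [k hk] := d0 _ (divr_gt0 eps0 Kp).
set U := lev m (sqrt_iter k); set U' := lev m (sqrt_iter k.+1).
have hU : opnorm (V - U) <= delta k by rewrite -levB; exact: hv.
have hU' : opnorm (V - U') <= delta k.
  rewrite -levB; apply: le_trans (hv k.+1 m) _.
  by rewrite ler_pM2r ?invr_gt0 // exprS ler_piMl ?exprn_ge0 // ltW.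
have U'E : U' + U' = Y + U *m U.
  rewrite /U' /= lev_scalc levD levM -/U -/Y -scalerDl -rmorphD /=.
  have -> : 2^-1 + 2^-1 = 1 :> R by rewrite -[2^-1]mul1r -splitr.
  by rewrite rmorph1 scale1r.
have -> : V + V - (Y + V *m V) =
    (V - U') + (V - U') - (V *m (V - U) + (V - U) *m U).
  rewrite mulmxBr mulmxBl [V *m V - _ + _]addrA subrK addrACA -opprD U'E.
  by rewrite opprB addrA !opprD !addrA subrK.
apply: le_trans (opnormB _ _) _.
apply: le_trans (lerD (opnormD _ _) (opnormD _ _)) _.
have h1 : opnorm (V *m (V - U)) <= delta 0%N * delta k by exact: opnormM_le.
have h2 : opnorm ((V - U) *m U) <= delta k * 1.
  apply: opnormM_le => //; apply: le_trans (sqrt_iter_bnd k m) _; exact: ltW.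
apply: le_trans (lerD (lerD hU' hU') (lerD h1 h2)) _.
rewrite ltr_pdivlMr // in hk.
by apply: le_trans (ltW hk); exact: sqrt_error_bound.
Qed.

End Iteration.

End SquareRoot.

(** * Completely positive maps *)

Section RealInequalities.
Context {R : realType}.
Implicit Types (a b e t s d v : R).

Lemma im_form_eq a2 b2 a3 b3 b1 b4 :
  b1 + (0 * b2 + 1 * a2) + (- 0 * b3 + -1 * a3 + b4) = 0 -> b1 = 0 -> b4 = 0 -> a3 = a2.
Proof. by lra. Qed.

Lemma form3_bound a t s v : a <= t -> 0 <= v + s + (s + a) -> 0 <= v + 2 * s + t.
Proof. by lra. Qed.

Lemma lmulM_bound a b : a + (1 * b + a * 1) <= 2 * a + b.
Proof. by lra. Qed.

Lemma lmul_approx_bound a b : b * 1 + (a + b * 1) <= a + 2 * b.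
Proof. by lra. Qed.

Lemma defect_bound (e t s d v : R) : t * e = 1 -> 0 < e ->
  d <= e * (- t * (- t * s)) -> 0 <= d + 2 * (- t * s) + v -> s <= e * v.
Proof.
move=> te e0 hd h.
have e1 : e * (- t * (- t * s)) = (t * e) * (t * s) by ring.
rewrite e1 te mul1r in hd.
have ts : t * s <= v by lra.
have -> : s = e * (t * s) by rewrite mulrA [e * t]mulrC te mul1r.
by rewrite ler_pM2l.
Qed.

End RealInequalities.

Section CompletelyPositive.
Context {R : realType} {N : nat -> nat}.
Local Notation C := (R[i]).
Local Notation X := (mxseq R N).
Context (B : set X) (HB : unital_Cstar_subalg B).
Context {D : nat} (psi : X -> 'M[C]_D) (Hpsi : ucp B psi).
Implicit Types (p q r n m k l : nat) (c eta : R).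
Local Notation Psi := (bmap psi).

Let psi_lin : linear_on B psi. Proof. by case: Hpsi. Qed.
Let psi1 : psi 1 = 1%:M. Proof. by case: Hpsi. Qed.

Lemma Psi1 p : Psi (1%:M : 'M[X]_p) = 1%:M.
Proof.
rewrite -(blks1 D p) /bmap /blks; apply: eq_mxblock => i j; rewrite !mxE.
by case: (i == j); rewrite ?mulr1n ?mulr0n ?psi1 // (linear_on0 HB psi_lin) raddf0.
Qed.

Lemma Psi_scal p q (M : 'M[C]_(p, q)) : Psi (scal M) = blks D M.
Proof.
by rewrite -[scal M]mulmx1 (bmap_scal_mul HB psi_lin) ?Psi1 ?mulmx1 //; exact: inB1.
Qed.

(* Rectangular [Y] are covered by padding with zeros to a square matrix. *)
Definition cdot n (x y : 'cV[C]_n) : C := (y^t* *m x) 0 0.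

Lemma rdot_cdot n (x y : 'cV[C]_n) : rdot x y = complex.Re (cdot x y).
Proof. exact: rdot_def. Qed.

Lemma cdotZl n z (x y : 'cV[C]_n) : cdot (z *: x) y = z * cdot x y.
Proof. by rewrite /cdot -scalemxAr mxE. Qed.

Lemma cdotZr n z (x y : 'cV[C]_n) : cdot x (z *: y) = z^* * cdot x y.
Proof. by rewrite /cdot trmxC_scale -scalemxAl mxE. Qed.

Lemma cdotDl n (x y z : 'cV[C]_n) : cdot (x + y) z = cdot x z + cdot y z.
Proof. by rewrite /cdot mulmxDr mxE. Qed.

Lemma conj_i : ('i%C : C)^* = - 'i%C.
Proof. by rewrite complexiE conjCi. Qed.

Lemma ucp_form l k (Y : 'M[X]_(l, k)) (x : 'cV[C]_(\sum_(i < k) D)) : inB B Y ->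
  0 <= cdot (Psi (adjX Y *m Y) *m x) x.
Proof.
move=> YB; case: Hpsi => _ _ pos.
pose Z : 'M[X]_(l + k) := block_mx 0 Y 0 0.
have ZB i j : B (Z i j).
  rewrite /Z; case: (split_ordP i) => i' ->; case: (split_ordP j) => j' ->;
  by rewrite ?block_mxEul ?block_mxEur ?block_mxEdl ?block_mxEdr ?mxE; try exact: B0.
have := pos (l + k)%N (fun i j => Z i j) ZB (jn 0 x).
have -> : \mxblock_(i, j) psi (\sum_(l0 < l + k) ms_adj (Z l0 i) * Z l0 j) =
          Psi (adjX Z *m Z).
  apply: eq_mxblock => i j; rewrite mxE; congr psi.
  by apply: eq_bigr => k0 _; rewrite !mxE.
have -> : adjX Z *m Z = col_mx 0 (row_mx 0 (adjX Y *m Y)).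
  have -> : adjX Z = block_mx 0 0 (adjX Y) 0.
    apply/matrixP => i j; rewrite [LHS]mxE /Z.
    case: (split_ordP i) => i' ->; case: (split_ordP j) => j' ->;
    by rewrite ?block_mxEul ?block_mxEur ?block_mxEdl ?block_mxEdr !mxE ?ms_adj0.
  by rewrite mulmx_block !mul0mx !mulmx0 !addr0 /block_mx row_mx0.
rewrite -mulmxA bmap_col_jn bmap_row_jn !(bmap0 HB psi_lin) !mul0mx add0r.
by rewrite form_jn mulmx0 add0r.
Qed.

Lemma ucp_form2 n p q (Y : 'M[X]_(n, p)) (Z : 'M[X]_(n, q))
    (x : 'cV[C]_(\sum_(i < p) D)) (y : 'cV[C]_(\sum_(i < q) D)) :
  inB B Y -> inB B Z ->
  0 <= cdot (Psi (adjX Y *m Y) *m x) x + cdot (Psi (adjX Y *m Z) *m y) x +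
       (cdot (Psi (adjX Z *m Y) *m x) y + cdot (Psi (adjX Z *m Z) *m y) y).
Proof.
move=> YB ZB; have := ucp_form (jn x y) (inB_row YB ZB).
rewrite adjX_row mul_col_mx !mul_mx_row bmap_col_jn !bmap_row_jn.
by rewrite /cdot form_jn mxE -!/(cdot _ _) !cdotDl.
Qed.

(** Positivity of a complex number includes that it is real. The form of the row (1, a) at (x, i y)
    has vanishing imaginary part, and this is the adjoint relation tested on x and y. *)
Lemma Psi_adj p q (a : 'M[X]_(p, q)) : inB B a -> Psi (adjX a) = (Psi a)^t*.
Proof.
move=> aB; apply/eqP; rewrite -subr_eq0; apply/eqP.
have key x y : rdot (Psi (adjX a) *m x) y = rdot (Psi a *m y) x.
  have h := ucp_form2 x ('i%C *: y) (@inB1 _ _ _ HB p) aB.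
  have h1 := ucp_form x (@inB1 _ _ _ HB p); have h2 := ucp_form ('i%C *: y) aB.
  have adj1 : adjX (1%:M : 'M[X]_p) = 1%:M by rewrite adjX_scalar ms_adj1.
  rewrite adj1 !mul1mx mulmx1 in h h1.
  move: h h1 h2; rewrite -!scalemxAr !cdotZl !cdotZr !rdot_cdot conj_i mulrA mulrN -expr2 sqr_i opprK mul1r.
  move: (cdot (Psi 1%:M *m x) x) (cdot (Psi a *m y) x) (cdot (Psi (adjX a) *m x) y)
        (cdot (Psi (adjX a *m a) *m y) y) => [a1 b1] [a2 b2] [a3 b3] [a4 b4]; rewrite !lecE /=.
  move=> /andP[/eqP h _] /andP[/eqP h1 _] /andP[/eqP h2 _].
  exact: im_form_eq h h1 h2.
apply: opnorm_eq0 => eps eps0; apply: opnorm_le => [|x]; first exact: ltW.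
suff -> : (Psi (adjX a) - (Psi a)^t*) *m x = 0 by rewrite l2norm0 mulr_ge0 ?l2norm_ge0 ?ltW.
apply: rdot_ext => y.
by rewrite mulmxBl rdotDl rdotNl key (rdot_adjr ((Psi a)^t*)) trmxCK rdotC subrr.
Qed.

Lemma ucp_rdot3 n p q r (Y : 'M[X]_(n, p)) (Z : 'M[X]_(n, q)) (W : 'M[X]_(n, r)) x y w :
  inB B Y -> inB B Z -> inB B W ->
  0 <= rdot (Psi (adjX Y *m Y) *m x + Psi (adjX Y *m Z) *m y + Psi (adjX Y *m W) *m w) x +
       rdot (Psi (adjX Z *m Y) *m x + Psi (adjX Z *m Z) *m y + Psi (adjX Z *m W) *m w) y +
       rdot (Psi (adjX W *m Y) *m x + Psi (adjX W *m Z) *m y + Psi (adjX W *m W) *m w) w.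
Proof.
move=> YB ZB WB; have := ucp_form (jn (jn x y) w) (inB_row (inB_row YB ZB) WB).
rewrite lecE => /andP[_]; rewrite -rdot_cdot.
rewrite !adjX_row !mul_col_mx !mul_mx_row !bmap_col_jn !bmap_row_jn.
by rewrite !rdot_jn.
Qed.

Lemma ucp_rdot2 n p q (Y : 'M[X]_(n, p)) (Z : 'M[X]_(n, q))
    (x : 'cV[C]_(\sum_(i < p) D)) (y : 'cV[C]_(\sum_(i < q) D)) :
  inB B Y -> inB B Z ->
  0 <= rdot (Psi (adjX Y *m Y) *m x + Psi (adjX Y *m Z) *m y) x +
       rdot (Psi (adjX Z *m Y) *m x + Psi (adjX Z *m Z) *m y) y.
Proof.
move=> YB ZB; have := ucp_form2 x y YB ZB.
rewrite lecE => /andP[_]; rewrite !raddfD /= -!rdot_cdot.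
by rewrite !rdotDl.
Qed.

Lemma ucp_rdot n p (Y : 'M[X]_(n, p)) x : inB B Y -> 0 <= rdot (Psi (adjX Y *m Y) *m x) x.
Proof. by move=> YB; have := ucp_form x YB; rewrite lecE => /andP[_]; rewrite -rdot_cdot. Qed.

Lemma Psi_scalc p q (c : R) (a : 'M[X]_(p, q)) : inB B a ->
  Psi (scal c%:C%:M *m a) = c%:C *: Psi a.
Proof. by move=> aB; rewrite (bmap_scal_mul HB psi_lin) // blks_scalar mul_scalar_mx. Qed.

(** For eps > 0 the element z + eps is c (1 - y) with |y| <= 1 - eps / c, so 1 - y has a
    self-adjoint square root over B and is of the form w^* w. Then eps tends to 0. *)
Lemma Psi_psd n (z : 'M[X]_n) : inB B z -> adjX z = z ->
  (forall m x, 0 <= rdot (lev m z *m x) x) -> forall x, 0 <= rdot (Psi z *m x) x.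
Proof.
move=> zB zh zpos x; have [K K0 zK] := inB_bounded HB zB.
suff hh eps : 0 < eps -> 0 <= rdot (Psi z *m x) x + eps * rdot x x.
  have x0 := rdot_ge0 x.
  apply/ler_addgt0Pr => e e0; have e' : 0 < e / (1 + rdot x x) by rewrite divr_gt0 // ltr_pwDl.
  apply: le_trans (hh _ e') _; rewrite lerD2l mulrAC ler_pdivrMr ?ltr_pwDl //.
  by rewrite ler_wpM2l ?(ltW e0) // lerDr.
move=> e0; pose c := K + eps.
have c0 : 0 < c by rewrite addr_gt0.
pose y : 'M[X]_n := 1%:M - scal (c^-1)%:C%:M *m (z + scal eps%:C%:M).
have yE m : lev m y = 1%:M - (c^-1)%:C *: (lev m z + eps%:C%:M).
  by rewrite levB lev1 lev_scalc levD lev_scal blks_scalar.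
have yB : inB B y.
  apply: (inBB HB); first exact: inB1.
  by apply: (inBM HB); [exact: inB_scal|apply: (inBD HB) => //; exact: inB_scal].
have yh : adjX y = y.
  apply: lev_inj => m; rewrite lev_adj yE trmxC_add trmxC_opp trmxC_scalar rmorph1.
  by rewrite trmxC_scale conj_realC trmxC_add trmxC_scalar conj_realC -lev_adj zh.
have yform m v : rdot (lev m y *m v) v =
    rdot v v - c^-1 * (rdot (lev m z *m v) v + eps * rdot v v).
  rewrite yE mulmxBl mul1mx rdotDl rdotNl -scalemxAl rdotZl mulmxDl rdotDl.
  by rewrite mul_scalar_mx rdotZl.
have rr : 0 < 1 - eps / c by rewrite subr_gt0 ltr_pdivrMr // mul1r ltrDr.
have yn : mxbnd y (1 - eps / c).
  move=> m; apply: opnorm_psd => // [|v|v]; first by rewrite -lev_adj yh.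
    rewrite yform subr_ge0 ler_pdivrMl // /c mulrDl lerD2r.
    apply: le_trans (rdot_le _ _) _; rewrite -l2norm_sqr expr2 mulrA ler_wpM2r ?l2norm_ge0 //.
    exact: opnorm_bound.
  rewrite yform mulrBl mul1r lerD2l lerN2 mulrDr [_ / _ * _]mulrAC [_ / c]mulrC.
  by rewrite lerDr mulr_ge0 // invr_ge0 ltW.
have r1 : 1 - eps / c < 1 by rewrite ltrBlDr ltrDl divr_gt0.
have [w [wB wh ww]] := sqrt_one_minus HB yB yh (ltW rr) r1 yn.
have := ucp_rdot x wB; rewrite wh ww /y opprB addrCA subrr addr0.
rewrite Psi_scalc; last by apply: (inBD HB) => //; exact: inB_scal.
rewrite (bmapD psi_lin) //; last exact: inB_scal.
rewrite Psi_scal blks_scalar -scalemxAl rdotZl mulmxDl rdotDl mul_scalar_mx rdotZl.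
by rewrite pmulr_rge0 // invr_gt0.
Qed.

Lemma Psi_scalar p (a : X) :
  Psi (a%:M : 'M[X]_p) = \mxblock_(i < p, j < p) (psi a *+ (i == j)).
Proof.
apply: eq_mxblock => i j; rewrite mxE.
by case: (i == j); rewrite ?mulr1n ?mulr0n // (linear_on0 HB psi_lin).
Qed.

Lemma Psi_ge n (z : 'M[X]_n) (e : R) : inB B z -> adjX z = z ->
  (forall m x, - e * rdot x x <= rdot (lev m z *m x) x) ->
  forall x, - e * rdot x x <= rdot (Psi z *m x) x.
Proof.
move=> zB zh zge x; pose y : 'M[X]_n := z + scal e%:C%:M.
have yB : inB B y by apply: (inBD HB) => //; exact: inB_scal.
have yh : adjX y = y by rewrite adjXD zh adjX_scal trmxC_scalar conj_realC.
have := @Psi_psd _ y yB yh _ x.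
rewrite (bmapD psi_lin) //; last exact: inB_scal.
rewrite Psi_scal blks_scalar mulmxDl rdotDl mul_scalar_mx rdotZl => h.
rewrite mulNr -subr_ge0 opprK; apply: h => m v; have := zge m v.
rewrite mulNr -subr_ge0 opprK.
by rewrite levD lev_scal blks_scalar mulmxDl rdotDl mul_scalar_mx rdotZl.
Qed.

Lemma psi_adj a : B a -> psi (ms_adj a) = (psi a)^t*.
Proof.
move=> aB; have := Psi_adj (inB_scalar HB (p := 1) aB).
rewrite adjX_scalar !Psi_scalar mxblock_adj => /eq_mxblockP /(_ 0 0).
by rewrite !eqxx !mulr1n.
Qed.

(** The form of the row (1, a) at (-Psi(a) x, x) is the Kadison-Schwarz inequality Psi(a)^* Psi(a)
    <= Psi(a^* a), and the right side is at most K^2 by positivity. *)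
Lemma Psi_contr p q (a : 'M[X]_(p, q)) K : 0 <= K -> inB B a -> mxbnd a K ->
  opnorm (Psi a) <= K.
Proof.
move=> K0 aB aK; apply: opnorm_le => // x.
rewrite -(@ler_pXn2r _ 2) ?nnegrE ?mulr_ge0 ?l2norm_ge0 // exprMn !l2norm_sqr.
have adj1 : adjX (1%:M : 'M[X]_p) = 1%:M by rewrite adjX_scalar ms_adj1.
have h1 := ucp_rdot2 (- (Psi a *m x)) x (@inB1 _ _ _ HB p) aB.
rewrite adj1 !mul1mx mulmx1 Psi1 mul1mx addNr rdot0l add0r Psi_adj // mulmxN in h1.
rewrite rdotDl rdotNl (rdot_adjr ((Psi a)^t*)) trmxCK in h1.
rewrite addrC subr_ge0 in h1; apply: le_trans h1 _.
pose z : 'M[X]_q := scal (K ^+ 2)%:C%:M - adjX a *m a.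
have zB : inB B z.
  by apply: (inBB HB); [exact: inB_scal|apply: (inBM HB) => //; exact: inB_adj].
have zh : adjX z = z.
  apply: lev_inj => m; rewrite lev_adj !levB lev_scal blks_scalar levM lev_adj.
  by rewrite trmxC_add trmxC_opp trmxC_scalar conj_realC trmxC_mul trmxCK.
have := @Psi_psd _ z zB zh _ x; rewrite (bmapB HB psi_lin) //; first last.
- by apply: (inBM HB) => //; exact: inB_adj.
- exact: inB_scal.
rewrite Psi_scal blks_scalar mulmxBl rdotDl rdotNl mul_scalar_mx rdotZl subr_ge0; apply.
move=> m v; rewrite levB lev_scal blks_scalar mulmxBl rdotDl rdotNl mul_scalar_mx rdotZl.
rewrite levM lev_adj -mulmxA rdot_adjr trmxCK subr_ge0 -!l2norm_sqr -exprMn.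
by rewrite ler_pXn2r ?nnegrE ?mulr_ge0 ?l2norm_ge0 //; exact: opnorm_bound.
Qed.

(* [a] is in the multiplicative domain of [Psi] up to [eta]. *)
Definition lmul eta p q (a : 'M[X]_(p, q)) : Prop :=
  forall r (x : 'M[X]_(q, r)), inB B x -> mxbnd x 1 ->
    opnorm (Psi (a *m x) - Psi a *m Psi x) <= eta.

Lemma lmul_defect p q (a : 'M[X]_(p, q)) eta : 0 < eta -> inB B a ->
  opnorm (Psi (a *m adjX a) - Psi a *m Psi (adjX a)) <= eta ^+ 2 -> lmul eta a.
Proof.
move=> e0 aB ha r c cB c1; set E := _ - _; apply: opnorm_le => [|v]; first exact: ltW.
have adj1 : adjX (1%:M : 'M[X]_q) = 1%:M by rewrite adjX_scalar ms_adj1.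
have a'B := inB_adj HB aB.
have key u : 0 <= rdot ((Psi (a *m adjX a) - Psi a *m Psi (adjX a)) *m u) u +
    2 * rdot (E *m v) u + rdot v v.
  have := ucp_rdot3 (- (Psi (adjX a) *m u + Psi c *m v)) u v (@inB1 _ _ _ HB q) a'B cB.
  rewrite adj1 !mul1mx !mulmx1 adjXK Psi1 mul1mx.
  rewrite -[_ + Psi (adjX a) *m u + _]addrA addNr rdot0l add0r.
  rewrite mulmxN mulmxDr mulmxN mulmxDr.
  have -> : - (Psi a *m (Psi (adjX a) *m u) + Psi a *m (Psi c *m v)) +
    Psi (a *m adjX a) *m u + Psi (a *m c) *m v =
    (Psi (a *m adjX a) - Psi a *m Psi (adjX a)) *m u + E *m v.
    rewrite /E !mulmxBl !mulmxA opprD; move: (Psi (a *m adjX a) *m u) (_ *m u) => t1 t2.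
    move: (Psi (a *m c) *m v) (_ *m v) => t3 t4.
    by rewrite [LHS]+%R.[ACl ((3*1)*(4*2))].
  have e1 : Psi (adjX c) *m (Psi (adjX a) *m u) = Psi (adjX c) *m Psi (adjX a) *m u.
    by rewrite mulmxA.
  have hc : rdot (Psi (adjX c *m adjX a) *m u - Psi (adjX c) *m (Psi (adjX a) *m u)) v =
      rdot (E *m v) u.
    rewrite -adjXM !Psi_adj //; last exact: (inBM HB).
    rewrite [in RHS]rdot_adjr rdotC; congr rdot.
    by rewrite /E trmxC_add trmxC_opp trmxC_mul mulmxBl mulmxA.
  have hv : rdot (Psi (adjX c *m c) *m v) v - rdot (Psi (adjX c) *m (Psi c *m v)) v <= rdot v v.
    rewrite lerBlDr ler_wpDr //.
      by rewrite Psi_adj // rdot_adjr trmxCK rdot_ge0.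
    apply: le_trans (rdot_le _ _) _; rewrite -l2norm_sqr expr2 ler_wpM2r ?l2norm_ge0 //.
    rewrite -[X in _ <= X]mul1r; apply: opnorm_bound; apply: Psi_contr => //.
      by apply: (inBM HB) => //; exact: inB_adj.
    by apply: mxbnd1M => //; exact: mxbnd_adj.
  rewrite [X in _ + rdot X v](_ : _ =
     (Psi (adjX c *m adjX a) *m u - Psi (adjX c) *m (Psi (adjX a) *m u)) +
     (Psi (adjX c *m c) *m v - Psi (adjX c) *m (Psi c *m v))); last first.
    by rewrite opprD [LHS]+%R.[ACl ((3*1)*(4*2))].
  rewrite [rdot (_ + E *m v) u]rdotDl [rdot (_ + _) v]rdotDl hc.
  rewrite [rdot (_ - Psi (adjX c) *m _) v]rdotDl rdotNl.
  exact: form3_bound hv.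
(* This u minimizes eta^2 |u|^2 + 2 <E v, u> + |v|^2. *)
pose t := eta ^- 2; pose u := (- t)%:C *: (E *m v).
have h := key u.
have hd : rdot ((Psi (a *m adjX a) - Psi a *m Psi (adjX a)) *m u) u <= eta ^+ 2 * rdot u u.
  apply: le_trans (rdot_le _ _) _; rewrite -l2norm_sqr expr2 [in leRHS]expr2 !mulrA.
  by rewrite ler_wpM2r ?l2norm_ge0 // -expr2; exact: opnorm_bound.
rewrite [rdot (E *m v) u]rdotZr in h.
have uu : rdot u u = - t * (- t * rdot (E *m v) (E *m v)) by rewrite /u rdotZl rdotZr.
rewrite uu in hd.
have te : t * eta ^+ 2 = 1 by rewrite /t mulVf // expf_neq0 // gt_eqF.
have e2 : 0 < eta ^+ 2 by rewrite exprn_gt0.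
rewrite -(@ler_pXn2r _ 2) ?nnegrE ?mulr_ge0 ?l2norm_ge0 ?(ltW e0) // exprMn !l2norm_sqr.
exact: defect_bound te e2 hd h.
Qed.

Lemma lmul_mono p q (a : 'M[X]_(p, q)) eta eta' : eta <= eta' -> lmul eta a -> lmul eta' a.
Proof. by move=> le h r x xB x1; exact: le_trans (h r x xB x1) le. Qed.

Lemma lmul_scal_mul p q r (M : 'M[C]_(p, q)) (a : 'M[X]_(q, r)) K eta :
  inB B a -> opnorm (blks D M) <= K -> lmul eta a -> lmul (K * eta) (scal M *m a).
Proof.
move=> aB MK h s x xB x1.
rewrite -mulmxA !(bmap_scal_mul HB psi_lin) //; last exact: (inBM HB).
by rewrite -mulmxA -mulmxBr; apply: opnormM_le => //; exact: h.
Qed.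

Lemma lmul_scal p q (M : 'M[C]_(p, q)) : lmul 0 (scal M).
Proof.
move=> r x xB x1; rewrite (bmap_scal_mul HB psi_lin) // Psi_scal subrr.
by rewrite opnorm0.
Qed.

(** The multiplicativity of a is used twice, to pass from a (c x) to Psi(a) Psi(c x) and to
    reassemble Psi(a) Psi(c) into Psi(a c); that of c is used once in between. *)
Lemma lmulM p q r (a : 'M[X]_(p, q)) (c : 'M[X]_(q, r)) ea ec :
  inB B a -> inB B c -> mxbnd a 1 -> mxbnd c 1 -> lmul ea a -> lmul ec c ->
  lmul (2 * ea + ec) (a *m c).
Proof.
move=> aB cB a1 c1 ha hc s x xB x1; rewrite -mulmxA.
have h1 := ha _ (c *m x) (inBM HB cB xB) (mxbnd1M c1 x1).
have h2 : opnorm (Psi a *m (Psi (c *m x) - Psi c *m Psi x)) <= 1 * ec.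
  by apply: opnormM_le; [apply: Psi_contr|exact: hc].
have h3 : opnorm ((Psi (a *m c) - Psi a *m Psi c) *m Psi x) <= ea * 1.
  by apply: opnormM_le; [apply: ha|apply: Psi_contr].
apply: le_trans (opnorm_dist _ (Psi a *m Psi (c *m x)) _) _.
apply: le_trans (lerD h1 (opnorm_dist _ (Psi a *m (Psi c *m Psi x)) _)) _.
have h3' : opnorm (Psi a *m (Psi c *m Psi x) - Psi (a *m c) *m Psi x) <= ea * 1.
  by rewrite opnormBC mulmxA -mulmxBl.
rewrite mulmxBr in h2; apply: le_trans (lerD (lexx _) (lerD h2 h3')) _.
exact: lmulM_bound.
Qed.

Lemma lmulD p q (a c : 'M[X]_(p, q)) ea ec :
  inB B a -> inB B c -> lmul ea a -> lmul ec c -> lmul (ea + ec) (a + c).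
Proof.
move=> aB cB ha hc s x xB x1; rewrite mulmxDl !(bmapD psi_lin) //; try exact: (inBM HB).
rewrite mulmxDl opprD addrACA; apply: le_trans (opnormD _ _) _.
by apply: lerD; [exact: ha|exact: hc].
Qed.

Lemma lmul_approx p q (a c : 'M[X]_(p, q)) eta zeta :
  0 <= zeta -> inB B a -> inB B c -> mxbnd (a - c) zeta -> lmul eta c ->
  lmul (eta + 2 * zeta) a.
Proof.
move=> z0 aB cB hac hc s x xB x1.
have h1 : opnorm (Psi (a *m x) - Psi (c *m x)) <= zeta * 1.
  have -> : Psi (a *m x) - Psi (c *m x) = Psi ((a - c) *m x).
    by rewrite mulmxBl (bmapB HB psi_lin) //; exact: (inBM HB).
  apply: Psi_contr.
  - by rewrite mulr1.
  - by apply: (inBM HB) => //; exact: (inBB HB).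
  - exact: mxbndM.
have h2 : opnorm ((Psi a - Psi c) *m Psi x) <= zeta * 1.
  apply: opnormM_le; last exact: Psi_contr.
  by rewrite -(bmapB HB psi_lin) //; apply: Psi_contr => //; exact: (inBB HB).
apply: le_trans (opnorm_dist _ (Psi (c *m x)) _) _.
apply: le_trans (lerD h1 (opnorm_dist _ (Psi c *m Psi x) _)) _.
rewrite mulmxBl opnormBC in h2.
by apply: le_trans (lerD (lexx _) (lerD (hc _ _ xB x1) h2)) _; exact: lmul_approx_bound.
Qed.

Lemma opnorm_block_scalar p (M : 'M[C]_D) :
  opnorm (\mxblock_(i < p, j < p) (M *+ (i == j))) <= opnorm M.
Proof.
apply: opnorm_le => [|x]; first exact: opnorm_ge0.
rewrite -(@ler_pXn2r _ 2) ?nnegrE ?mulr_ge0 ?l2norm_ge0 ?opnorm_ge0 //.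
rewrite exprMn !l2norm_sqr [in leRHS]rdot_submxcol rdot_submxcol mulr_sumr.
apply: ler_sum => i _; rewrite -{1 2}(submxcolK x) mul_mxblock_mxrow mxcolK.
have -> : \sum_j M *+ (i == j) *m submxcol x j = M *m submxcol x i.
  rewrite (bigD1 i) //= eqxx mulr1n big1 ?addr0 // => j ji.
  by rewrite eq_sym (negbTE ji) mulr0n mul0mx.
rewrite -!l2norm_sqr -exprMn ler_pXn2r ?nnegrE ?mulr_ge0 ?l2norm_ge0 ?opnorm_ge0 //.
exact: le_opnorm.
Qed.

(** The defect of a (x) 1_p is block diagonal with p equal blocks, so the size p does not enter the
    bound. This lets finitely many conditions on psi serve matrices of all sizes. *)
Lemma lmul_scalar p (a : X) eta : 0 < eta -> B a ->
  opnorm (psi (a * ms_adj a) - psi a *m psi (ms_adj a)) <= eta ^+ 2 ->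
  lmul eta (a%:M : 'M[X]_p).
Proof.
move=> e0 aB h; apply: lmul_defect => //; first exact: inB_scalar.
rewrite adjX_scalar -scalar_mxM !Psi_scalar mul_mxblock -mxblockB.
apply: le_trans h; apply: le_trans (opnorm_block_scalar p _).
rewrite le_eqVlt; apply/orP; left; apply/eqP; congr opnorm; apply: eq_mxblock => i j.
rewrite mulrnBl; congr (_ - _).
rewrite (bigD1 i) //= eqxx mulr1n big1 ?addr0 => [|k ki].
  by case: (i == j); rewrite ?mulr1n ?mulr0n ?mulmx0.
by rewrite eq_sym (negbTE ki) mulr0n mul0mx.
Qed.

End CompletelyPositive.

(** * Averages over the group *)

Section SumBound.
Context {R : realType}.

Lemma sum4_bound (a b c d e : R) : 0 <= a -> - e <= b -> - e <= c -> - e <= d ->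
  - (3 * e) <= a + b + (c + d).
Proof. by lra. Qed.

End SumBound.

Lemma sum_const_seq (V : zmodType) I (s : seq I) (u : V) : \sum_(i <- s) u = u *+ size s.
Proof. by elim: s => [|i s IH]; rewrite ?big_nil // big_cons IH /= mulrS. Qed.

Section InvariantVectors.
Context {R : realType} {G : groupType}.
Local Notation C := (R[i]).

Lemma invariant_decomp n (rho : G -> 'M[C]_n) x :
  exists x0 x1 : 'cV[C]_n, [/\ x = x0 + x1, forall g, rho g *m x0 = x0 &
    forall u, (forall g, rho g *m u = u) -> rdot x1 u = 0].
Proof.
have [K KP] : exists K : 'M[C]_n, forall u : 'rV_n,
    (forall g, rho g *m u^T = u^T) <-> (u <= K)%MS.
  apply: subspace_mx => [g|a u v hu hv g]; first by rewrite trmx0 mulmx0.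
  by rewrite raddfD /= linearZ /= mulmxDr -scalemxAr hu hv.
have : (x^T <= K + ortho (@Num.conj C) 1%:M K)%MS.
  by apply: submx_trans (submx1 _) _; rewrite addsmx_ortho submx_refl.
case/sub_addsmxP => [[a c]] /= xE.
exists ((a *m K)^T), ((c *m ortho (@Num.conj C) 1%:M K)^T); split.
- by apply: trmx_inj; rewrite xE raddfD /= !trmxK.
- by apply/KP; exact: submxMl.
move=> u uinv.
have /submxP [d ud] : (u^T <= K)%MS by apply/KP => g; rewrite trmxK uinv.
have /orthomx1P o : (ortho (@Num.conj C) 1%:M K <= ortho (@Num.conj C) 1%:M K)%MS.
  exact: submx_refl.
by rewrite -[u]trmxK ud rdot_trmx trmxC_mul -mulmxA (mulmxA _ (K^t*)) o mul0mx mulmx0 mxE.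
Qed.

End InvariantVectors.

Section Averages.
Context {R : realType} {G : groupType} {N : nat -> nat}.
Local Notation C := (R[i]).
Local Notation X := (mxseq R N).
Context (sigma : G -> X).
Context (sigma1 : sigma 1%g = 1) (sigmaM : forall g h, sigma (g * h)%g = sigma g * sigma h)
  (sigmaU : forall g, sigma g * ms_adj (sigma g) = 1).
Context (S : seq G) (kappa : R) (S0 : (0 < size S)%N) (kappa0 : 0 <= kappa) (kappa1 : kappa < 1).
Context (gap : gap_bound S kappa).

Section Twist.
Context {n : nat} (rho : G -> 'M[C]_n) (rhoU : mx_unitary_rep rho).

Definition twist g : 'M[X]_n := (sigma g)%:M *m scal (rho g).

Lemma twistE g i j : twist g i j = rho g i j *: sigma g.
Proof.
rewrite /twist -scal_scalar_comm scal_mulE (bigD1 j) //= big1 ?addr0 => [|l lj].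
  by rewrite [X in _ *: X]mxE eqxx mulr1n.
by rewrite [X in _ *: X]mxE (negbTE lj) mulr0n scaler0.
Qed.

Lemma twist1 : twist 1%g = 1%:M.
Proof. by rewrite /twist sigma1 mul1mx; case: rhoU => -> _ _; exact: scal1. Qed.

Lemma twistM g h : twist (g * h)%g = twist g *m twist h.
Proof.
rewrite /twist sigmaM; case: rhoU => _ -> _.
rewrite scalM scalar_mxM -!mulmxA; congr (_ *m _).
by rewrite !mulmxA scal_scalar_comm.
Qed.

Lemma twist_unitary g : twist g *m adjX (twist g) = 1%:M.
Proof.
rewrite /twist adjXM adjX_scalar adjX_scal mulmxA -(mulmxA (sigma g)%:M) -scalM.
case: rhoU => _ _ /(_ g) /unitarymxP ->; rewrite scal1 mulmx1 -scalar_mxM.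
by rewrite [X in X%:M](sigmaU g).
Qed.

Lemma lev_twist_rep m : mx_unitary_rep (fun g => lev m (twist g)).
Proof.
split=> [|g h|g]; first by rewrite twist1 lev1.
  by rewrite twistM levM.
by apply/unitarymxP; rewrite -lev_adj -levM twist_unitary lev1.
Qed.

Lemma twist_bnd g : mxbnd (twist g) 1.
Proof.
rewrite -(adjXK (twist g)); apply: mxbnd_adj; apply: mxbnd_isom.
by rewrite adjXK twist_unitary.
Qed.

Definition havg : 'M[X]_n := scal ((size S)%:R^-1)%:C%:M *m \sum_(g <- S) twist g.

Fixpoint hpow k : 'M[X]_n := if k is k'.+1 then havg *m hpow k' else 1%:M.

Lemma lev_sum m I (s : seq I) (F : I -> 'M[X]_n) :
  lev m (\sum_(i <- s) F i) = \sum_(i <- s) lev m (F i).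
Proof. by elim: s => [|i s IH]; rewrite ?big_nil ?lev0 // !big_cons levD IH. Qed.

Let sS : (size S)%:R != 0 :> R. Proof. by rewrite pnatr_eq0 -lt0n. Qed.

Lemma havgE m (x : 'cV[C]_(\sum_(i < n) N m)) : lev m havg *m x = ((size S)%:R^-1)%:C *: \sum_(g <- S) lev m (twist g) *m x.
Proof. by rewrite lev_scalc lev_sum -scalemxAl mulmx_suml. Qed.

Lemma havg_bnd : mxbnd havg 1.
Proof.
move=> m; apply: opnorm_le => // x; rewrite havgE l2normZ ger0_norm ?invr_ge0 //.
rewrite mul1r ler_pdivrMl ?ltr0n //; apply: le_trans (l2norm_sum _ _ _) _.
rewrite -sum1_size natr_sum mulr_suml; apply: ler_sum => g _.
by apply: opnorm_bound; exact: twist_bnd.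
Qed.

Lemma hpow_bnd k : mxbnd (hpow k) 1.
Proof.
elim: k => [|k IH] /=; first by move=> m; rewrite lev1 opnorm1.
exact: mxbnd1M havg_bnd IH.
Qed.

Definition fixedvec m (u : 'cV[C]_(\sum_(i < n) N m)) := forall g, lev m (twist g) *m u = u.

Lemma havg_perp m x : (forall u, fixedvec u -> rdot x u = 0) ->
  forall u, fixedvec u -> rdot (lev m havg *m x) u = 0.
Proof.
move=> xp u uinv; rewrite havgE rdotZl rdot_suml big1 ?mulr0 // => g _.
rewrite rdot_adjr; suff -> : (lev m (twist g))^t* *m u = u by exact: xp.
by rewrite -{1}(uinv g) mulmxA (unitary_rep_invl g (lev_twist_rep m)) mul1mx.
Qed.

Lemma hpow_perp m k x : (forall u, fixedvec u -> rdot x u = 0) ->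
  forall u, fixedvec u -> rdot (lev m (hpow k) *m x) u = 0.
Proof.
move=> xp; elim: k => [|k IH] /=; first by rewrite lev1 mul1mx.
by rewrite levM -mulmxA; exact: havg_perp.
Qed.

Lemma hpow_gap m k x : (forall u, fixedvec u -> rdot x u = 0) ->
  l2norm (lev m (hpow k) *m x) <= kappa ^+ k * l2norm x.
Proof.
move=> xp; elim: k => [|k IH] /=; first by rewrite lev1 mul1mx expr0 mul1r.
rewrite levM -mulmxA havgE l2normZ ger0_norm ?invr_ge0 //.
rewrite ler_pdivrMl ?ltr0n //.
apply: le_trans (gap (lev_twist_rep m) (hpow_perp k xp)) _.
by rewrite exprS -!mulrA [leRHS]mulrCA ler_wpM2l // ler_wpM2l.
Qed.

Lemma hpow_fix m k u : fixedvec u -> lev m (hpow k) *m u = u.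
Proof.
move=> uinv; elim: k => [|k IH] /=; first by rewrite lev1 mul1mx.
rewrite levM -mulmxA IH havgE.
rewrite (eq_bigr (fun=> u)) => [|g _]; last exact: uinv.
rewrite (sum_const_seq S u) -[u *+ _]scaler_nat scalerA.
by rewrite -(rmorph_nat (real_complex R)) -rmorphM mulVf // rmorph1 scale1r.
Qed.

(** The powers fix invariant vectors and shrink the complement by kappa^k; apply this to x - q x.
    Neither the level m nor the size n enters the rate. *)
Lemma hpow_projection (q : 'M[X]_n) k : adjX q = q -> q *m q = q ->
  (forall g, twist g *m q = q) ->
  (forall m u, fixedvec (m := m) u -> lev m q *m u = u) ->
  mxbnd (q - hpow k) (kappa ^+ k).
Proof.
move=> qh qq tq qinv m; rewrite levB opnormBC; apply: opnorm_le => [|x].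
  exact: exprn_ge0.
set Q := lev m q.
have QQ : Q *m Q = Q by rewrite -levM qq.
have Qh : Q^t* = Q by rewrite -lev_adj qh.
have Qx : fixedvec (Q *m x) by move=> g; rewrite mulmxA -levM tq.
have xp u : fixedvec u -> rdot (x - Q *m x) u = 0.
  by move=> /qinv uq; rewrite rdotDl rdotNl (rdot_adjr Q) Qh uq subrr.
have -> : (lev m (hpow k) - Q) *m x = lev m (hpow k) *m (x - Q *m x).
  by rewrite mulmxBl mulmxBr (hpow_fix k Qx).
apply: le_trans (hpow_gap k xp) _; rewrite ler_wpM2l ?exprn_ge0 //.
rewrite -(@ler_pXn2r _ 2) ?nnegrE ?l2norm_ge0 // !l2norm_sqr.
rewrite rdotDr (xp _ _ : rdot _ (- _) = 0) ?addr0; last first.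
  by move=> g; rewrite mulmxN Qx.
rewrite rdotDl rdotNl lerBlDr lerDl -QQ -mulmxA rdot_adjr Qh.
exact: rdot_ge0.
Qed.

Section Positivity.
Context (c : 'M[C]_n) (K : R) (K0 : 0 <= K).
Context (cK : forall D, opnorm (blks D c) <= K).
Context (cpos : forall m u, fixedvec (m := m) u -> 0 <= rdot (blks (N m) c *m u) u).

Definition havg_form k : 'M[X]_n := adjX (hpow k) *m scal c *m hpow k.

(** Split x into its invariant part and the rest. The form is nonnegative on the invariant part, and
    each of the three other terms has an argument shrunk by kappa^k. *)
Lemma havg_form_ge m k x :
  - (3 * K * kappa ^+ k) * rdot x x <= rdot (lev m (havg_form k) *m x) x.
Proof.
have [x0 [x1 [xE x0i x1p]]] := invariant_decomp (fun g => lev m (twist g)) x.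
rewrite /havg_form !levM lev_adj lev_scal -!mulmxA rdot_adjr trmxCK.
set H := lev m (hpow k); set M := blks (N m) c.
have Hx : H *m x = x0 + H *m x1 by rewrite {1}xE mulmxDr /H hpow_fix.
have orth : rdot x1 x0 = 0 by apply: x1p.
have nx : l2norm x ^+ 2 = l2norm x0 ^+ 2 + l2norm x1 ^+ 2.
  by rewrite !l2norm_sqr xE rdotDl !rdotDr (rdotC x0 x1) orth addr0 add0r.
have n0 : l2norm x0 <= l2norm x.
  by rewrite -(@ler_pXn2r _ 2) ?nnegrE ?l2norm_ge0 // nx lerDl sqr_ge0.
have n1 : l2norm x1 <= l2norm x.
  by rewrite -(@ler_pXn2r _ 2) ?nnegrE ?l2norm_ge0 // nx lerDr sqr_ge0.
set y := H *m x1.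
have k0 : 0 <= kappa ^+ k by exact: exprn_ge0.
have k1 : kappa ^+ k <= 1 by apply: exprn_ile1 => //; exact: ltW.
have yk : l2norm y <= kappa ^+ k * l2norm x.
  apply: le_trans (hpow_gap k x1p) _; exact: ler_wpM2l.
have y1 : l2norm y <= l2norm x.
  by apply: le_trans yk _; rewrite ler_piMl ?l2norm_ge0.
have Mb u v : l2norm u <= l2norm x -> l2norm v <= l2norm x ->
    l2norm u <= kappa ^+ k * l2norm x \/ l2norm v <= kappa ^+ k * l2norm x ->
    - (K * kappa ^+ k * rdot x x) <= rdot (M *m u) v.
  move=> hu hv h; rewrite lerNl -rdotNl; apply: le_trans (rdot_le _ _) _.
  rewrite l2normN -l2norm_sqr.
  have hM := le_trans (opnorm_bound u (cK (N m))) (lexx _).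
  apply: (@le_trans _ _ (K * (l2norm u * l2norm v))).
    by rewrite mulrA ler_wpM2r ?l2norm_ge0.
  rewrite -mulrA ler_wpM2l // expr2.
  case: h => h; first by rewrite mulrA; apply: ler_pM; rewrite ?l2norm_ge0.
  by rewrite mulrCA; apply: ler_pM; rewrite ?l2norm_ge0.
rewrite Hx -/y mulmxDr !rdotDl !rdotDr.
have h1 := Mb x0 y n0 y1 (or_intror yk).
have h2 := Mb y x0 y1 n0 (or_introl yk).
have h3 := Mb y y y1 y1 (or_introl yk).
have h0 := cpos x0i; rewrite -/M in h0.
rewrite mulNr -!mulrA; rewrite -mulrA in h1 h2 h3; exact: sum4_bound h0 h1 h2 h3.
Qed.

End Positivity.

Fixpoint words k : seq G :=
  if k is k'.+1 then [seq (g * h)%g | g <- S, h <- words k'] else [:: 1%g].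

Lemma size_words k : size (words k) = (size S ^ k)%N.
Proof. by elim: k => //= k IH; rewrite size_allpairs IH expnS. Qed.

Lemma hpow_words k :
  hpow k = scal ((size (words k))%:R^-1)%:C%:M *m \sum_(g <- words k) twist g.
Proof.
elim: k => [|k IH]; first by rewrite /= big_seq1 twist1 invr1 scal1 mulmx1.
rewrite [LHS]/= IH size_words -size_words /havg.
rewrite [RHS]/= big_allpairs_dep.
have -> : \sum_(i <- S) \sum_(j <- words k) twist (i * j)%g =
    (\sum_(g <- S) twist g) *m (\sum_(h <- words k) twist h).
  rewrite mulmx_suml; apply: eq_bigr => g _; rewrite mulmx_sumr.
  by apply: eq_bigr => h _; rewrite twistM.
rewrite !mulmxA -(mulmxA _ _ (scal _)) -scalc_comm !mulmxA -scalM -scalar_mxM.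
by rewrite -rmorphM /= size_allpairs natrM invfM.
Qed.

End Twist.
End Averages.

(** * Flipping tensor factors in quadratic forms *)

Section SwappedForms.
Context {R : realType}.
Local Notation C := (R[i]).

(** On vectors, [blks D M] acts as M on each of the D coordinate slices [sl t] separately. *)
Lemma opnorm_blks_le D p q (M : 'M[C]_(p, q)) : opnorm (blks D M) <= opnorm M.
Proof.
apply: opnorm_le => [|z]; first exact: opnorm_ge0.
pose sl (t : 'I_D) : 'cV[C]_q := \col_j submxcol z j t 0.
have e (r : nat) (w : 'cV[C]_(\sum_(i < r) D)) :
    l2norm w ^+ 2 = \sum_t \sum_i Normc.normc (submxcol w i t 0) ^+ 2.
  rewrite l2norm_sqr rdot_submxcol exchange_big; apply: eq_bigr => i _.
  by rewrite -l2norm_sqr l2norm_sqrE.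
rewrite -(@ler_pXn2r _ 2) ?nnegrE ?mulr_ge0 ?l2norm_ge0 ?opnorm_ge0 //.
rewrite exprMn !e mulr_sumr; apply: ler_sum => t _.
have -> : \sum_i Normc.normc (submxcol z i t 0) ^+ 2 = l2norm (sl t) ^+ 2.
  by rewrite l2norm_sqrE; apply: eq_bigr => i _; rewrite [in RHS]mxE.
have -> : \sum_i Normc.normc (submxcol (blks D M *m z) i t 0) ^+ 2 = l2norm (M *m sl t) ^+ 2.
  rewrite l2norm_sqrE; apply: eq_bigr => i _; congr (Normc.normc _ ^+ 2).
  rewrite -{1}(submxcolK z) mul_mxblock_mxrow mxcolK summxE [RHS]mxE.
  by apply: eq_bigr => j _; rewrite mul_scalar_mx [in RHS]mxE mxE.
rewrite -exprMn ler_pXn2r ?nnegrE ?mulr_ge0 ?l2norm_ge0 ?opnorm_ge0 //.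
exact: le_opnorm.
Qed.

Lemma l2norm_conj n (x : 'cV[C]_n) : l2norm (map_mx (@Num.conj C) x) = l2norm x.
Proof.
apply/eqP; rewrite -(@eqrXn2 _ 2) ?l2norm_ge0 // !l2norm_sqr !rdotE.
apply/eqP; apply: eq_bigr => i _; rewrite mxE.
by rewrite conjCK mulrC.
Qed.

Lemma opnorm_conj p q (M : 'M[C]_(p, q)) : opnorm (map_mx (@Num.conj C) M) <= opnorm M.
Proof.
apply: opnorm_le => [|x]; first exact: opnorm_ge0.
rewrite -[x]map_mxCK -map_mxM l2norm_conj.
by rewrite [in X in _ <= _ * X]l2norm_conj; exact: le_opnorm.
Qed.

(** The flip from C^D (x) C^n to C^n (x) C^D composed with complex conjugation. Conjugation is what
    makes [swap_form] relate a matrix to one with conjugate entries. *)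
Definition swapv n D (z : 'cV[C]_(\sum_(u < D) n)) : 'cV[C]_(\sum_(x < n) D) :=
  \mxcol_(x < n) \col_(u < D) (submxcol z u x 0)^*.

Lemma rdot_mxblock_entries p q r s (f : 'I_p -> 'I_q -> 'M[C]_(r, s)) w v :
  rdot ((\mxblock_(i < p, j < q) f i j) *m w) v =
  \sum_i \sum_j \sum_k \sum_l
    complex.Re (f i j k l * submxcol w j l 0 * (submxcol v i k 0)^*).
Proof.
rewrite rdot_mxblock; apply: eq_bigr => i _; apply: eq_bigr => j _.
rewrite rdotE; apply: eq_bigr => k _.
by rewrite mxE mulr_suml raddf_sum.
Qed.

Lemma conj_real_part (z : C) : complex.Re z^* = complex.Re z.
Proof. by case: z. Qed.

Lemma rdot_swapv n D (z : 'cV[C]_(\sum_(u < D) n)) : rdot (swapv z) (swapv z) = rdot z z.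
Proof.
rewrite !rdot_submxcol.
under eq_bigr do rewrite rdotE.
under [RHS]eq_bigr do rewrite rdotE.
rewrite exchange_big; apply: eq_bigr => u _; apply: eq_bigr => x _.
by rewrite mxcolK !mxE conjCK mulrC.
Qed.

Lemma swap_form n D (f : 'I_n -> 'I_n -> 'M[C]_D) (f' : 'I_D -> 'I_D -> 'M[C]_n) z :
  (forall x y u v, f' u v x y = (f x y u v)^*) ->
  rdot ((\mxblock_(u < D, v < D) f' u v) *m z) z =
  rdot ((\mxblock_(x < n, y < n) f x y) *m swapv z) (swapv z).
Proof.
move=> h; rewrite !rdot_mxblock_entries.
rewrite [RHS](eq_bigr (fun x => \sum_u \sum_v \sum_y
    complex.Re (f x y u v * submxcol (swapv z) y v 0 * (submxcol (swapv z) x u 0)^*))).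
  rewrite [RHS]exchange_big; apply: eq_bigr => u _.
  rewrite [RHS]exchange_big; apply: eq_bigr => v _.
  apply: eq_bigr => x _; apply: eq_bigr => y _.
  by rewrite -conj_real_part /swapv !mxcolK !mxE !rmorphM /= !conjCK h conjCK.
move=> x _; rewrite exchange_big; apply: eq_bigr => u _.
by rewrite exchange_big.
Qed.

End SwappedForms.

Section ApproximateAverages.
Context {R : realType} {G : groupType} {N : nat -> nat}.
Local Notation C := (R[i]).
Local Notation X := (mxseq R N).
Context (B : set X) (HB : unital_Cstar_subalg B).
Context (sigma : G -> X) (sigmaB : forall g, B (sigma g)).
Context (sigma1 : sigma 1%g = 1) (sigmaM : forall g h, sigma (g * h)%g = sigma g * sigma h)
  (sigmaU : forall g, sigma g * ms_adj (sigma g) = 1).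
Context (S : seq G) (kappa : R) (S0 : (0 < size S)%N) (kappa0 : 0 <= kappa) (kappa1 : kappa < 1).
Context (gap : gap_bound S kappa).
Context {D : nat} (psi : X -> 'M[C]_D) (Hpsi : ucp B psi).

Let psi_lin : linear_on B psi. Proof. by case: Hpsi. Qed.

Section Twisted.
Context {n : nat} (rho : G -> 'M[C]_n) (rhoU : mx_unitary_rep rho).
Local Notation twist := (twist sigma rho).
Local Notation hpow := (hpow sigma S rho).

Lemma inB_twist g : inB B (twist g).
Proof. by apply: (inBM HB); [exact: inB_scalar|exact: inB_scal]. Qed.

Lemma inB_havg : inB B (havg sigma S rho).
Proof.
apply: (inBM HB); first exact: inB_scal.
by apply: (inB_sum HB) => g _; exact: inB_twist.
Qed.

Lemma inB_hpow k : inB B (hpow k).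
Proof.
elim: k => [|k IH] /=; first exact: inB1.
by apply: (inBM HB) => //; exact: inB_havg.
Qed.

Lemma lmul_sum p q (I : eqType) (s : seq I) (F : I -> 'M[X]_(p, q)) eta :
  (forall i, inB B (F i)) -> (forall i, i \in s -> lmul B psi eta (F i)) ->
  lmul B psi ((size s)%:R * eta) (\sum_(i <- s) F i).
Proof.
move=> FB; elim: s => [_|i s IH hF].
  rewrite big_nil mul0r => r x xB x1.
  by rewrite mul0mx !(bmap0 HB psi_lin) mul0mx subr0 opnorm0.
rewrite big_cons /= -natr1 mulrDl mul1r addrC.
apply: (lmulD HB Hpsi) => //; first exact: (inB_sum HB).
  by apply: hF; rewrite mem_head.
by apply: IH => j js; apply: hF; rewrite inE js orbT.
Qed.

Lemma lmul_havg eta : (forall g, g \in S -> lmul B psi eta (twist g)) ->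
  lmul B psi eta (havg sigma S rho).
Proof.
move=> h; have sS : (size S)%:R != 0 :> R by rewrite pnatr_eq0 -lt0n.
have -> : eta = (size S)%:R^-1 * ((size S)%:R * eta) by rewrite mulrA mulVf // mul1r.
apply: (lmul_scal_mul HB Hpsi).
- by apply: (inB_sum HB) => g _; exact: inB_twist.
- by rewrite blks_scalar; apply: le_trans (opnorm_scalar _ _) _; rewrite ger0_norm ?invr_ge0.
- by apply: lmul_sum => // g; exact: inB_twist.
Qed.

Lemma lmul_hpow eta k : (forall g, g \in S -> lmul B psi eta (twist g)) ->
  lmul B psi (k%:R * (2 * eta)) (hpow k).
Proof.
move=> h; elim: k => [|k IH] /=.
  by rewrite mul0r -(scal1 n); exact: (lmul_scal HB Hpsi).
rewrite -natr1 mulrDl mul1r addrC; apply: (lmulM HB Hpsi) => //.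
- exact: inB_havg.
- exact: inB_hpow.
- exact: havg_bnd.
- exact: hpow_bnd.
- exact: lmul_havg.
Qed.

Section Projection.
Context (q : 'M[X]_n) (qh : adjX q = q) (qq : q *m q = q) (tq : forall g, twist g *m q = q).
Context (qinv : forall m (u : 'cV[C]_(\sum_(i < n) N m)),
  fixedvec sigma rho u -> lev m q *m u = u).

Lemma inB_projection : inB B q.
Proof.
apply: (inB_closed HB) => eps eps0.
have := @cvg_geometric _ 1 kappa; rewrite ger0_norm // => /(_ kappa1).
move=> /cvgrPdist_lt /(_ _ eps0) [k _ /(_ k (leqnn k))].
rewrite sub0r normrN /geometric /= mul1r ger0_norm ?exprn_ge0 // => hk.
exists (hpow k); first exact: inB_hpow.
by apply: mxbnd_le (ltW hk) _; exact: hpow_projection.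
Qed.

(* The bound does not depend on the size [n]; this is where property (T) is used. *)
Lemma lmul_projection eta k : (forall g, g \in S -> lmul B psi eta (twist g)) ->
  lmul B psi (k%:R * (2 * eta) + 2 * kappa ^+ k) q.
Proof.
move=> h; apply: (lmul_approx HB Hpsi (c := hpow k)).
- exact: exprn_ge0.
- exact: inB_projection.
- exact: inB_hpow.
- exact: hpow_projection.
- exact: lmul_hpow.
Qed.

End Projection.
End Twisted.

(** In this form only finitely many products of words occur as algebra elements, so psi need be
    controlled on these alone. *)
Lemma havg_form_words n (rho : G -> 'M[C]_n) (c : 'M[C]_n) k (rhoU : mx_unitary_rep rho) :
  havg_form sigma S rho c k =
  scal (((size (words S k))%:R^-1 ^+ 2)%:C%:M) *m
   \sum_(g <- words S k) \sum_(h <- words S k)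
     (ms_adj (sigma g) * sigma h)%:M *m scal ((rho g)^t* *m c *m rho h).
Proof.
rewrite /havg_form hpow_words // adjXM adjX_scal trmxC_scalar conj_realC.
have -> : adjX (\sum_(g <- words S k) twist sigma rho g) =
    \sum_(g <- words S k) adjX (twist sigma rho g).
  elim: (words S k) => [|g s IH]; last by rewrite !big_cons adjXD IH.
  by rewrite !big_nil; apply/matrixP => i j; rewrite !mxE ms_adj0.
set t := scal _; rewrite -scalc_comm -/t.
rewrite -!mulmxA (mulmxA (scal c)) -(scalc_comm _ (scal c)) -/t -!mulmxA.
rewrite (mulmxA _ t) -(scalc_comm _ (\sum_(g <- _) adjX _)) -/t !mulmxA.
rewrite -scalM -scalar_mxM -rmorphM -expr2 -!mulmxA; congr (_ *m _).
rewrite mulmx_suml; apply: eq_bigr => g _.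
rewrite !mulmx_sumr; apply: eq_bigr => h _.
rewrite /twist adjXM adjX_scalar adjX_scal !mulmxA.
rewrite scal_scalar_comm -!mulmxA; rewrite (scalar_mxM _ (ms_adj (sigma g))) -!mulmxA.
congr (_ *m _); rewrite (mulmxA (scal c)) scal_scalar_comm !mulmxA.
by rewrite scal_scalar_comm -!mulmxA -!scalM.
Qed.

End ApproximateAverages.

Section ScalarEntries.
Context {R : realType} {N : nat -> nat}.
Local Notation C := (R[i]).
Local Notation X := (mxseq R N).

Lemma scal_diagE p q (z : C) (a : 'M[X]_(p, q)) i j : (scal z%:M *m a) i j = z *: a i j.
Proof.
rewrite scal_mulE (bigD1 i) //= big1 ?addr0 => [|l li]; last first.
  by rewrite mxE eq_sym (negbTE li) mulr0n scale0r.
by rewrite mxE eqxx mulr1n.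
Qed.

Lemma scalar_scalE p q (a : X) (M : 'M[C]_(p, q)) i j : (a%:M *m scal M) i j = M i j *: a.
Proof.
rewrite mxE (bigD1 i) //= big1 ?addr0 => [|l li]; last first.
  by rewrite mxE eq_sym (negbTE li) mulr0n mul0r.
by rewrite !mxE eqxx mulr1n -ms_scaleAr mulr1.
Qed.

End ScalarEntries.

(** * Positivity inherited from the commutant of sigma *)

Section CommutantPositivity.
Context {R : realType} {G : groupType} {N : nat -> nat}.
Local Notation C := (R[i]).
Local Notation X := (mxseq R N).
Local Notation conjmx := (map_mx (@Num.conj C)).
Context (B : set X) (HB : unital_Cstar_subalg B).
Context (sigma : G -> X) (sigmaB : forall g, B (sigma g)).
Context (sigma1 : sigma 1%g = 1) (sigmaM : forall g h, sigma (g * h)%g = sigma g * sigma h)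
  (sigmaU : forall g, sigma g * ms_adj (sigma g) = 1).
Context (S : seq G) (kappa : R) (S0 : (0 < size S)%N) (kappa0 : 0 <= kappa) (kappa1 : kappa < 1).
Context (gap : gap_bound S kappa).
Context (a : X) (aB : B a) (ah : ms_adj a = a) (K : R) (K0 : 0 <= K)
  (aK : forall m, opnorm (a m) <= K).
(* [Z^t* *m Z] runs through positive elements of the commutant of [sigma _ m]. *)
Context (apos : forall m m' (Z : 'M[C]_(N m', N m)),
  (forall g, sigma g m' *m Z = Z *m sigma g m) ->
  0 <= complex.Re (\tr (a m *m (Z^t* *m Z)))).

(** The conjugate is taken so that a vector fixed by sigma_m' (x) conj(sigma_m) is an intertwiner
    from level m to level m'. *)
Definition level_rep m g : 'M[C]_(N m) := conjmx (sigma g m).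

Lemma sigma_level_unitary m g : sigma g m *m (sigma g m)^t* = 1%:M.
Proof. exact: (congr1 (fun x : X => x m) (sigmaU g)). Qed.

Lemma level_rep_unitary m : mx_unitary_rep (level_rep m).
Proof.
split=> [|g h|g]; rewrite /level_rep.
- by rewrite sigma1 (_ : (1 : X) m = 1%:M) // map_mx1.
- by rewrite sigmaM (_ : (sigma g * sigma h) m = sigma g m *m sigma h m) // map_mxM.
- by rewrite conjC_unitary; apply/unitarymxP; exact: sigma_level_unitary.
Qed.

(** Read the blocks of [u] as the columns of a matrix Z: that u is fixed means that Z intertwines,
    and the quadratic form becomes the trace in [apos]. *)
Lemma level_form_pos m m' (u : 'cV[C]_(\sum_(i < N m) N m')) :
  fixedvec sigma (level_rep m) u -> 0 <= rdot (blks (N m') (conjmx (a m)) *m u) u.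
Proof.
move=> uinv; pose Z : 'M[C]_(N m', N m) := \matrix_(t, x) submxcol u x t 0.
have ZE x : submxcol u x = col x Z by apply/matrixP => t j; rewrite !ord1 !mxE.
have Zs g : sigma g m' *m Z *m (sigma g m)^t* = Z.
  apply/matrixP => t x; rewrite [in RHS]mxE -(uinv g).
  rewrite -[X in submxcol (_ *m X)](submxcolK u) mul_mxblock_mxrow mxcolK summxE mxE.
  apply: eq_bigr => y _; rewrite twistE.
  rewrite (_ : (_ *: sigma g) m' = level_rep m g x y *: sigma g m') //.
  rewrite -scalemxAl ZE [in RHS]mxE mulrC; congr (_ * _); first by rewrite !mxE.
  by rewrite !mxE; apply: eq_bigr => s _; rewrite !mxE.
have Zc g : sigma g m' *m Z = Z *m sigma g m.
  rewrite -[in RHS](Zs g) -mulmxA.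
  by rewrite (mulmx1C (sigma_level_unitary m g)) mulmx1.
have := apos Zc; congr (_ <= _).
rewrite rdot_mxblock /mxtrace raddf_sum exchange_big; apply: eq_bigr => y _.
rewrite mxE raddf_sum; apply: eq_bigr => x _.
have -> : (a m) y x = ((a m) x y)^*.
  by have /(congr1 (fun M : X => M m y x)) := ah; rewrite /ms_adj !mxE => <-.
rewrite mul_scalar_mx rdot_def -scalemxAr !ZE !mxE.
congr (complex.Re (_ * _)); apply: eq_bigr => t _.
by rewrite !mxE.
Qed.

Section Fixed.
Context {D : nat} (psi : X -> 'M[C]_D) (Hpsi : ucp B psi) (k : nat).
Local Notation W := (words S k).
Local Notation w := ((size W)%:R^-1 ^+ 2 : R).
Local Notation delta := (3 * K * kappa ^+ k).

Let psi_lin : linear_on B psi. Proof. by case: Hpsi. Qed.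

(* [havg_form] for the representation conj(sigma_m) is a positive matrix up to [delta], hence so
   is its image under [psi]; exchanging the index in 'I_D with the index in 'I_(N m) gives a
   matrix over the algebra that is positive up to [delta] at every level. *)
Definition avg_mx : 'M[X]_D := \matrix_(u, v)
  (w%:C *: \sum_(g <- W) \sum_(h <- W)
     (psi (ms_adj (sigma g) * sigma h) u v)^* *: (ms_adj (sigma g) * a * sigma h)).

Lemma inB_word g h : B (ms_adj (sigma g) * sigma h).
Proof. by apply: (csub_mul HB) => //; exact: (csub_adj HB). Qed.

Lemma inB_aword g h : B (ms_adj (sigma g) * a * sigma h).
Proof. by apply: (csub_mul HB) => //; apply: (csub_mul HB) => //; exact: (csub_adj HB). Qed.

Lemma inB_avg_mx : inB B avg_mx.
Proof.
move=> u v; rewrite mxE; apply: (csub_scale HB); apply: (B_sum HB) => g _.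
apply: (B_sum HB) => h _; apply: (csub_scale HB); exact: inB_aword.
Qed.

Lemma avg_mx_adj : adjX avg_mx = avg_mx.
Proof.
apply/matrixP => u v; rewrite !mxE ms_adjZ conj_realC; congr (_ *: _).
rewrite ms_adj_sum exchange_big; apply: eq_bigr => h _.
rewrite ms_adj_sum; apply: eq_bigr => g _.
rewrite ms_adjZ conjCK !ms_adjM ms_adjK ah mulrA; congr (_ *: _).
have := psi_adj HB Hpsi (inB_word g h).
by rewrite ms_adjM ms_adjK => ->; rewrite !mxE.
Qed.

Lemma avg_mx_ge m x : - delta * rdot x x <= rdot (lev m avg_mx *m x) x.
Proof.
pose z := havg_form sigma S (level_rep m) (conjmx (a m)) k.
have zB : inB B z.
  rewrite /z /havg_form; apply: (inBM HB); last exact: inB_hpow.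
  by apply: (inBM HB); [apply: (inB_adj HB); exact: inB_hpow|exact: inB_scal].
have zh : adjX z = z.
  rewrite /z /havg_form !adjXM adjXK adjX_scal mulmxA.
  suff -> : (conjmx (a m))^t* = conjmx (a m) by [].
  apply/matrixP => i j; rewrite !mxE conjCK.
  by have /(congr1 (fun M : X => M m j i)) := ah; rewrite /ms_adj !mxE => ->.
have zge m' v : - delta * rdot v v <= rdot (lev m' z *m v) v.
  apply: havg_form_ge => //.
  - exact: level_rep_unitary.
  - move=> D'; apply: le_trans (opnorm_blks_le _ _) _.
    by apply: le_trans (opnorm_conj _) _; exact: aK.
  - by move=> m0 u; exact: level_form_pos.
have := Psi_ge HB Hpsi zB zh zge (swapv x).
(* After the flip, the image under psi of the form z built from level m is [avg_mx] evaluated at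
   level m. *)
rewrite rdot_swapv; congr (_ <= _); symmetry; apply: swap_form => i j u v.
have -> : z i j = w%:C *: \sum_(g <- W) \sum_(h <- W)
    ((level_rep m g)^t* *m conjmx (a m) *m level_rep m h) i j *: (ms_adj (sigma g) * sigma h).
  rewrite /z (havg_form_words sigma1 sigmaM S _ _ (level_rep_unitary m)).
  rewrite scal_diagE; congr (_ *: _); rewrite summxE; apply: eq_bigr => g _.
  by rewrite summxE; apply: eq_bigr => h _; rewrite scalar_scalE.
rewrite (linear_onZ HB _ psi_lin); last first.
  apply: (B_sum HB) => g _; apply: (B_sum HB) => h _; apply: (csub_scale HB); exact: inB_word.
rewrite (linear_on_sum HB _ psi_lin); last first.
  by move=> g _; apply: (B_sum HB) => h _; apply: (csub_scale HB); exact: inB_word.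
have -> : avg_mx u v m = w%:C *: (\sum_(g <- W) \sum_(h <- W)
     (psi (ms_adj (sigma g) * sigma h) u v)^* *: (ms_adj (sigma g) * a * sigma h)) m.
  by rewrite /avg_mx mxE.
have cM (p q : C) : (p * q)^* = p^* * q^* by exact: rmorphM.
rewrite [in LHS]mxE [in RHS]mxE cM conj_realC; congr (_ * _).
rewrite ms_sumE !summxE rmorph_sum; apply: eq_bigr => g _.
rewrite (linear_on_sum HB _ psi_lin); last first.
  by move=> h _; apply: (csub_scale HB); exact: inB_word.
rewrite ms_sumE !summxE rmorph_sum; apply: eq_bigr => h _.
rewrite (linear_onZ HB _ psi_lin); last exact: inB_word.
rewrite -[RHS]/(((((level_rep m g)^t* *m conjmx (a m) *m level_rep m h) i j *:
  psi (ms_adj (sigma g) * sigma h)) u v)^*) [in RHS]mxE cM.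
rewrite (_ : (_ *: (ms_adj (sigma g) * a * sigma h)) m =
  (psi (ms_adj (sigma g) * sigma h) u v)^* *: ((sigma g m)^t* *m a m *m sigma h m)) //.
rewrite [in LHS]mxE mulrC; congr (_ * _).
have -> : (level_rep m g)^t* *m conjmx (a m) *m level_rep m h =
   conjmx ((sigma g m)^t* *m a m *m sigma h m).
  by rewrite !map_mxM /level_rep map_trmx.
by rewrite [in RHS]mxE conjCK.
Qed.

(** The lower bound is meant to be compared with mu(a): for an approximately multiplicative psi,
    each summand divided by D is close to mu of g^* a h h^* g, where g and h stand for their images
    under sigma, and this is mu(a). *)
Lemma avg_trace_ge :
  - delta * D%:R <= w * \sum_(g <- W) \sum_(h <- W)
    complex.Re (\tr (psi (ms_adj (sigma g) * a * sigma h) *m psi (ms_adj (sigma h) * sigma g))).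
Proof.
(* The diagonal vector turns the quadratic form of [avg_mx] under [psi] into a trace. *)
pose i0 : 'cV[C]_(\sum_(u < D) D) := \mxcol_(u < D) delta_mx u 0.
have i0n : rdot i0 i0 = D%:R.
  rewrite rdot_submxcol -[X in _ = X%:R](card_ord D) -sum1_card natr_sum.
  by apply: eq_bigr => u _; rewrite mxcolK -l2norm_sqr l2norm_delta expr1n.
have := Psi_ge HB Hpsi inB_avg_mx avg_mx_adj avg_mx_ge i0; rewrite i0n.
congr (_ <= _); rewrite /bmap rdot_mxblock.
have -> (F : G -> G -> R) : w * (\sum_(g <- W) \sum_(h <- W) F g h) =
    \sum_(g <- W) \sum_(h <- W) w * F g h.
  by rewrite mulr_sumr; apply: eq_bigr => g _; rewrite mulr_sumr.
transitivity (\sum_(u < D) \sum_(v < D) \sum_(g <- W) \sum_(h <- W)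
   w * complex.Re (psi (ms_adj (sigma g) * a * sigma h) u v *
                   (psi (ms_adj (sigma g) * sigma h) u v)^*)).
  apply: eq_bigr => u _; apply: eq_bigr => v _; rewrite !mxcolK rdot_delta -colE mxE.
  rewrite [avg_mx u v]mxE (linear_onZ HB _ psi_lin); last first.
    by apply: (B_sum HB) => g _; apply: (B_sum HB) => h _; apply: (csub_scale HB); exact: inB_aword.
  rewrite (linear_on_sum HB _ psi_lin); last first.
    by move=> g _; apply: (B_sum HB) => h _; apply: (csub_scale HB); exact: inB_aword.
  rewrite mxE summxE mulr_sumr raddf_sum; apply: eq_bigr => g _.
  rewrite (linear_on_sum HB _ psi_lin); last first.
    by move=> h _; apply: (csub_scale HB); exact: inB_aword.
  rewrite summxE mulr_sumr raddf_sum; apply: eq_bigr => h _.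
  rewrite (linear_onZ HB _ psi_lin) ?mxE; last exact: inB_aword.
  rewrite [_^* * _]mulrC; case: (_ * _^*) => p q /=; by rewrite mul0r subr0.
transitivity (\sum_(u < D) \sum_(g <- W) \sum_(v < D) \sum_(h <- W)
   w * complex.Re (psi (ms_adj (sigma g) * a * sigma h) u v *
                   (psi (ms_adj (sigma g) * sigma h) u v)^*)).
  by apply: eq_bigr => u _; rewrite exchange_big.
rewrite exchange_big; apply: eq_bigr => g _.
transitivity (\sum_(u < D) \sum_(h <- W) \sum_(v < D)
   w * complex.Re (psi (ms_adj (sigma g) * a * sigma h) u v *
                   (psi (ms_adj (sigma g) * sigma h) u v)^*)).
  by apply: eq_bigr => u _; rewrite exchange_big.
rewrite exchange_big; apply: eq_bigr => h _.
rewrite /mxtrace raddf_sum mulr_sumr; apply: eq_bigr => u _.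
rewrite mxE raddf_sum mulr_sumr; apply: eq_bigr => v _.
congr (_ * complex.Re (_ * _)).
by rewrite -[in RHS](ms_adjK (sigma g)) -ms_adjM (psi_adj HB Hpsi (inB_word g h)) !mxE.
Qed.

End Fixed.

End CommutantPositivity.

Section TraceLimits.
Context {R : realType} {N : nat -> nat}.
Local Notation C := (R[i]).
Local Notation X := (mxseq R N).
Context (B : set X) (HB : unital_Cstar_subalg B) (mu : X -> C).
Context {D : nat -> nat} {psi : forall j, X -> 'M[C]_(D j)}.
Context (psi_mul : forall x y, B x -> B y ->
  opnorm (psi j (x * y) - psi j x *m psi j y) @[j --> \oo] --> (0 : R)).
Context (psi_tr : forall x, B x -> (ntr (psi j x) : C^o) @[j --> \oo] --> (mu x : C^o)).

Lemma near_trace x e : B x -> 0 < e ->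
  \forall j \near \oo, `|complex.Re (ntr (psi j x)) - complex.Re (mu x)| < e.
Proof.
move=> xB e0; have eC : 0 < e%:C by rewrite ltcR.
have /cvgrPdist_lt /(_ _ eC) := psi_tr xB; apply: filter_app; near=> j => h.
apply: le_lt_trans (_ : Normc.normc (mu x - ntr (psi j x)) < e).
  have [h1 _] := normc_ge_abs (mu x - ntr (psi j x)); apply: le_trans h1.
  by rewrite distrC raddfB.
by move: h; rewrite normc_def /= ltcR; case: (mu x - _).
Unshelve. all: by end_near. Qed.

Lemma near_mul x y e : B x -> B y -> 0 < e ->
  \forall j \near \oo, opnorm (psi j (x * y) - psi j x *m psi j y) < e.
Proof.
move=> xB yB e0; have /cvgrPdist_lt /(_ _ e0) := psi_mul xB yB.
apply: filter_app; near=> j; by rewrite sub0r normrN ger0_norm // opnorm_ge0.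
Unshelve. all: by end_near. Qed.

Lemma near_all (T : eqType) (s : seq T) (P : T -> nat -> Prop) :
  (forall t, \forall j \near \oo, P t j) ->
  \forall j \near \oo, forall t, t \in s -> P t j.
Proof.
move=> h; elim: s => [|t s IH]; first by near=> j.
near=> j => u; rewrite inE => /orP [/eqP ->|us]; first by near: j; exact: h.
by move: u us; near: j.
Unshelve. all: by end_near. Qed.

Context (Dpos : forall j, (0 < D j)%N) (Hpsi : forall j, ucp B (psi j)).

Lemma Re_ntr n (M : 'M[C]_n) : complex.Re (ntr M) = complex.Re (\tr M) / n%:R.
Proof.
have -> : ntr M = \tr M * (n%:R^-1)%:C by rewrite /ntr fmorphV rmorph_nat.
by case: (\tr M) => p q /=; rewrite mulr0 subr0.
Qed.

Lemma ntr_opnorm n (M : 'M[C]_n) : (0 < n)%N -> `|complex.Re (ntr M)| <= opnorm M.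
Proof.
move=> n0; rewrite Re_ntr normrM normfV normr_nat ler_pdivrMr ?ltr0n // mulrC.
exact: opnorm_mxtrace.
Qed.

Lemma near_trace_mul x y e : B x -> B y -> 0 < e ->
  \forall j \near \oo,
    complex.Re (ntr (psi j x *m psi j y)) < complex.Re (mu (x * y)) + e.
Proof.
move=> xB yB e0; have e2 : 0 < e / 2 by rewrite divr_gt0.
near=> j.
have -> : psi j x *m psi j y = psi j (x * y) - (psi j (x * y) - psi j x *m psi j y).
  by rewrite opprB addrCA subrr addr0.
have h1 : opnorm (psi j (x * y) - psi j x *m psi j y) < e / 2.
  by near: j; exact: near_mul.
have h2 : `|complex.Re (ntr (psi j (x * y))) - complex.Re (mu (x * y))| < e / 2.
  by near: j; apply: near_trace => //; exact: (csub_mul HB).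
have h3 := le_lt_trans (ntr_opnorm _ (Dpos j)) h1.
move: h2 h3; rewrite !ltr_norml => /andP[_ h2] /andP[h3 _].
rewrite /ntr linearB mulrBl raddfB /= -/(ntr _) -/(ntr (_ - _)).
rewrite [e]splitr addrA; apply: ltrD; first by rewrite -ltrBlDl.
by rewrite ltrNl.
Unshelve. all: by end_near. Qed.

Context (mu_tr : tracial_state B mu).
Context {G : groupType} (sigma : G -> X) (sigmaB : forall g, B (sigma g)).
Context (sigma1 : sigma 1%g = 1) (sigmaM : forall g h, sigma (g * h)%g = sigma g * sigma h)
  (sigmaU : forall g, sigma g * ms_adj (sigma g) = 1).
Context (S : seq G) (kappa : R) (S0 : (0 < size S)%N) (kappa0 : 0 <= kappa) (kappa1 : kappa < 1).
Context (gap : gap_bound S kappa).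
Context (a : X) (aB : B a) (ah : ms_adj a = a) (K : R) (K0 : 0 <= K)
  (aK : forall m, opnorm (a m) <= K).
Context (apos : forall m m' (Z : 'M[C]_(N m', N m)),
  (forall g, sigma g m' *m Z = Z *m sigma g m) ->
  0 <= complex.Re (\tr (a m *m (Z^t* *m Z)))).

(** The order of choices matters: for fixed k only finitely many pairs of words occur, j is chosen
    to suit them, and k tends to infinity last. *)
Lemma trace_commutant_ge0 : 0 <= complex.Re (mu a).
Proof.
have [_ _ _ muC] := mu_tr.
have key k e : 0 < e -> - (3 * K * kappa ^+ k) <= complex.Re (mu a) + e.
  move=> e0; pose W := words S k.
  have h : \forall j \near \oo, forall p : G * G, p \in [seq (g, h) | g <- W, h <- W] ->
      complex.Re (ntr (psi j (ms_adj (sigma p.1) * a * sigma p.2) *m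
                       psi j (ms_adj (sigma p.2) * sigma p.1))) < complex.Re (mu a) + e.
    apply: near_all => -[g g'] /=.
    have -> : mu a = mu (ms_adj (sigma g) * a * sigma g' * (ms_adj (sigma g') * sigma g)).
      rewrite -mulrA (mulrA (sigma g')) sigmaU mul1r -mulrA muC; last 2 first.
      - exact: (csub_adj HB).
      - exact: (csub_mul HB).
      by rewrite -mulrA sigmaU mulr1.
    apply: near_trace_mul => //; first exact: (inB_aword HB).
    exact: (inB_word HB).
  have [j hj] := filter_ex h.
  have := avg_trace_ge HB sigmaB sigma1 sigmaM sigmaU S0 kappa0 kappa1 gap aB ah K0 aK apos
     (Hpsi j) k.
  have Dj : 0 < (D j)%:R :> R by rewrite ltr0n.
  rewrite -ler_pdivlMr // => h1; apply: le_trans h1 _.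
  rewrite -mulrA mulr_suml; set w := size _; have w0 : 0 < (w%:R : R).
    by rewrite ltr0n /w size_words expn_gt0 S0.
  apply: le_trans (_ : w%:R^-1 ^+ 2 * (\sum_(g <- W) \sum_(h <- W) (complex.Re (mu a) + e)) <= _).
    rewrite ler_pM2l ?exprn_gt0 ?invr_gt0 //.
    rewrite big_seq [leRHS]big_seq; apply: ler_sum => g gW.
    rewrite mulr_suml big_seq [leRHS]big_seq; apply: ler_sum => g' gW'.
    by rewrite -Re_ntr; apply/ltW/(hj (g, g')); apply/allpairsP; exists (g, g').
  rewrite !sum_const_seq -mulrnA -[X in _ * X]mulr_natl natrM -/w mulrA exprVn -expr2.
  by rewrite mulVf ?mul1r // expf_neq0 // gt_eqF.
apply/ler_addgt0Pr => e e0; have e2 : 0 < e / 2 by rewrite divr_gt0.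
have [k hk] : exists k, 3 * K * kappa ^+ k <= e / 2.
  have hc : 3 * K * kappa ^+ n @[n --> \oo] --> 3 * K * 0.
    by apply: cvgMr; apply: cvg_expr; rewrite ger0_norm.
  rewrite mulr0 in hc; have /cvgr0_norm_le /(_ _ e2) h := hc.
  by have [k hk] := filter_ex h; exists k; apply: le_trans hk; exact: ler_norm.
rewrite [e]splitr addrA -lerBlDr sub0r; apply: le_trans (key k _ e2).
by rewrite lerN2.
Qed.

End TraceLimits.

(** * The algebra A *)

Section Kernels.
Context {R : realType} {d : nat -> nat} {b : nat}.
Local Notation C := (R[i]).
Local Notation X := (mxseq R (Edim d b)).
Local Notation EB m := (@Ebasis d b m).
Local Notation Tg k p := (Tagged (fun n : nat => 'I_(d n)) (i := k) p).

Definition ent m (M : 'M[C]_(Edim d b m)) (x y : EB m) : C :=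
  M (enum_rank x) (enum_rank y).

Lemma ent_Eop m (f : EB m -> EB m -> C) x y : ent (Eop f) x y = f x y.
Proof. by rewrite /ent mxE !enum_rankK. Qed.

Lemma ent_inj m (M M' : 'M[C]_(Edim d b m)) :
  (forall x y, ent M x y = ent M' x y) -> M = M'.
Proof.
move=> h; apply/matrixP => i j; have := h (enum_val i) (enum_val j).
by rewrite /ent !enum_valK.
Qed.

Lemma sum_Edim m (F : 'I_(Edim d b m) -> C) : \sum_i F i = \sum_(z : EB m) F (enum_rank z).
Proof.
rewrite (reindex (@enum_rank (EB m))) //.
by exists enum_val => z _; [exact: enum_rankK|exact: enum_valK].
Qed.

Lemma ent_mul m (M M' : 'M[C]_(Edim d b m)) x y :
  ent (M *m M') x y = \sum_z ent M x z * ent M' z y.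
Proof. by rewrite /ent mxE sum_Edim. Qed.

Lemma ent_adj m (M : 'M[C]_(Edim d b m)) x y : ent (M^t*) x y = (ent M y x)^*.
Proof. by rewrite /ent !mxE. Qed.

Lemma ent1 m (x y : EB m) : ent 1%:M x y = (x == y)%:R.
Proof. by rewrite /ent mxE (inj_eq enum_rank_inj). Qed.

Lemma ent_sum m I (s : seq I) (P : pred I) (F : I -> 'M[C]_(Edim d b m)) x y :
  ent (\sum_(i <- s | P i) F i) x y = \sum_(i <- s | P i) ent (F i) x y.
Proof. by rewrite /ent summxE. Qed.

Lemma mxtrace_ent m (M : 'M[C]_(Edim d b m)) : \tr M = \sum_x ent M x x.
Proof. by rewrite /mxtrace sum_Edim. Qed.

Lemma ms_ent_ext (a c : X) : (forall m x y, ent (a m) x y = ent (c m) x y) -> a = c.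
Proof. by move=> h; apply: functional_extensionality_dep => m; exact: ent_inj. Qed.

Lemma mx_ent_ext p q (a c : 'M[X]_(p, q)) :
  (forall i j m x y, ent (a i j m) x y = ent (c i j m) x y) -> a = c.
Proof. by move=> h; apply/matrixP => i j; exact: ms_ent_ext. Qed.

Lemma mx_ent_mul p q r (a : 'M[X]_(p, q)) (c : 'M[X]_(q, r)) i j m x y :
  ent ((a *m c) i j m) x y = \sum_k \sum_z ent (a i k m) x z * ent (c k j m) z y.
Proof. by rewrite mxE ms_sumE ent_sum; apply: eq_bigr => k _; rewrite ent_mul. Qed.

(** The multiplicity index. The representation sigma changes only the coordinate [hpart], so basis
    vectors with one [mult] span one copy of a conj(pi_k). *)
Definition mult m (x : EB m) : bool * seq 'I_b := (copy_of x, word_of x).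

Lemma Ebasis_ext m (x y : EB m) : mult x = mult y -> hpart x = hpart y -> x = y.
Proof.
case: x => cx [k [p w]]; case: y => cy [k' [p' w']] [/= -> ew] eh.
have ek : k = k' by apply: val_inj; exact: (congr1 (@tag _ _) eh).
case: k' / ek p' w' ew eh => p' w' ew eh.
have -> : p = p'.
  by have := eqP (introT eqP eh); rewrite /hpart /= => /eqP; rewrite -tag_eqE /tag_eq eqxx /= tagged_asE => /eqP.
by have -> : w = w' by exact: val_inj.
Qed.

Lemma word_level m (x : EB m) : (size (word_of x) + level_of x = m)%N.
Proof. by case: x => c [k [p w]]; rewrite /= size_tuple subnK // -ltnS. Qed.

Lemma hpart_level m (x : EB m) : tag (hpart x) = level_of x.
Proof. by []. Qed.

Section Level.
Context {m k : nat} (km : (k <= m)%N).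

Definition bvec (c : bool) (p : 'I_(d k)) (w : (m - k).-tuple 'I_b) : EB m :=
  (c, Tagged (fun k : 'I_m.+1 => ('I_(d k) * (m - k).-tuple 'I_b)%type)
    (i := Ordinal (km : (k < m.+1)%N)) (p, w)).

Lemma mult_bvec c p w : mult (bvec c p w) = (c, val w). Proof. by []. Qed.
Lemma sum_level (F : EB m -> C) :
  \sum_(z | level_of z == k) F z = \sum_c \sum_p \sum_w F (bvec c p w).
Proof.
rewrite (eq_bigl (fun z : EB m => xpredT z.1 && (val (tag z.2) == k))) //.
rewrite (eq_bigr (fun z => F (z.1, z.2))) => [|[]] //.
rewrite -(pair_big xpredT (fun u : {k : 'I_m.+1 & ('I_(d k) * (m - k).-tuple 'I_b)%type} => val (tag u) == k)
  (fun c u => F (c, u))) /=.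
apply: eq_bigr => c _.
rewrite (eq_bigl (fun u : {k : 'I_m.+1 & ('I_(d k) * (m - k).-tuple 'I_b)%type} =>
  (val (tag u) == k) && true)) => [|u]; last by rewrite andbT.
rewrite (eq_bigr (fun u => F (c, Tagged _ (tagged u)))) => [|[]] //.
rewrite -(sig_big_dep (fun k' : 'I_m.+1 => val k' == k) (fun _ _ => true)
  (fun k' pw => F (c, Tagged (fun k : 'I_m.+1 => ('I_(d k) * (m - k).-tuple 'I_b)%type) pw))) /=.
rewrite (big_pred1 (Ordinal (km : (k < m.+1)%N))) ; last by [].
rewrite /=.
rewrite pair_bigA; apply: eq_bigr => -[p w] _ //.
Qed.

End Level.

Lemma sum_level_out m k (F : EB m -> C) : (m < k)%N ->
  \sum_(z | level_of z == k) F z = 0.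
Proof.
move=> mk; rewrite big_pred0 // => z; apply: contraTF mk => /eqP <-.
by rewrite -leqNgt; apply: leq_trans (leq_addl (size (word_of z)) _) _; rewrite word_level.
Qed.

Lemma sum_tuple_delta n (s : seq 'I_b) (f : seq 'I_b -> C) : size s = n ->
  \sum_(w : n.-tuple 'I_b | val w == s) f w = f s.
Proof.
move=> <-; rewrite (big_pred1 (in_tuple s)) // => w.
Qed.

Lemma sum_fiber m k c s (f : {k : nat & 'I_(d k)} -> C) : (size s + k = m)%N ->
  \sum_(z : EB m | mult z == (c, s)) f (hpart z) = \sum_p f (Tg k p).
Proof.
move=> e; have km : (k <= m)%N by rewrite -e leq_addl.
transitivity (\sum_(z : EB m | level_of z == k) (mult z == (c, s))%:R * f (hpart z)).
  rewrite [RHS](bigID (fun z => mult z == (c, s))) /= [X in _ + X]big1 ?addr0 => [|z /andP[_ /negbTE ->]]; last by rewrite mul0r.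
  rewrite (eq_bigl (fun z : EB m => (level_of z == k) && (mult z == (c, s)))) => [|z].
    by apply: eq_bigr => z /andP[_ ->]; rewrite mul1r.
  case: eqP => [[_ ew]|]; rewrite ?andbF // andbT.
  have h := word_level z; rewrite ew in h; symmetry; apply/eqP/(@addnI (size s)).
  by rewrite h e.
rewrite (sum_level km) (bigD1 c) //= [X in _ + X]big1 ?addr0 => [|c' c'c]; last first.
  by rewrite big1 // => p _; rewrite big1 // => w _; rewrite xpair_eqE (negbTE c'c) mul0r.
apply: eq_bigr => p _; rewrite (bigID (fun w => val w == s)) /=.
rewrite [X in _ + X]big1 ?addr0 => [|w /negbTE ws]; last by rewrite xpair_eqE ws andbF mul0r.
rewrite (eq_bigr (fun w => f (Tg k p))) => [|w ws]; last by rewrite xpair_eqE eqxx ws mul1r.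
by rewrite (@sum_tuple_delta _ s (fun=> f (Tg k p))) // -e addnK.
Qed.

End Kernels.

Section CommutativeProducts.
Context (T : comNzRingType).
Implicit Types a e k l n s t : T.

Lemma mul_swap4 k l n a e : (k * l * a) * (l * n * e) = k * n * (l * l * (a * e)).
Proof. ring. Qed.

Lemma mul_swap5 a e s t : (a * a) * (e * e) * t * s = (a * e * s) * (a * e * t).
Proof. ring. Qed.

Lemma mul_swap6 a e s t : a * (t * s) * e = a * e * t * s.
Proof. ring. Qed.

End CommutativeProducts.

(** * Operators between spaces of invariant vectors *)

Section Theta.
Context {R : realType} {d : nat -> nat} {b : nat} (d_pos : forall k, (0 < d k)%N).
Local Notation C := (R[i]).
Local Notation X := (mxseq R (Edim d b)).
Local Notation EB m := (@Ebasis d b m).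
Local Notation Tg k p := (Tagged (fun n : nat => 'I_(d n)) (i := k) p).
Local Notation U := (bool * seq 'I_b)%type.
Local Notation kernel := (nat -> U -> U -> C).

(** This normalizes the invariant vector of conj H_k (x) H_k, the sum of all conj(e_i) (x) e_i,
    whose norm is the square root of d_k. *)
Definition isqd k : R := (Num.sqrt (d k)%:R)^-1.

Lemma realcM (p q : R) : (p * q)%:C = p%:C * q%:C :> C.
Proof. exact: rmorphM. Qed.

Lemma ent_scale (z : C) (a : X) m (x y : EB m) : ent ((z *: a) m) x y = z * ent (a m) x y.
Proof. by rewrite /ent mxE. Qed.

Lemma isqd_sqr k : isqd k * isqd k * (d k)%:R = 1.
Proof.
have d0 : (0 < (d k)%:R :> R) by rewrite ltr0n.
by rewrite /isqd -expr2 exprVn sqr_sqrtr ?ltW // mulVf ?gt_eqF.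
Qed.

Lemma isqd_sqrC k : (isqd k * isqd k)%:C * (d k)%:R = 1 :> C.
Proof.
have -> : (d k)%:R = ((d k)%:R)%:C :> C by rewrite rmorph_nat.
by rewrite -realcM isqd_sqr.
Qed.

(* [Theta k l A] is [A] on multiplicity spaces, tensored with the rank-one operator
   between the unit invariant vectors of [conj H_l (x) H_l] and [conj H_k (x) H_k]. *)
Definition Theta k l (A : kernel) : 'M[X]_(d k, d l) := \matrix_(i, j) (fun m =>
  Eop (fun x y => ((hpart x == Tg k i) && (hpart y == Tg l j))%:R *
                  ((isqd k * isqd l)%:C * A m (mult x) (mult y)))).

Lemma ent_Theta k l A i j m x y : ent (Theta k l A i j m) x y =
  ((hpart x == Tg k i) && (hpart y == Tg l j))%:R * ((isqd k * isqd l)%:C * A m (mult x) (mult y)).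
Proof. by rewrite mxE ent_Eop. Qed.

Lemma hpart_word m (x : EB m) k i : hpart x = Tg k i -> (size (mult x).2 + k = m)%N.
Proof. by move=> h; have := word_level x; rewrite -hpart_level h. Qed.

Lemma level_hpart m (x : EB m) k : level_of x = k -> exists p, hpart x = Tg k p.
Proof. by case: x => c [k' [p w]] <-; exists p. Qed.

Lemma Theta_ext k l (A A' : kernel) :
  (forall m u v, (size u.2 + k = m)%N -> (size v.2 + l = m)%N -> A m u v = A' m u v) ->
  Theta k l A = Theta k l A'.
Proof.
move=> h; apply: mx_ent_ext => i j m x y; rewrite !ent_Theta.
case: eqP => [hx|]; last by rewrite !mul0r.
case: eqP => [hy|]; last by rewrite !mul0r.
by rewrite (h m) //; [exact: hpart_word hx|exact: hpart_word hy].
Qed.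

Lemma Theta_adj k l A : adjX (Theta k l A) = Theta l k (fun m u v => (A m v u)^*).
Proof.
apply: mx_ent_ext => i j m x y; rewrite mxE ent_adj !ent_Theta andbC.
have cM (p q : C) : (p * q)^* = p^* * q^* by exact: rmorphM.
rewrite !cM conj_realC [isqd l * _]mulrC; congr (_ * _).
by case: (_ && _); rewrite ?rmorph1 ?rmorph0.
Qed.

Lemma ThetaD k l A A' : Theta k l A + Theta k l A' = Theta k l (fun m u v => A m u v + A' m u v).
Proof.
apply: mx_ent_ext => i j m x y; rewrite mxE.
transitivity (ent (Theta k l A i j m) x y + ent (Theta k l A' i j m) x y).
  by rewrite /ent mxE.
by rewrite !ent_Theta -!mulrDr.
Qed.

Lemma Theta0 k l (A : kernel) :
  (forall m u v, (size u.2 + k = m)%N -> (size v.2 + l = m)%N -> A m u v = 0) ->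
  Theta k l A = 0.
Proof.
move=> h; rewrite (Theta_ext (A' := fun _ _ _ => 0)) //.
apply: mx_ent_ext => i j m x y; rewrite ent_Theta !mulr0 mxE.
by rewrite /ent (_ : (0 : X) m = 0) // mxE.
Qed.

Lemma Theta_sum k l I (s : seq I) (A : I -> kernel) :
  \sum_(i <- s) Theta k l (A i) = Theta k l (fun m u v => \sum_(i <- s) A i m u v).
Proof.
elim: s => [|i s IH].
  by rewrite big_nil Theta0 // => m u v _ _; rewrite big_nil.
rewrite big_cons IH ThetaD; apply: Theta_ext => m u v _ _; by rewrite big_cons.
Qed.

(** For m < l the space E_m has no summand of level l; without the case distinction the truncated
    difference m - l would contribute an empty word. *)
Definition kermul l (A A' : kernel) : kernel := fun m u v =>
  if (l <= m)%N then \sum_c \sum_(w : (m - l).-tuple 'I_b) A m u (c, val w) * A' m (c, val w) v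
  else 0.

(** Rank-one operators between unit vectors compose to such operators: the middle sum over a basis
    of H_l has d_l equal terms, which cancels the two factors [isqd l]. *)
Lemma Theta_mul k l n A A' : Theta k l A *m Theta l n A' = Theta k n (kermul l A A').
Proof.
apply: mx_ent_ext => i j m x y; rewrite mx_ent_mul ent_Theta.
pose g (z : EB m) := A m (mult x) (mult z) * A' m (mult z) (mult y).
have step p z : ent (Theta k l A i p m) x z * ent (Theta l n A' p j m) z y =
   ((hpart x == Tg k i) && (hpart y == Tg n j))%:R * (isqd k * isqd n)%:C *
   ((hpart z == Tg l p)%:R * ((isqd l * isqd l)%:C * g z)).
  rewrite !ent_Theta /g.
  case: (hpart x == _); last by rewrite !mul0r.
  case: (hpart y == _); last by rewrite !andbF !mul0r mulr0.
  case: (hpart z == _); last by rewrite !mul0r mulr0.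
  rewrite /= !mul1r !realcM; exact: mul_swap4.
under eq_bigr => p _ do (under eq_bigr => z _ do rewrite step; rewrite -mulr_sumr).
rewrite -mulr_sumr -mulrA; congr (_ * (_ * _)).
rewrite exchange_big /= /kermul.
transitivity (\sum_(z : EB m | level_of z == l) (isqd l * isqd l)%:C * g z).
  rewrite [RHS]big_mkcond; apply: eq_bigr => z _.
  case: eqP => [lz|lz].
    rewrite -mulr_suml; suff -> : \sum_p ((hpart z == Tg l p)%:R : C) = 1 by rewrite mul1r.
    have [p hp] := level_hpart lz.
    rewrite (bigD1 p) //= hp eqxx big1 ?addr0 // => p' p'p.
    by rewrite eq_Tagged /= eq_sym (negbTE p'p).
  rewrite big1 // => p _; case: eqP => [hz|]; last by rewrite mul0r.
  by case: lz; rewrite -hpart_level hz.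
have [lm|ml] := leqP l m; last by rewrite sum_level_out.
rewrite (sum_level lm); apply: eq_bigr => c _; rewrite exchange_big; apply: eq_bigr => w _.
transitivity (\sum_(p < d l) (isqd l * isqd l)%:C * (A m (mult x) (c, val w) * A' m (c, val w) (mult y))).
  by apply: eq_bigr => p _; rewrite /g mult_bvec.
rewrite sumr_const card_ord -mulr_natl mulrA.
by rewrite [X in X * _]mulrC isqd_sqrC mul1r.
Qed.

Definition kid : kernel := fun _ u v => (u == v)%:R.
Definition invproj k : 'M[X]_(d k) := Theta k k kid.

Lemma fiber_one m (x : EB m) k i i' : hpart x = Tg k i ->
  \sum_(z : EB m) ((mult z == mult x) && (hpart z == Tg k i'))%:R = 1 :> C.
Proof.
move=> hx; rewrite (eq_bigr (fun z => if mult z == mult x then (hpart z == Tg k i')%:R else 0)) => [|z _]; last by case: (mult z == _).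
rewrite -big_mkcond (@sum_fiber _ _ _ m k _ _ (fun h => (h == Tg k i')%:R)); last exact: hpart_word hx.
rewrite (bigD1 i') //= eqxx big1 ?addr0 // => p pi.
by rewrite eq_Tagged /= (negbTE pi).
Qed.

(** The invariant vectors are supported on basis pairs with equal coordinates. Hence only the
    entries of a with hpart x = i and hpart y = j are seen, and M is compressed to the sum of its
    entries. *)
Lemma invproj_sandwich k l (a : 'M[X]_(d k, d l)) (t : kernel) (M : 'M[C]_(d k, d l)) :
  (forall i j m x y, hpart x = Tg k i -> hpart y = Tg l j ->
     ent (a i j m) x y = t m (mult x) (mult y) * M i j) ->
  invproj k *m a *m invproj l =
  scal ((isqd k * isqd l)%:C * \sum_i \sum_j M i j)%:M *m Theta k l t.
Proof.
move=> h; apply: mx_ent_ext => i j m x y; rewrite scal_diagE mx_ent_mul.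
rewrite ent_scale.
rewrite ent_Theta.
pose P := (hpart x == Tg k i) && (hpart y == Tg l j).
pose z := (isqd k * isqd k)%:C * (isqd l * isqd l)%:C * t m (mult x) (mult y).
transitivity (P%:R * z * \sum_j' \sum_i' \sum_(y' : EB m) \sum_(x' : EB m)
   ((mult x' == mult x) && (hpart x' == Tg k i'))%:R *
   ((mult y' == mult y) && (hpart y' == Tg l j'))%:R * M i' j').
  rewrite mulr_sumr; apply: eq_bigr => j' _.
  transitivity (\sum_(y' : EB m) \sum_i' \sum_(x' : EB m) ent (invproj k i i' m) x x' *
      ent (a i' j' m) x' y' * ent (invproj l j' j m) y' y).
    apply: eq_bigr => y' _; rewrite mx_ent_mul mulr_suml; apply: eq_bigr => i' _.
    by rewrite mulr_suml.
  rewrite exchange_big mulr_sumr; apply: eq_bigr => i' _.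
  rewrite mulr_sumr; apply: eq_bigr => y' _; rewrite mulr_sumr; apply: eq_bigr => x' _.
  rewrite !ent_Theta /P /kid (eq_sym (mult x)).
  case: (hpart x == _); last by rewrite !mul0r.
  case: (hpart y == _); last by rewrite !andbF !(mul0r, mulr0).
  case: (mult x' =P _) => [ex|_]; last by rewrite !(mul0r, mulr0).
  case: (mult y' =P _) => [ey|_]; last by rewrite !(mul0r, mulr0).
  case: eqP => [hx'|_]; last by rewrite /= !(mul0r, mulr0).
  case: eqP => [hy'|_]; last by rewrite /= !(mul0r, mulr0).
  rewrite (h _ _ _ _ _ hx' hy') ex ey /z !(mul1r, mulr1).
  exact: mul_swap6.
rewrite /P; case: (hpart x =P _) => [hx|]; last by rewrite /= !mul0r mulr0.
case: (hpart y =P _) => [hy|]; last by rewrite /= !mul0r mulr0.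
transitivity (z * \sum_j' \sum_i' M i' j').
  rewrite /= mul1r; congr (_ * _); apply: eq_bigr => j' _; apply: eq_bigr => i' _.
  rewrite exchange_big /=.
  under eq_bigr => x' _ do rewrite -mulr_suml -mulr_sumr.
  by rewrite -!mulr_suml (fiber_one _ hx) (fiber_one _ hy) !mul1r.
rewrite exchange_big /= /z mul1r; set s := \sum_i _; rewrite !realcM; exact: mul_swap5.
Qed.

End Theta.

(** * The representation sigma and its invariant projections *)

Section Generators.
Context {R : realType} {G : groupType} {d : nat -> nat} {b : nat} (d_pos : forall k, (0 < d k)%N).
Local Notation C := (R[i]).
Local Notation X := (mxseq R (Edim d b)).
Local Notation EB m := (@Ebasis d b m).
Local Notation Tg k p := (Tagged (fun n : nat => 'I_(d n)) (i := k) p).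
Local Notation U := (bool * seq 'I_b)%type.
Context (pi : forall k, G -> 'M[C]_(d k)) (J : forall k, 'M[C]_(d k.+1, d k)).
Context (piU : forall k, mx_unitary_rep (pi k)).
Local Notation isq := (@isqd R d).
Local Notation sig := (seq_sigma pi b).
Local Notation conjmx := (map_mx (@Num.conj C)).

Lemma hcoef_in s (M : forall k, 'M[C]_(d (s k), d k)) k (i : 'I_(d (s k))) (j : 'I_(d k)) :
  hcoef M (Tg (s k) i) (Tg k j) = M k i j.
Proof.
rewrite /hcoef /= (big_pred1 i) // => p.
by rewrite eq_Tagged /= eq_sym.
Qed.

Lemma hcoef_out s (M : forall k, 'M[C]_(d (s k), d k)) x y : tag x != s (tag y) ->
  hcoef M x y = 0.
Proof. by move=> h; rewrite /hcoef big_pred0 // => p; apply: contraNF h => /eqP ->. Qed.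

Definition hcoord m (x : EB m) : 'I_(d (level_of x)) := (tagged x.2).1.

Lemma hpartE m (x : EB m) : hpart x = Tg (level_of x) (hcoord x). Proof. by []. Qed.

Definition setp m (x : EB m) (p : 'I_(d (level_of x))) : EB m :=
  (x.1, Tagged (fun k : 'I_m.+1 => ('I_(d k) * (m - k).-tuple 'I_b)%type) (p, (tagged x.2).2)).

Lemma setp_hcoord m (x : EB m) : setp (hcoord x) = x.
Proof. by case: x => c [k [p w]]. Qed.

Lemma mult_level m (x y : EB m) : mult x = mult y -> level_of x = level_of y.
Proof.
move=> [_ e]; apply: (@addnI (size (word_of x))).
by rewrite word_level e word_level.
Qed.

Lemma sum_mult m (x : EB m) (F : EB m -> C) :
  \sum_(z | mult z == mult x) F z = \sum_p F (setp (x := x) p).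
Proof.
have uniq (z0 : EB m) : mult z0 = mult x ->
    \sum_(z | (mult z == mult x) && (hpart z == hpart z0)) F z = F z0.
  move=> ez; rewrite (big_pred1 z0) // => z /=.
  apply/andP/eqP => [[/eqP e1 /eqP e2]|->]; last by rewrite ez !eqxx.
  by apply: Ebasis_ext => //; rewrite e1 ez.
pose f h := \sum_(z | (mult z == mult x) && (hpart z == h)) F z.
rewrite (eq_bigr (fun z : EB m => f (hpart z))) => [|z /eqP ez]; last by rewrite /f uniq.
rewrite (sum_fiber (copy_of x) f (word_level x)); apply: eq_bigr => p _.
exact: (@uniq (setp p)).
Qed.

Lemma ent_sigma g m (x y : EB m) : ent (sig g m) x y = (mult x == mult y)%:R *
  hcoef (s := id) (fun k => conjmx (pi k g)) (hpart x) (hpart y).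
Proof. by rewrite ent_Eop. Qed.

Lemma sigma_row g m (x : EB m) (F : EB m -> C) :
  \sum_z ent (sig g m) x z * F z =
  \sum_p (pi (level_of x) g (hcoord x) p)^* * F (setp p).
Proof.
transitivity (\sum_(z | mult z == mult x)
    hcoef (s := id) (fun k => conjmx (pi k g)) (hpart x) (hpart z) * F z).
  rewrite [RHS]big_mkcond; apply: eq_bigr => z _; rewrite ent_sigma eq_sym.
  by case: (_ == _); rewrite ?mul1r ?mul0r.
rewrite sum_mult; apply: eq_bigr => p _.
by rewrite hpartE (hcoef_in (s := id)) mxE.
Qed.

Lemma sigma_col g m (x y : EB m) (p : 'I_(d (level_of x))) :
  ent (sig g m) (setp p) y =
  (mult x == mult y)%:R * \sum_(q | hpart y == Tg (level_of x) q) (pi (level_of x) g p q)^*.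
Proof.
rewrite ent_sigma; congr (_ * _).
rewrite (_ : hpart (setp p) = Tg (level_of x) p) //.
case: (eqVneq (level_of y) (level_of x)) => [/level_hpart [q ->]|l].
  rewrite (hcoef_in (s := id)) mxE (big_pred1 q) // => q'.
  by rewrite eq_Tagged /= eq_sym.
rewrite hcoef_out; last by rewrite /= eq_sym.
rewrite big_pred0 // => q; apply: contraNF l => /eqP e.
by rewrite -hpart_level e.
Qed.

Lemma sigma_id : sig 1%g = 1.
Proof.
apply: ms_ent_ext => m x y; rewrite (_ : (1 : X) m = 1%:M) // ent1.
rewrite -{1}(setp_hcoord x) sigma_col; have [-> _ _] := piU (level_of x).
have [->|xy] := eqVneq x y.
  rewrite eqxx mul1r (big_pred1 (hcoord y)) => [|q]; last by rewrite hpartE eq_Tagged /= eq_sym.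
  by rewrite mxE eqxx rmorph1.
case: eqP => [e|]; last by rewrite mul0r.
rewrite mul1r big1 // => q /eqP hy; rewrite mxE; case: eqP => [eq|_]; last by rewrite rmorph0.
by case/eqP: xy; apply: Ebasis_ext => //; rewrite hy -eq.
Qed.

Lemma sigma_mul g h : sig (g * h)%g = sig g * sig h.
Proof.
apply: ms_ent_ext => m x y; rewrite (_ : (sig g * sig h) m = sig g m *m sig h m) // ent_mul.
rewrite sigma_row -{1}(setp_hcoord x) sigma_col.
under [RHS]eq_bigr => p _ do rewrite sigma_col mulrCA.
rewrite -mulr_sumr; congr (_ * _).
have [_ -> _] := piU (level_of x).
under [RHS]eq_bigr => p _ do rewrite mulr_sumr.
rewrite exchange_big; apply: eq_bigr => q _.
rewrite mxE rmorph_sum; apply: eq_bigr => p _; exact: rmorphM.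
Qed.

Lemma rep_inv k g : pi k (g^-1)%g = (pi k g)^t*.
Proof.
have U1 := unitary_rep_invl g (piU k); have [p1 pM _] := piU k.
by rewrite -[RHS]mulmx1 -p1 -(mulgV g) pM mulmxA U1 mul1mx.
Qed.

Lemma sigma_adj g : ms_adj (sig g) = sig (g^-1)%g.
Proof.
apply: ms_ent_ext => m x y; rewrite ent_adj !ent_sigma (eq_sym (mult y)).
case: eqP => [e|]; last by rewrite !mul0r conjC0.
rewrite !mul1r; have [q ->] := level_hpart (esym (mult_level e)).
by rewrite hpartE !(hcoef_in (s := id)) !mxE rep_inv !mxE conjCK.
Qed.

Lemma sigma_unitary g : sig g * ms_adj (sig g) = 1.
Proof. by rewrite sigma_adj -sigma_mul mulgV sigma_id. Qed.

(** Invariance of the sum of all conj(e_i) (x) e_i under conj(pi_k) (x) pi_k is the identity pi_k(g)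
    pi_k(g)^* = 1, read entrywise. *)
Lemma twist_invproj k g : twist sig (pi k) g *m invproj k = invproj k.
Proof.
apply: mx_ent_ext => i j m x y; rewrite mx_ent_mul.
transitivity (\sum_p pi k g i p * \sum_z ent (sig g m) x z * ent (invproj k p j m) z y).
  apply: eq_bigr => p _; rewrite mulr_sumr; apply: eq_bigr => z _.
  by rewrite twistE ent_scale mulrA.
under eq_bigr => p _ do rewrite sigma_row.
have [lx|lx] := eqVneq (level_of x) k; last first.
  rewrite !ent_Theta (_ : hpart x == Tg k i = false) ?mul0r; last first.
    by apply: contraNF lx => /eqP h; rewrite -hpart_level h.
  rewrite big1 // => p _; rewrite big1 ?mulr0 // => q _; rewrite ent_Theta.
  rewrite (_ : hpart (setp q) == Tg k p = false) ?mul0r ?mulr0 //.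
  by apply: contraNF lx => /eqP h; rewrite -[level_of x]/(tag (hpart (setp q))) h.
case: k / lx i j => i j.
pose W := (hpart y == Tg (level_of x) j)%:R *
   ((isq (level_of x) * isq (level_of x))%:C * (mult x == mult y)%:R) : C.
transitivity (\sum_p pi (level_of x) g i p * ((pi (level_of x) g (hcoord x) p)^* * W)).
  apply: eq_bigr => p _; congr (_ * _); rewrite (bigD1 p) //= big1 ?addr0 => [|q qp].
    by rewrite ent_Theta (_ : hpart (setp p) == _) //; apply/eqP.
  rewrite ent_Theta (_ : hpart (setp q) == _ = false) ?mul0r ?mulr0 //.
  by rewrite (_ : hpart (setp q) = Tg (level_of x) q) // eq_Tagged /= (negbTE qp).
under eq_bigr => p _ do rewrite mulrA; rewrite -mulr_suml ent_Theta.
have /matrixP /(_ i (hcoord x)) : pi (level_of x) g *m (pi (level_of x) g)^t* = 1%:M.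
  by apply/unitarymxP; case: (piU (level_of x)).
rewrite !mxE => e; have -> : \sum_p pi (level_of x) g i p * (pi (level_of x) g (hcoord x) p)^* = (i == hcoord x)%:R.
  by rewrite -e; apply: eq_bigr => p _; rewrite !mxE.
rewrite /W hpartE eq_Tagged /= eq_sym; case: (_ == i); rewrite ?mul0r ?mul1r //.
Qed.

Context (piI : forall k, mx_irreducible_rep (pi k)).
Context (pi_ineq : forall k l, k != l -> ~ mx_unitary_equiv (pi k) (pi l)).

(** The part of a fixed vector over one multiplicity index of level l is a matrix W intertwining
    pi_l with pi_k. By Schur it is 0 for l different from k, and for l = k it is a scalar, that is,
    a multiple of the invariant vector. *)
Lemma invproj_fixed k m (u : 'cV[C]_(\sum_(i < d k) Edim d b m)) :
  fixedvec sig (pi k) u -> lev m (invproj k) *m u = u.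
Proof.
move=> uinv; pose v i (x : EB m) := submxcol u i (enum_rank x) 0.
have blockE (a : 'M[X]_(d k)) i (x : EB m) :
    submxcol (lev m a *m u) i (enum_rank x) 0 = \sum_j \sum_z ent (a i j m) x z * v j z.
  rewrite -[X in submxcol (_ *m X)](submxcolK u) mul_mxblock_mxrow mxcolK summxE.
  by apply: eq_bigr => j _; rewrite mxE sum_Edim.
have vE g i (x : EB m) : v i x = \sum_j \sum_p
    pi k g i j * (pi (level_of x) g (hcoord x) p)^* * v j (setp p).
  rewrite {1}/v -(uinv g) blockE; apply: eq_bigr => j _.
  transitivity (pi k g i j * \sum_z ent (sig g m) x z * v j z).
    by rewrite mulr_sumr; apply: eq_bigr => z _; rewrite twistE ent_scale mulrA.
  by rewrite sigma_row mulr_sumr; apply: eq_bigr => p _; rewrite mulrA.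
suff vq i (x : EB m) : \sum_j \sum_z ent (invproj k i j m) x z * v j z = v i x.
  rewrite -[RHS]submxcolK -[LHS]submxcolK; apply: eq_mxcol => i.
  apply/matrixP => t j; rewrite ord1 -(enum_valK t).
  by rewrite blockE vq.
pose W : 'M[C]_(d k, d (level_of x)) := \matrix_(j, p) v j (setp (x := x) p).
have Wv : W i (hcoord x) = v i x by rewrite mxE setp_hcoord.
have Wc g : W *m pi (level_of x) g = pi k g *m W.
  have e : W = pi k g *m W *m (pi (level_of x) g)^t*.
    apply/matrixP => j p; rewrite !mxE (vE g).
    rewrite exchange_big; apply: eq_bigr => q _; rewrite !mxE mulr_suml; apply: eq_bigr => l _.
    by rewrite !mxE -mulrA [RHS]mulrAC -mulrA.
  by rewrite {1}e -mulmxA unitary_rep_invl ?mulmx1.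
transitivity (\sum_j \sum_p (hpart x == Tg k i)%:R * (isq k * isq k)%:C *
    ((Tg (level_of x) p == Tg k j)%:R * W j p)).
  apply: eq_bigr => j _.
  transitivity (\sum_(z : EB m | mult z == mult x) (hpart x == Tg k i)%:R * (isq k * isq k)%:C *
      ((hpart z == Tg k j)%:R * v j z)).
    rewrite [RHS]big_mkcond; apply: eq_bigr => z _; rewrite ent_Theta /kid (eq_sym (mult x)).
    case: (mult z == _); last by rewrite !mulr0 mul0r.
    by case: (hpart x == _); case: (hpart z == _); rewrite ?(mul0r, mulr0, mul1r, mulr1).
  by rewrite sum_mult; apply: eq_bigr => p _; rewrite mxE.
rewrite -Wv; clear vE Wv; clearbody W; clear blockE v uinv u; have [lx|lx] := eqVneq (level_of x) k; last first.
  have W0 : W = 0.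
    apply: (schur_inequivalent (piU _) (piI _) (piU _) (piI _) _ Wc).
      exact: pi_ineq.
  rewrite W0 mxE big1 // => j _; rewrite big1 // => p _; by rewrite mxE !mulr0.
case: k / lx i W Wc => i W Wc.
have [c ->] := schur_scalar (piI (level_of x)) Wc.
rewrite hpartE eq_Tagged /= [RHS]mxE eq_sym.
case: (i =P hcoord x) => [_|_]; last by rewrite mulr0n; apply: big1 => j _; apply: big1 => p _; rewrite !mul0r.
rewrite mulr1n mul1r; transitivity (\sum_(j < d (level_of x)) (isq (level_of x) * isq (level_of x))%:C * c).
  apply: eq_bigr => j _; rewrite (bigD1 j) //= eqxx big1 ?addr0 => [|p pj].
    by rewrite mul1r mxE eqxx mulr1n.
  by rewrite eq_Tagged /= (negbTE pj) mul0r mulr0.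
by rewrite sumr_const card_ord -mulr_natl mulrA [X in X * _]mulrC isqd_sqrC ?mul1r.
Qed.

End Generators.

(** * Relations between the compressed generators *)

Section Relations.
Context {R : realType} {d : nat -> nat} {b : nat} (d_pos : forall k, (0 < d k)%N).
Local Notation C := (R[i]).
Local Notation X := (mxseq R (Edim d b)).
Local Notation EB m := (@Ebasis d b m).
Local Notation Tg k p := (Tagged (fun n : nat => 'I_(d n)) (i := k) p).
Local Notation U := (bool * seq 'I_b)%type.
Local Notation kernel := (nat -> U -> U -> C).
Local Notation isq := (@isqd R d).
Local Notation Theta := (@Theta R d b).

Lemma kermul_single l (A A' : kernel) m u v c s : (size s + l = m)%N ->
  (forall c' (w : seq 'I_b), (c', w) != (c, s) -> A m u (c', w) * A' m (c', w) v = 0) ->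
  kermul l A A' m u v = A m u (c, s) * A' m (c, s) v.
Proof.
move=> e h; have lm : (l <= m)%N by rewrite -e leq_addl.
rewrite /kermul lm (bigD1 c) //= [X in _ + X]big1 ?addr0 => [|c' c'c]; last first.
  by rewrite big1 // => w _; apply: h; rewrite xpair_eqE (negbTE c'c).
rewrite (bigID (fun w => val w == s)) /= [X in _ + X]big1 ?addr0 => [|w ws]; last first.
  by apply: h; rewrite xpair_eqE (negbTE ws) andbF.
by rewrite (@sum_tuple_delta R b _ s (fun w => A m u (c, w) * A' m (c, w) v)) // -e addnK.
Qed.

Lemma kermul_zero l (A A' : kernel) m u v :
  (forall c (w : seq 'I_b), (size w + l = m)%N -> A m u (c, w) * A' m (c, w) v = 0) ->
  kermul l A A' m u v = 0.
Proof.
move=> h; rewrite /kermul; case: leqP => // lm.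
rewrite big1 // => c _; rewrite big1 // => w _; apply: h.
by rewrite size_tuple subnK.
Qed.

Definition ke (c : bool) : kernel := fun _ u v => ((u == v) && (u.1 == c))%:R.
Definition kF (c : bool) : kernel := fun _ u v => [&& u == v, u.1 == c & nilp u.2]%:R.
(** On words this deletes a leading letter i, and [kF] projects onto the empty word: annihilation
    operators and vacuum projection of a Fock space, one set for each copy. *)
Definition kT (c : bool) (i : 'I_b) : kernel := fun _ u v =>
  [&& u.1 == c, v.1 == c & v.2 == i :: u.2]%:R.
Definition ks : kernel := fun _ u v => [&& ~~ u.1, v.1, u.2 == v.2 & nilp v.2]%:R.

Definition qe k c : 'M[X]_(d k) := Theta k k (ke c).
Definition qF k c : 'M[X]_(d k) := Theta k k (kF c).
Definition tau k c i : 'M[X]_(d k.+1, d k) := Theta k.+1 k (kT c i).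
Definition qs k : 'M[X]_(d k) := Theta k k ks.

Lemma conjb (B : bool) : (B%:R : C)^* = B%:R.
Proof. by case: B; rewrite ?rmorph1 ?rmorph0. Qed.

Lemma natbM (B B' : bool) : (B%:R * B'%:R : C) = (B && B')%:R.
Proof. by case: B; rewrite ?mul1r ?mul0r. Qed.

Lemma qe_adj k c : adjX (qe k c) = qe k c.
Proof.
rewrite Theta_adj; apply: Theta_ext => m u v _ _; rewrite /ke conjb eq_sym.
by case: eqP => // ->.
Qed.

Lemma qF_adj k c : adjX (qF k c) = qF k c.
Proof.
rewrite Theta_adj; apply: Theta_ext => m u v _ _; rewrite /kF conjb eq_sym.
by case: eqP => // ->.
Qed.

Lemma qe_mul k c : qe k c *m qe k c = qe k c.
Proof.
rewrite Theta_mul //; apply: Theta_ext => m [cu u] v eu _.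
rewrite (@kermul_single _ _ _ _ _ _ cu u) //; last first.
  by move=> c' w h; rewrite /ke eq_sym (negbTE h) mul0r.
by rewrite /ke eqxx natbM /= andbCA andbb.
Qed.

Lemma qF_mul k c : qF k c *m qF k c = qF k c.
Proof.
rewrite Theta_mul //; apply: Theta_ext => m [cu u] v eu _.
rewrite (@kermul_single _ _ _ _ _ _ cu u) //; last first.
  by move=> c' w h; rewrite /kF eq_sym (negbTE h) mul0r.
by rewrite /kF eqxx natbM /= andbCA andbb.
Qed.

Lemma qe_tau k c i : qe k.+1 c *m tau k c i = tau k c i.
Proof.
rewrite Theta_mul //; apply: Theta_ext => m [cu u] v eu _.
rewrite (@kermul_single _ _ _ _ _ _ cu u) //; last first.
  by move=> c' w h; rewrite /ke eq_sym (negbTE h) mul0r.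
by rewrite /ke /kT eqxx natbM /= andbA andbb.
Qed.

Lemma tau_adj k c i : adjX (tau k c i) = Theta k k.+1 (fun m u v => kT c i m v u).
Proof. by rewrite Theta_adj; apply: Theta_ext => m u v _ _; rewrite /kT conjb. Qed.

Lemma tau_tau_adj k c i j :
  tau k c i *m adjX (tau k c j) = if i == j then qe k.+1 c else 0.
Proof.
rewrite tau_adj Theta_mul //.
have E m u v : (size u.2 + k.+1 = m)%N -> kermul k (kT c i) (fun m u v => kT c j m v u) m u v =
    ((i == j) && ((u == v) && (u.1 == c)))%:R :> C.
  move: u v => [cu u] [cv v] /= eu; rewrite (@kermul_single _ _ _ _ _ _ c (i :: u)) /= ?addSnnS //; last first.
    move=> c' w; rewrite xpair_eqE natbM /=.
    case: (cu == c) => //=; case: (c' == c) => //=.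
    by move=> /negbTE ->.
  rewrite natbM /= !eqxx /= andbT eqseq_cons xpair_eqE.
  case: (cu =P c) => [->|]; last by rewrite /= !andbF.
  by rewrite /= andbT (eq_sym c); case: (cv == c); case: (i == j) => //=; rewrite andbF.
case: ifP => ij.
  by apply: Theta_ext => m u v eu _; rewrite E // ij.
by apply: Theta0 => m u v eu _; rewrite E // ij.
Qed.

Lemma tau_adj_tau k c : \sum_i adjX (tau k c i) *m tau k c i + qF k c = qe k c.
Proof.
under eq_bigr => i _ do rewrite tau_adj Theta_mul //.
rewrite Theta_sum ThetaD; apply: Theta_ext => m [cu u] [cv v] /= eu ev.
case: u eu => [|i0 u] /= eu.
  rewrite big1 ?add0r => [|i _]; last first.
    by rewrite /kermul -eu add0n ltnn.
  by rewrite /kF /ke /= andbT.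
rewrite /kF /nilp /= !andbF addr0 (bigD1 i0) //= big1 ?addr0 => [|i ii0]; last first.
  apply: kermul_zero => c' w _; rewrite /kT /= eqseq_cons (eq_sym i0) (negbTE ii0) /= !andbF.
  by rewrite mul0r.
rewrite (@kermul_single _ _ _ _ _ _ c u); last first.
- move=> c' w; rewrite xpair_eqE /kT natbM /= eqseq_cons eqxx /=.
  case: (c' =P c) => //= _; rewrite eq_sym => /negbTE ->; by rewrite andbF.
- by rewrite addnS.
rewrite /kT /ke natbM /= !eqxx /= xpair_eqE (eq_sym v).
by case: c; case: cu; case: cv; case: (_ :: _ == v).
Qed.

Lemma qs_adj k : adjX (qs k) = Theta k k (fun m u v => ks m v u).
Proof. by rewrite Theta_adj; apply: Theta_ext => m u v _ _; rewrite /ks conjb. Qed.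

Lemma qs_adj_qs k : adjX (qs k) *m qs k = qF k true.
Proof.
rewrite qs_adj Theta_mul //; apply: Theta_ext => m [cu u] [cv v] /= eu ev.
rewrite (@kermul_single _ _ _ _ _ _ false u) //; last first.
  move=> c' w; rewrite xpair_eqE /ks natbM /=.
  by case: c' => //= /negbTE ->; rewrite andbF.
rewrite /ks /kF natbM /= eqxx /= xpair_eqE /nilp.
case: (u =P v) => [<-|]; last by rewrite /= !andbF.
by case: cu; case: cv; case: (size u == 0)%N.
Qed.

Lemma qs_qs_adj k : qs k *m adjX (qs k) = qF k false.
Proof.
rewrite qs_adj Theta_mul //; apply: Theta_ext => m [cu u] [cv v] /= eu ev.
rewrite (@kermul_single _ _ _ _ _ _ true u) //; last first.
  move=> c' w; rewrite xpair_eqE /ks natbM /=.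
  by case: c' => /= [|_]; rewrite ?andbF // eq_sym => /negbTE ->; rewrite andbF.
rewrite /ks /kF natbM /= eqxx /= xpair_eqE /nilp (eq_sym v).
by case: (u == v); case: cu; case: cv; case: (size u == 0)%N.
Qed.

(** The operator s and its adjoint have their ranges in top summands, where the word is empty and
    there is no letter to delete; the same reason gives [tau_qs]. *)
Lemma tau_qs_adj k i : tau k true i *m adjX (qs k) = 0.
Proof.
rewrite qs_adj Theta_mul //; apply: Theta0 => m [cu u] [cv v] /= eu ev.
apply: kermul_zero => c w _; rewrite /kT /ks natbM /=.
by case: (w =P i :: u) => [->|]; rewrite ?andbF.
Qed.

Lemma tau_qs k i : tau k false i *m qs k = 0.
Proof.
rewrite Theta_mul //; apply: Theta0 => m [cu u] [cv v] /= eu ev.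
apply: kermul_zero => c w _; rewrite /kT /ks natbM /=.
case: (w =P i :: u) => [->|]; rewrite ?andbF //=.
by case: v ev => [|j v] _; rewrite ?andbF.
Qed.

Lemma ent_scalar_mx k (a : X) (i j : 'I_k) m x y :
  ent ((a%:M : 'M[X]_k) i j m) x y = (i == j)%:R * ent (a m) x y.
Proof.
rewrite mxE; case: eqP; rewrite ?mulr1n ?mul1r // mulr0n mul0r => _.
by rewrite /ent (_ : (0 : X) m = 0) // mxE.
Qed.

Lemma isqd_trace k : (isq k * isq k)%:C * (\sum_i \sum_j (1%:M : 'M[C]_(d k)) i j) = 1.
Proof.
have -> : \sum_i \sum_j (1%:M : 'M[C]_(d k)) i j = (d k)%:R.
  rewrite -[X in _ = X%:R]card_ord -sum1_card natr_sum; apply: eq_bigr => i _.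
  rewrite (bigD1 i) //= mxE eqxx big1 ?addr0 // => j ji; by rewrite mxE eq_sym (negbTE ji).
exact: isqd_sqrC.
Qed.

Lemma eq_split m (x y : EB m) k i j : hpart x = Tg k i -> hpart y = Tg k j ->
  (x == y) = (mult x == mult y) && (i == j).
Proof.
move=> hx hy; apply/eqP/andP => [e|[/eqP e1 /eqP e2]].
  rewrite e eqxx; split => //; move: hx; rewrite e hy => /eqP.
  by rewrite eq_Tagged /= eq_sym.
by apply: Ebasis_ext => //; rewrite hx hy e2.
Qed.

Lemma top_level m (x : EB m) : (level_of x == m) = nilp (mult x).2.
Proof.
rewrite /nilp /=; have h := word_level x; apply/eqP/eqP => e.
  by apply: (@addIn (level_of x)); rewrite h add0n e.
by rewrite e add0n in h.
Qed.

Lemma invproj_e k c : invproj k *m (seq_e d b c)%:M *m invproj k = qe k c.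
Proof.
rewrite (invproj_sandwich (t := ke c) (M := 1%:M)) => [|i j m x y hx hy].
  by rewrite isqd_trace scal1 mul1mx.
rewrite ent_scalar_mx ent_Eop (eq_split hx hy) mxE /ke !natbM.
by case: (i == j); case: (mult x == _); rewrite ?andbF ?andbT.
Qed.

Lemma invproj_s k : invproj k *m (seq_s d b)%:M *m invproj k = qs k.
Proof.
rewrite (invproj_sandwich (t := ks) (M := 1%:M)) => [|i j m x y hx hy].
  by rewrite isqd_trace scal1 mul1mx.
rewrite ent_scalar_mx ent_Eop top_level mxE /ks !natbM.
have -> : (x.2 == y.2) = ((mult x).2 == (mult y).2) && (i == j).
  have := @eq_split m (true, x.2) (true, y.2) k i j hx hy.
  by rewrite !xpair_eqE !eqxx.
by case: (i == j); rewrite ?andbT // !andbF.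
Qed.

Context (J : forall k, 'M[C]_(d k.+1, d k)) (Jisom : forall k, (J k)^t* *m J k = 1%:M).

Lemma J_square k : \sum_i \sum_j (J k i j)^* * J k i j = (d k)%:R.
Proof.
rewrite exchange_big -[X in _ = X%:R]card_ord -sum1_card natr_sum; apply: eq_bigr => j _.
have /matrixP /(_ j j) := Jisom k; rewrite !mxE eqxx => <-.
by apply: eq_bigr => i _; rewrite !mxE.
Qed.

(** The inverse of the factor d_k / sqrt(d_k d_(k+1)) that the compression of T_i (x) J_k by
    invariant vectors produces. *)
Definition dratio k : R := Num.sqrt (d k.+1)%:R / Num.sqrt (d k)%:R.

(* [J] enters only through [\tr (J^* J) = d k], so it need not intertwine anything. *)
Lemma invproj_T k c i :
  scal (dratio k)%:C%:M *m
    (invproj k.+1 *m ((seq_T J c i)%:M *m scal (J k)) *m invproj k) = tau k c i.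
Proof.
rewrite (invproj_sandwich (t := kT c i) (M := \matrix_(p, q) ((J k p q)^* * J k p q))) => [|p q m x y hx hy].
  rewrite mulmxA -scalM -scalar_mxM.
  have -> : \sum_p \sum_q (\matrix_(p, q) ((J k p q)^* * J k p q)) p q = (d k)%:R :> C.
    by rewrite -J_square; apply: eq_bigr => p _; apply: eq_bigr => q _; rewrite mxE.
  rewrite (_ : _ * _ = 1) ?scal1 ?mul1mx //.
  have -> : (d k)%:R = ((d k)%:R)%:C :> C by rewrite rmorph_nat.
  rewrite -!realcM /dratio /isqd.
  have h l : Num.sqrt (d l)%:R != 0 :> R by rewrite gt_eqF // sqrtr_gt0 ltr0n.
  suff -> : Num.sqrt (d k.+1)%:R / Num.sqrt (d k)%:R *
    ((Num.sqrt (d k.+1)%:R)^-1 * (Num.sqrt (d k)%:R)^-1 * (d k)%:R) = 1 :> R by [].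
  rewrite -[X in _ * (_ * _ * X)](@sqr_sqrtr R (d k)%:R) ?ler0n //.
  by field; rewrite !h.
rewrite scalar_scalE ent_scale ent_Eop hx hy (hcoef_in (s := succn)) !mxE /kT.
by rewrite mulrCA [J k p q * _]mulrC.
Qed.

End Relations.

(** * The generated algebra and bounds for its generators *)

Section GeneratedSubalgebra.
Context {R : realType} {N : nat -> nat}.
Local Notation C := (R[i]).
Local Notation X := (mxseq R N).
Implicit Types a c : X.

Lemma opnormZC p q (z : C) (A : 'M[C]_(p, q)) : opnorm (z *: A) <= Normc.normc z * opnorm A.
Proof.
apply: opnorm_le => [|x].
  by rewrite mulr_ge0 ?opnorm_ge0 //; case: z => ? ?; exact: sqrtr_ge0.
rewrite -scalemxAl l2normZc -mulrA ler_wpM2l ?le_opnorm //; case: z => ? ?; exact: sqrtr_ge0.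
Qed.

Lemma bounded_subalg : unital_Cstar_subalg (@ms_bounded R N).
Proof.
split.
- by move=> a.
- by exists 1 => m; exact: opnorm1.
- move=> a c [K hK] [L hL]; exists (K + L) => m.
  by apply: le_trans (opnormD _ _) _; exact: lerD.
- move=> z a [K hK]; exists (Normc.normc z * K) => m.
  apply: le_trans (opnormZC _ _) _; apply: ler_wpM2l => //.
  by case: z => ? ?; exact: sqrtr_ge0.
- by move=> a c [K hK] [L hL]; exists (K * L) => m; exact: opnormM_le.
- by move=> a [K hK]; exists K => m; rewrite /ms_adj opnorm_adj.
- move=> a /(_ 1 ltr01) [c [K hK] h]; exists (1 + K) => m.
  rewrite -[a m](subrK (c m)); apply: le_trans (opnormD _ _) _; exact: lerD.
Qed.

(** The closure properties pass to the intersection of all subalgebras containing S; boundedness of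
    its elements requires that one such subalgebra exist, here that of all bounded sequences. *)
Lemma Cstar_gen_subalg (S : set X) : S `<=` @ms_bounded R N ->
  unital_Cstar_subalg (Cstar_gen S).
Proof.
move=> SB; split.
- by move=> a; exact: (smallest_sub bounded_subalg SB).
- by move=> A [HA _]; exact: (csub_one HA).
- by move=> a c ha hc A HA; apply: (csub_add HA.1); [exact: ha|exact: hc].
- by move=> z a ha A HA; apply: (csub_scale HA.1); exact: ha.
- by move=> a c ha hc A HA; apply: (csub_mul HA.1); [exact: ha|exact: hc].
- by move=> a ha A HA; apply: (csub_adj HA.1); exact: ha.
- move=> a h A HA; apply: (csub_closed HA.1) => eps /h [c hc hac].
  by exists c => //; exact: hc.
Qed.

Lemma c0_bounded a : ms_c0 a -> ms_bounded a.
Proof.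
move=> /cvgrPdist_lt /(_ 1 ltr01) [n _ hn].
exists (1 + \sum_(i < n) opnorm (a i)) => m.
have s0 (P : pred 'I_n) : 0 <= \sum_(i < n | P i) opnorm (a i).
  by apply: sumr_ge0 => i _; exact: opnorm_ge0.
have [mn|nm] := ltnP m n.
  rewrite (bigD1 (Ordinal mn)) //= addrCA lerDl addr_ge0 //; exact: s0.
have := hn m nm; rewrite /= sub0r normrN ger0_norm ?opnorm_ge0 // => /ltW h.
by apply: le_trans h _; rewrite lerDl; exact: (s0 xpredT).
Qed.

Lemma opnorm_proj p (P : 'M[C]_p) : P^t* = P -> P *m P = P -> opnorm P <= 1.
Proof.
move=> Ph PP; apply: opnorm_le => // x; rewrite mul1r.
have [y0|y0] := eqVneq (l2norm (P *m x)) 0; first by rewrite y0 l2norm_ge0.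
rewrite -(ler_pM2r (_ : 0 < l2norm (P *m x))) ?lt_neqAle ?l2norm_ge0 1?eq_sym ?y0 //.
rewrite -expr2 l2norm_sqr rdot_adjr Ph mulmxA PP [leRHS]mulrC.
by apply: le_trans (rdot_le _ _) _; rewrite mulrC.
Qed.

Lemma mxbnd_proj p (a : 'M[X]_p) : adjX a = a -> a *m a = a -> mxbnd a 1.
Proof. by move=> ah aa m; apply: opnorm_proj; rewrite -?lev_adj -?levM ?ah ?aa. Qed.

Lemma mxbnd_half p q (a : 'M[X]_(p, q)) : mxbnd (adjX a *m a) 1 -> mxbnd a 1.
Proof.
by move=> h m; apply: opnorm_sqr_le => //; rewrite expr1n -lev_adj -levM.
Qed.

End GeneratedSubalgebra.

Section GeneratorBounds.
Context {R : realType} {G : groupType} {d : nat -> nat} {b : nat}.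
Local Notation C := (R[i]).
Local Notation X := (mxseq R (Edim d b)).
Local Notation EB m := (@Ebasis d b m).
Local Notation Tg k p := (Tagged (fun n : nat => 'I_(d n)) (i := k) p).
Context (pi : forall k, G -> 'M[C]_(d k)) (J : forall k, 'M[C]_(d k.+1, d k)).
Context (piU : forall k, mx_unitary_rep (pi k)) (Jisom : forall k, (J k)^t* *m J k = 1%:M).

Lemma ent_ms_mul (a c : X) m x y :
  ent ((a * c) m) x y = \sum_z ent (a m) x z * ent (c m) z y.
Proof. exact: ent_mul. Qed.

Lemma ent_ms_adj (a : X) m x y : ent (ms_adj a m) x y = (ent (a m) y x)^*.
Proof. exact: ent_adj. Qed.

Definition diagseq (P : forall m, pred (EB m)) : X := fun m =>
  Eop (fun x y : EB m => ((x == y) && P m x)%:R).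

Lemma diagseq_adj P : ms_adj (diagseq P) = diagseq P.
Proof.
apply: ms_ent_ext => m x y; rewrite ent_adj !ent_Eop conjb eq_sym.
by case: eqP => // ->.
Qed.

Lemma diagseq_mul P Q : diagseq P * diagseq Q = diagseq (fun m x => P m x && Q m x).
Proof.
apply: ms_ent_ext => m x y; rewrite ent_ms_mul.
rewrite (bigD1 x) //= big1 ?addr0 => [|z zx]; last first.
  by rewrite ent_Eop eq_sym (negbTE zx) mul0r.
by rewrite !ent_Eop eqxx natbM /= andbCA.
Qed.

Lemma diagseq_add P Q : (forall m x, ~~ (P m x && Q m x)) ->
  diagseq P + diagseq Q = diagseq (fun m x => P m x || Q m x).
Proof.
move=> h; apply: ms_ent_ext => m x y.
transitivity (ent (diagseq P m) x y + ent (diagseq Q m) x y); first by rewrite /ent mxE.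
rewrite !ent_Eop; have := h m x; case: (x == y) => /=; last by rewrite addr0.
by case: (P m x); case: (Q m x) => //=; rewrite ?addr0 ?add0r.
Qed.

Lemma diagseq_ext P Q : (forall m, P m =1 Q m) -> diagseq P = diagseq Q.
Proof. by move=> h; apply: ms_ent_ext => m x y; rewrite !ent_Eop h. Qed.

Lemma diagseq_opnorm P m : opnorm (diagseq P m) <= 1.
Proof.
apply: opnorm_proj; first exact: (congr1 (fun a : X => a m) (diagseq_adj P)).
have -> : diagseq P m *m diagseq P m = (diagseq P * diagseq P) m by [].
by rewrite diagseq_mul; congr (_ m); apply: diagseq_ext => m' x; rewrite andbb.
Qed.

Lemma seq_eE c : seq_e d b c = diagseq (fun m x => copy_of x == c).
Proof. by []. Qed.

Lemma seq_FE c : seq_F d b c = diagseq (fun m x => (copy_of x == c) && (level_of x == m)).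
Proof. by []. Qed.

(** The relation J_k^* J_k = 1 collapses the sum over the coordinate in H_(k+1) to a Kronecker
    delta, leaving only the condition on the first letter. *)
Lemma seq_T_adj_T c i : ms_adj (seq_T J c i) * seq_T J c i =
  diagseq (fun m x => (copy_of x == c) && (ohead (word_of x) == Some i)).
Proof.
apply: ms_ent_ext => m x y.
rewrite ent_ms_mul [RHS]ent_Eop.
pose cond (x z : EB m) := [&& copy_of z == c, copy_of x == c & word_of x == i :: word_of z].
pose hc (x z : EB m) : C := hcoef (s := succn) (fun k => map_mx Num.conj (J k)) (hpart z) (hpart x).
have E z : ent (ms_adj (seq_T J c i) m) x z * ent (seq_T J c i m) z y =
    (cond x z && cond y z)%:R * ((hc x z)^* * hc y z).
  rewrite ent_ms_adj !ent_Eop -/(cond x z) -/(cond y z) -/(hc x z) -/(hc y z).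
  case: (cond x z); last by rewrite !mul0r conjC0 mul0r.
  by case: (cond y z); rewrite ?mul1r // mul0r mulr0 mul0r.
under eq_bigr => z _ do rewrite E.
have zero : ~ [/\ copy_of x == c, ohead (word_of x) == Some i & mult y = mult x] ->
    \sum_z (cond x z && cond y z)%:R * ((hc x z)^* * hc y z) = 0.
  move=> h; rewrite big1 // => z _; rewrite [_ && _](_ : _ = false) ?mul0r //.
  apply/negP => /andP[/and3P[_ /eqP cx /eqP wx] /and3P[_ /eqP cy /eqP wy]]; apply: h.
  by split; rewrite ?cx ?wx ?eqxx //= /mult cx cy wx wy.
have [e|ne] := eqVneq (mult y) (mult x); last first.
  rewrite zero => [|[_ _ /eqP e]]; last by rewrite e in ne.
  rewrite (_ : (x == y) = false) //; apply: contraNF ne => /eqP ->; exact: eqxx.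
have [cx|ncx] := boolP (copy_of x == c); last first.
  by rewrite andbF zero // => -[h]; rewrite h in ncx.
have [ow|now] := boolP (ohead (word_of x) == Some i); last first.
  by rewrite !andbF zero // => -[_ h]; rewrite h in now.
rewrite !andbT; clear zero.
have [s ws] : exists s, word_of x = i :: s.
  by case: (word_of x) ow => [|i' s] //= /eqP [->]; exists s.
have [ey1 ey2] : copy_of y = copy_of x /\ word_of y = word_of x by case: e.
have sz : (size s + (level_of x).+1 = m)%N.
  by have := word_level x; rewrite ws addSnnS.
have [q hy] := level_hpart (mult_level e).
transitivity (\sum_(z : EB m | mult z == (c, s))
   (hcoef (s := succn) (fun k => map_mx Num.conj (J k)) (hpart z) (hpart x))^* *
    hcoef (s := succn) (fun k => map_mx Num.conj (J k)) (hpart z) (Tg (level_of x) q)).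
  rewrite [RHS]big_mkcond; apply: eq_bigr => z _.
  rewrite -hy -/(hc x z) -/(hc y z) /cond ey1 ey2 cx ws eqseq_cons eqxx /= xpair_eqE (eq_sym s).
  by case: (copy_of z == c); case: (word_of z == s); rewrite ?mul1r ?mul0r.
rewrite (sum_fiber c (fun h => (hcoef (s := succn) (fun k => map_mx Num.conj (J k)) h (hpart x))^* *
    hcoef (s := succn) (fun k => map_mx Num.conj (J k)) h (Tg (level_of x) q)) sz).
have /matrixP /(_ q (hcoord x)) := Jisom (level_of x); rewrite !mxE => Jqx.
transitivity ((q == hcoord x)%:R : C).
  rewrite -Jqx; apply: eq_bigr => p _; rewrite hpartE !(hcoef_in (s := succn)) !mxE conjCK.
  by rewrite mulrC.
rewrite (eq_split (hpartE x) hy) e eqxx /= eq_sym.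
by [].
Qed.

Lemma seq_s_adj_s : ms_adj (seq_s d b) * seq_s d b = seq_F d b true :> X.
Proof.
apply: ms_ent_ext => m x y.
rewrite ent_ms_mul [RHS]ent_Eop.
rewrite (bigD1 (false, x.2)) //= big1 ?addr0 => [|z zx]; last first.
  rewrite ent_ms_adj ent_Eop (_ : [&& _, _, _ & _] = false) ?conjC0 ?mul0r //.
  apply: contraNF zx; case: z => [[] z2] //= /and3P[_ /eqP h _].
  by rewrite -h.
rewrite ent_ms_adj !ent_Eop conjb natbM /= eqxx /=.
case: x y => [cx x] [cy y]; rewrite xpair_eqE /copy_of /level_of /=.
case: (x =P y) => [<-|]; last by rewrite /= !andbF.
by case: cx; case: cy; case: (_ == m).
Qed.

Lemma sigma_opnorm g m : opnorm (seq_sigma pi b g m) <= 1.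
Proof.
rewrite -opnorm_adj; apply: opnorm_isom; rewrite trmxCK.
exact: (sigma_level_unitary (sigma_unitary piU) m g).
Qed.

Lemma opnorm_half (a c : X) : ms_adj a * a = c -> (forall m, opnorm (c m) <= 1) ->
  forall m, opnorm (a m) <= 1.
Proof.
move=> e h m; apply: opnorm_sqr_le => //; rewrite expr1n.
by have -> : (a m)^t* *m a m = (ms_adj a * a) m by []; rewrite e.
Qed.

Lemma seq_T_opnorm c (i : 'I_b) m : opnorm (seq_T J c i m) <= 1.
Proof. by apply: (opnorm_half (seq_T_adj_T c i)) => m'; exact: diagseq_opnorm. Qed.

Lemma seq_s_opnorm m : opnorm (seq_s d b m : 'M[C]__) <= 1.
Proof. by apply: (opnorm_half seq_s_adj_s) => m'; rewrite seq_FE; exact: diagseq_opnorm. Qed.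

Lemma algA_subalg : unital_Cstar_subalg (algA pi J b).
Proof.
apply: Cstar_gen_subalg => a; rewrite /setU /=.
case=> [[[[[[->|ha]|[c _ <-]]|[c _ <-]]|[[c i] _ <-]]|[g _ <-]]|->].
- exact: (csub_one bounded_subalg).
- exact: c0_bounded.
- by exists 1 => m; rewrite seq_eE; exact: diagseq_opnorm.
- by exists 1 => m; rewrite seq_FE; exact: diagseq_opnorm.
- by exists 1 => m; exact: seq_T_opnorm.
- by exists 1 => m; exact: sigma_opnorm.
- by exists 1 => m; exact: seq_s_opnorm.
Qed.

Lemma algA_e c : algA pi J b (seq_e d b c).
Proof. by apply: sub_gen_smallest; do 4 left; right; exists c. Qed.

Lemma algA_F c : algA pi J b (seq_F d b c).
Proof. by apply: sub_gen_smallest; do 3 left; right; exists c. Qed.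

Lemma algA_T c i : algA pi J b (seq_T J c i).
Proof. by apply: sub_gen_smallest; do 2 left; right; exists (c, i). Qed.

Lemma algA_sigma g : algA pi J b (seq_sigma pi b g).
Proof. by apply: sub_gen_smallest; left; right; exists g. Qed.

Lemma algA_s : algA pi J b (seq_s d b).
Proof. by apply: sub_gen_smallest; right. Qed.

End GeneratorBounds.

(** * Approximately multiplicative relations *)

Section MultiplierInequalities.
Context {R : realType}.
Implicit Types z k e t : R.

Lemma sandwich_bound z : 2 * (2 * z + 2 * z) + z <= 9 * z.
Proof. lra. Qed.

Lemma nine_bounds z : 0 <= z -> z <= 2 * z /\ 2 * z + 0 <= 2 * z /\ 2 * 0 + z <= 2 * z.
Proof. by move=> z0; split; [|split]; lra. Qed.

Lemma hpow_bound z k t : 0 <= k -> 0 < z -> t <= z / 4 ->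
  k * (2 * (2 * (z / (8 * (k + 1))) + 0)) + 2 * t <= z.
Proof.
move=> k0 z0 ht; have k1 : 0 < k + 1 by lra.
have e : k * (2 * (2 * (z / (8 * (k + 1))) + 0)) = z / 2 * (k / (k + 1)).
  by field; rewrite gt_eqF.
have : k / (k + 1) <= 1 by rewrite ler_pdivrMr // mul1r; lra.
rewrite e => h; have : z / 2 * (k / (k + 1)) <= z / 2 * 1 by rewrite ler_wpM2l //; lra.
by move=> h'; lra.
Qed.

End MultiplierInequalities.

Section Multipliers.
Context {R : realType} {G : groupType} {d : nat -> nat} {b : nat} (d_pos : forall k, (0 < d k)%N).
Local Notation C := (R[i]).
Local Notation X := (mxseq R (Edim d b)).
Context (pi : forall k, G -> 'M[C]_(d k)) (J : forall k, 'M[C]_(d k.+1, d k)).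
Context (piU : forall k, mx_unitary_rep (pi k)) (piI : forall k, mx_irreducible_rep (pi k)).
Context (pi_ineq : forall k l, k != l -> ~ mx_unitary_equiv (pi k) (pi l)).
Context (Jisom : forall k, (J k)^t* *m J k = 1%:M).
Context (S : seq G) (kappa : R) (S0 : (0 < size S)%N) (kappa0 : 0 <= kappa) (kappa1 : kappa < 1).
Context (gap : gap_bound S kappa).
Context (R0 : R) (R01 : 1 <= R0) (dR0 : forall k, (d k.+1)%:R <= R0 * (d k)%:R).
Local Notation B := (algA pi J b).
Local Notation IP k := (@invproj R d b k).
Local Notation TAU k c i := (@tau R d b k c i).
Local Notation QE k c := (@qe R d b k c).
Local Notation QF k c := (@qF R d b k c).
Local Notation QS k := (@qs R d b k).

Let HB : unital_Cstar_subalg B := algA_subalg piU Jisom.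

Lemma invproj_adj k : adjX (IP k) = IP k.
Proof. by rewrite Theta_adj; apply: Theta_ext => m u v _ _; rewrite /kid conjb eq_sym. Qed.

Lemma invproj_mul k : IP k *m IP k = IP k.
Proof.
rewrite Theta_mul //; apply: Theta_ext => m [cu u] v eu _.
rewrite (@kermul_single _ _ _ _ _ _ _ _ cu u) //; last first.
  by move=> c' w h; rewrite /kid eq_sym (negbTE h) mul0r.
by rewrite /kid eqxx mul1r.
Qed.

Lemma inB_invproj k : inB B (IP k).
Proof.
apply: (inB_projection HB (@algA_sigma R G d b pi J) (sigma_id piU) (sigma_mul piU) (sigma_unitary piU)
  S0 kappa0 kappa1 gap (piU k) (invproj_adj k) (invproj_mul k)).
- by move=> g; exact: twist_invproj.
- by move=> m u; exact: (invproj_fixed d_pos piU piI pi_ineq).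
Qed.

Opaque invproj tau qe qF qs algA.

Lemma inB_qe k c : inB B (QE k c).
Proof.
rewrite -invproj_e //; have h := @inB_invproj k.
by apply: (inBM HB) => //; apply: (inBM HB) => //; apply: (inB_scalar HB); exact: algA_e.
Qed.

Lemma inB_qs k : inB B (QS k).
Proof.
rewrite -invproj_s //; have h := @inB_invproj k.
by apply: (inBM HB) => //; apply: (inBM HB) => //; apply: (inB_scalar HB); exact: algA_s.
Qed.

Lemma inB_TJ k c (i : 'I_b) : inB B ((seq_T J c i)%:M *m scal (J k)).
Proof.
apply: (inBM HB); last exact: (inB_scal HB).
by apply: (inB_scalar HB); exact: algA_T.
Qed.

Lemma inB_tau k c i : inB B (TAU k c i).
Proof.
rewrite -(invproj_T _ Jisom) //; apply: (inBM HB); first exact: (inB_scal HB).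
apply: (inBM HB); last exact: inB_invproj.
apply: (inBM HB); [exact: inB_invproj|exact: inB_TJ].
Qed.

Lemma qe_bnd k c : mxbnd (QE k c) 1.
Proof. by apply: mxbnd_proj; [exact: qe_adj|exact: qe_mul]. Qed.

Lemma qF_bnd k c : mxbnd (QF k c) 1.
Proof. by apply: mxbnd_proj; [exact: qF_adj|exact: qF_mul]. Qed.

Lemma tau_bnd k c i : mxbnd (TAU k c i) 1.
Proof.
rewrite -[TAU k c i]adjXK; apply: mxbnd_adj; apply: mxbnd_half.
by rewrite adjXK tau_tau_adj // eqxx; exact: qe_bnd.
Qed.

Lemma qs_bnd k : mxbnd (QS k) 1.
Proof. by apply: mxbnd_half; rewrite qs_adj_qs //; exact: qF_bnd. Qed.

Lemma dratio_ge0 k : 0 <= dratio (R := R) (d := d) k.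
Proof. by rewrite divr_ge0 ?sqrtr_ge0. Qed.

Lemma dratio_le k : dratio (R := R) (d := d) k <= R0.
Proof.
have s0 : 0 < Num.sqrt (d k)%:R :> R by rewrite sqrtr_gt0 ltr0n.
have R00 : 0 <= R0 by exact: le_trans R01.
rewrite /dratio ler_pdivrMr // -(@ler_pXn2r _ 2) ?nnegrE ?mulr_ge0 ?sqrtr_ge0 //.
rewrite exprMn !sqr_sqrtr ?ler0n //; apply: le_trans (dR0 k) _.
by rewrite ler_wpM2r ?ler0n // expr2 ler_peMr.
Qed.

Lemma adjX_scalc p q (c : R) (a : 'M[X]_(p, q)) :
  adjX (scal c%:C%:M *m a) = scal c%:C%:M *m adjX a.
Proof.
by apply/matrixP => i j; rewrite scal_diagE mxE scal_diagE mxE ms_adjZ conj_realC.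
Qed.

Lemma mxbnd_scalar p (a : X) : (forall m, opnorm (a m) <= 1) -> mxbnd (a%:M : 'M[X]_p) 1.
Proof.
move=> h m; apply: le_trans (h m); rewrite /lev /bmap.
apply: le_trans (opnorm_block_scalar p (a m)); rewrite le_eqVlt; apply/orP; left; apply/eqP.
congr opnorm; apply: eq_mxblock => i j; rewrite mxE.
by case: (i == j); rewrite ?mulr1n ?mulr0n.
Qed.

Section Fixed.
Context {D : nat} (psi : X -> 'M[C]_D) (Hpsi : ucp B psi) (zeta : R) (z0 : 0 <= zeta).
Local Notation lm := (lmul B psi).

(** All sizes n at once, since a enters as a (x) 1 in matrices of size d_k for every k. *)
Definition multiplier eta (a : X) := forall n, lm eta (a%:M : 'M[X]_n).

Context (me : forall c, multiplier zeta (seq_e d b c))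
  (mT : forall c i, multiplier zeta (seq_T J c i))
  (mTa : forall c i, multiplier zeta (ms_adj (seq_T J c i)))
  (ms : multiplier zeta (seq_s d b)) (msa : multiplier zeta (ms_adj (seq_s d b))).
Context (mq : forall k, lm zeta (IP k)).
Local Notation delta := (R0 * (9 * zeta)).

(** Two applications of [lmulM] give 2 (2 zeta + 2 zeta) + zeta. *)
Lemma sandwich_lmul k l (a : 'M[X]_(d k, d l)) : inB B a -> mxbnd a 1 -> lm (2 * zeta) a ->
  lm (9 * zeta) (IP k *m a *m IP l).
Proof.
move=> aB a1 la; have bq n : mxbnd (IP n) 1.
  by apply: mxbnd_proj; [exact: invproj_adj|exact: invproj_mul].
apply: (lmul_mono (eta := 2 * (2 * zeta + 2 * zeta) + zeta)).
  exact: sandwich_bound.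
apply: (lmulM HB Hpsi).
- by apply: (inBM HB); [exact: inB_invproj|].
- exact: inB_invproj.
- exact: mxbnd1M.
- exact: bq.
- by apply: (lmulM HB Hpsi); [exact: inB_invproj| | | |exact: mq|].
- exact: mq.
Qed.

Let d0 : 9 * zeta <= delta.
Proof. by rewrite ler_peMl // mulr_ge0. Qed.

Lemma lmul_qe k c : lm delta (QE k c).
Proof.
rewrite -invproj_e //; apply: lmul_mono d0 _; apply: sandwich_lmul.
- by apply: (inB_scalar HB); exact: algA_e.
- by apply: mxbnd_scalar => m; rewrite seq_eE; exact: diagseq_opnorm.
- by apply: (lmul_mono (eta := zeta)); [have [] := nine_bounds z0|exact: (me c)].
Qed.

Lemma lmul_qs k : lm delta (QS k).
Proof.
rewrite -invproj_s //; apply: lmul_mono d0 _; apply: sandwich_lmul.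
- by apply: (inB_scalar HB); exact: algA_s.
- by apply: mxbnd_scalar => m; exact: seq_s_opnorm.
- by apply: (lmul_mono (eta := zeta)); [have [] := nine_bounds z0|exact: ms].
Qed.

Lemma lmul_qs_adj k : lm delta (adjX (QS k)).
Proof.
rewrite -invproj_s // !adjXM adjX_scalar invproj_adj mulmxA.
apply: lmul_mono d0 _; apply: sandwich_lmul.
- by apply: (inB_scalar HB); apply: (csub_adj HB); exact: algA_s.
- by apply: mxbnd_scalar => m; rewrite /ms_adj opnorm_adj; exact: seq_s_opnorm.
- by apply: (lmul_mono (eta := zeta)); [have [] := nine_bounds z0|exact: msa].
Qed.

Lemma TJ_bnd k c (i : 'I_b) : mxbnd ((seq_T J c i)%:M *m scal (J k)) 1.
Proof.
apply: mxbnd1M; last exact: mxbnd_scal.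
by apply: mxbnd_scalar => m; exact: (seq_T_opnorm Jisom).
Qed.

Lemma lmul_scalc p q (c : R) (a : 'M[X]_(p, q)) eta : 0 <= c -> c <= R0 -> 0 <= eta ->
  inB B a -> lm eta a -> lm (R0 * eta) (scal c%:C%:M *m a).
Proof.
move=> c0 cR e0 aB la; apply: (lmul_scal_mul HB Hpsi) => //.
by rewrite blks_scalar; apply: le_trans (opnorm_scalar _ _) _; rewrite ger0_norm.
Qed.

Lemma lmul_tau k c i : lm delta (TAU k c i).
Proof.
rewrite -(invproj_T _ Jisom) //; apply: lmul_scalc.
- exact: dratio_ge0.
- exact: dratio_le.
- by rewrite mulr_ge0.
- apply: (inBM HB); last exact: inB_invproj.
  by apply: (inBM HB); [exact: inB_invproj|exact: inB_TJ].
apply: sandwich_lmul; [exact: inB_TJ|exact: TJ_bnd|].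
have [_ [h _]] := nine_bounds z0; apply: lmul_mono h _.
apply: (lmulM HB Hpsi).
- by apply: (inB_scalar HB); exact: algA_T.
- exact: (inB_scal HB).
- by apply: mxbnd_scalar => m; exact: (seq_T_opnorm Jisom).
- exact: mxbnd_scal.
- exact: mT.
- exact: (lmul_scal HB Hpsi).
Qed.

Lemma lmul_tau_adj k c i : lm delta (adjX (TAU k c i)).
Proof.
rewrite -(invproj_T _ Jisom) // adjX_scalc !adjXM adjX_scalar adjX_scal !invproj_adj (mulmxA (IP k)).
have aB : inB B (scal ((J k)^t*) *m (ms_adj (seq_T J c i))%:M).
  apply: (inBM HB); first exact: (inB_scal HB).
  by apply: (inB_scalar HB); apply: (csub_adj HB); exact: algA_T.
have T1 : mxbnd ((ms_adj (seq_T J c i))%:M : 'M[X]_(d k.+1)) 1.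
  by apply: mxbnd_scalar => m; rewrite /ms_adj opnorm_adj; exact: (seq_T_opnorm Jisom).
have J1 : mxbnd (scal ((J k)^t*) : 'M[X]_(_, _)) 1.
  by rewrite -adjX_scal; apply: mxbnd_adj; exact: mxbnd_scal.
apply: lmul_scalc.
- exact: dratio_ge0.
- exact: dratio_le.
- by rewrite mulr_ge0.
- apply: (inBM HB); last exact: inB_invproj.
  by apply: (inBM HB); [exact: inB_invproj|exact: aB].
apply: sandwich_lmul; [exact: aB|exact: mxbnd1M|].
have [_ [_ h]] := nine_bounds z0; apply: lmul_mono h _.
apply: (lmulM HB Hpsi).
- exact: (inB_scal HB).
- by apply: (inB_scalar HB); apply: (csub_adj HB); exact: algA_T.
- exact: J1.
- exact: T1.
- exact: (lmul_scal HB Hpsi).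
- exact: mTa.
Qed.

End Fixed.

Context {D : nat -> nat} {psi : forall j, X -> 'M[C]_(D j)} (Hpsi : forall j, ucp B (psi j)).
Context (psi_mul : forall x y, B x -> B y ->
  opnorm (psi j (x * y) - psi j x *m psi j y) @[j --> \oo] --> (0 : R)).

Lemma near_multiplier a eta : 0 < eta -> B a ->
  \forall j \near \oo, multiplier (psi j) eta a.
Proof.
move=> e0 aB; near=> j => n; apply: (lmul_scalar HB (Hpsi j)) => //; apply/ltW.
near: j; apply: (near_mul psi_mul) => //; first exact: (csub_adj HB).
by rewrite exprn_gt0.
Unshelve. all: by end_near. Qed.

Lemma near_all_mult (I : eqType) (s : seq I) (a : I -> X) eta : 0 < eta ->
  (forall i, B (a i)) ->
  \forall j \near \oo, forall i, i \in s -> multiplier (psi j) eta (a i).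
Proof. by move=> e0 aB; apply: near_all => i; exact: near_multiplier. Qed.

(** The power k is fixed first by kappa^k <= zeta / 4; then j has to be good only for the finitely
    many g in S, and this settles every level at once. *)
Lemma near_lmul_invproj zeta : 0 < zeta ->
  \forall j \near \oo, forall k, lmul B (psi j) zeta (IP k).
Proof.
move=> z0; have z4 : 0 < zeta / 4 by rewrite divr_gt0.
have [k hk] : exists k, kappa ^+ k <= zeta / 4.
  have := @cvg_geometric _ 1 kappa; rewrite ger0_norm // => /(_ kappa1).
  move=> /cvgrPdist_lt /(_ _ z4) [k _ /(_ k (leqnn k))].
  rewrite sub0r normrN /geometric /= mul1r ger0_norm ?exprn_ge0 // => /ltW hk.
  by exists k.
pose eta := zeta / (8 * (k%:R + 1)).
have e0 : 0 < eta by rewrite divr_gt0 // mulr_gt0 // ltr_wpDl.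
near=> j => l.
have hS : forall g, g \in S -> multiplier (psi j) eta (seq_sigma pi b g).
  by near: j; apply: near_all_mult => // g; exact: algA_sigma.
have h := lmul_projection HB (@algA_sigma R G d b pi J) (sigma_id piU) (sigma_mul piU)
  (sigma_unitary piU) S0 kappa0 kappa1 gap (Hpsi j) (piU l) (invproj_adj l) (invproj_mul l)
  (fun g => twist_invproj piU l g) (fun m u => invproj_fixed d_pos piU piI pi_ineq (u := u)).
apply: (lmul_mono (hpow_bound (ler0n R k) z0 hk)); apply: h => g gS.
apply: (lmulM HB (Hpsi j)).
- by apply: (inB_scalar HB); exact: algA_sigma.
- exact: (inB_scal HB).
- by apply: mxbnd_scalar => m; exact: sigma_opnorm.
- by apply: mxbnd_scal; exact: unitary_rep_invl.
- exact: hS.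
- exact: (lmul_scal HB (Hpsi j)).
Unshelve. all: by end_near. Qed.

Definition multiplicative_rels delta j :=
  [/\ forall k c, lmul B (psi j) delta (QE k c),
      forall k c i, lmul B (psi j) delta (TAU k c i),
      forall k c i, lmul B (psi j) delta (adjX (TAU k c i)),
      forall k, lmul B (psi j) delta (QS k) &
      forall k, lmul B (psi j) delta (adjX (QS k))].

Lemma near_multiplicative_rels delta : 0 < delta ->
  \forall j \near \oo, multiplicative_rels delta j.
Proof.
move=> dl0; pose z := delta / (R0 * 9).
have R00 : 0 < R0 by exact: lt_le_trans R01.
have z0 : 0 < z by rewrite divr_gt0 // mulr_gt0.
have zd : R0 * (9 * z) = delta.
  by rewrite mulrA /z mulrCA divff ?mulr1 // gt_eqF // mulr_gt0.
have nTa : \forall j \near \oo, forall p : bool * 'I_b, p \in enum predT ->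
    multiplier (psi j) z (ms_adj (seq_T J p.1 p.2)).
  apply: near_all => p; apply: near_multiplier; first exact: z0.
  by apply: (csub_adj HB); exact: algA_T.
have nsa : \forall j \near \oo, multiplier (psi j) z (ms_adj (seq_s d b)).
  by apply: near_multiplier; [exact: z0|apply: (csub_adj HB); exact: algA_s].
apply: filter_app nTa; apply: filter_app nsa; near=> j => msa mTa.
have me : forall c, c \in [:: false; true] -> multiplier (psi j) z (seq_e d b c).
  by near: j; apply: near_all_mult => // c; exact: algA_e.
have mT : forall p : bool * 'I_b, p \in enum predT -> multiplier (psi j) z (seq_T J p.1 p.2).
  by near: j; apply: near_all_mult => // p; exact: algA_T.
have ms : multiplier (psi j) z (seq_s d b).
  by near: j; apply: near_multiplier => //; exact: algA_s.
have mq : forall k, lmul B (psi j) z (IP k).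
  by near: j; exact: near_lmul_invproj.
have me' c : multiplier (psi j) z (seq_e d b c) by apply: me; case: c.
have mT' c i : multiplier (psi j) z (seq_T J c i).
  by apply: (mT (c, i)); rewrite mem_enum.
have mTa' c i : multiplier (psi j) z (ms_adj (seq_T J c i)).
  by apply: (mTa (c, i)); rewrite mem_enum.
clear me mT mTa; rewrite -zd; split.
- exact: (lmul_qe (Hpsi j) (ltW z0) me' mq).
- exact: (lmul_tau (Hpsi j) (ltW z0) mT' mq).
- exact: (lmul_tau_adj (Hpsi j) (ltW z0) mTa' mq).
- exact: (lmul_qs (Hpsi j) (ltW z0) ms mq).
- exact: (lmul_qs_adj (Hpsi j) (ltW z0) msa mq).
Unshelve. all: by end_near. Qed.

End Multipliers.

(** * Comparison of ranks *)

Section GluingInequalities.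
Context {R : realType}.
Implicit Types b e f dl : R.

Lemma glue_bound b e f : b * b * e + b * (2 * e) + b * e + b * e + f <= (b * b + 4 * b) * e + f.
Proof. by rewrite le_eqVlt; apply/orP; left; apply/eqP; ring. Qed.

(** The summands are the gluing error with e = 2 dl, the error of [glue_inner], and the distance 2
    dl between a carrier and Y. Together they make (2 b^2 + 10 b + 3) dl; rounding 3 up to 4 also
    yields the 4 dl used in [small_delta]. *)
Lemma glue_bound2 b dl : 0 <= b -> 0 <= dl -> (2 * b * b + 10 * b + 4) * dl <= 8^-1 ->
  (b * b + 4 * b) * (2 * dl) + (2 * b + 1) * dl + 2 * dl <= 4^-1.
Proof.
move=> b0 dl0 h; apply: (@le_trans _ _ ((2 * b * b + 10 * b + 4) * dl)).
  rewrite -subr_ge0; have -> : (2 * b * b + 10 * b + 4) * dl - ((b * b + 4 * b) * (2 * dl) + (2 * b + 1) * dl + 2 * dl) = dl by ring.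
  by [].
by apply: le_trans h _; lra.
Qed.

Lemma small_delta b dl : 0 <= b -> 0 <= dl -> (2 * b * b + 10 * b + 4) * dl <= 8^-1 ->
  8^-1 + 2 * dl <= 4^-1.
Proof.
move=> b0 dl0 h; have : 4 * dl <= (2 * b * b + 10 * b + 4) * dl.
  by rewrite ler_wpM2r // lerDr addr_ge0 ?mulr_ge0.
by move=> h'; lra.
Qed.

End GluingInequalities.

Lemma glue_split (V : zmodType) (p q p' q' s E : V) :
  p + q + (p' + q') - E = p - s + q + p' + (s + q' - E).
Proof.
rewrite -[s + q' - E]addrA (addrAC p (- s) q) (addrAC (p + q) (- s) p').
by rewrite [RHS]addrA subrK !addrA.
Qed.

Section Gluing.
Context {R : realType}.
Local Notation C := (R[i]).

Lemma opnorm_ord_sum p q n (F : 'I_n -> 'M[C]_(p, q)) e :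
  (forall i, opnorm (F i) <= e) -> opnorm (\sum_i F i) <= n%:R * e.
Proof.
move=> h; apply: le_trans (opnorm_sum _ _ _) _.
rewrite -[X in X%:R * _](card_ord n) mulr_natl -sumr_const.
by apply: ler_sum => i _; exact: h.
Qed.

(* [V] glues the partial isometry [U1^* U0] between the ranges at the next level with the
   identification [z] of the top summands. *)
Lemma gluing n' n b r (Y0 Y1 : 'M[C]_n') (U0 U1 : 'M[C]_(r, n')) (t0 t1 : 'I_b -> 'M[C]_(n', n))
    (z E V : 'M[C]_n) (e e' : R) :
  U0 *m U0^t* = 1%:M -> U1 *m U1^t* = 1%:M ->
  opnorm (U0^t* *m U0 - Y0) <= e -> opnorm (U1^t* *m U1 - Y1) <= e ->
  (forall i, opnorm (t0 i) <= 1) ->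
  (forall i j, opnorm (t1 i *m (t1 j)^t* - (if i == j then Y1 else 0)) <= e) ->
  (forall i, opnorm (t1 i *m z) <= e) ->
  opnorm (\sum_i (t0 i)^t* *m Y0 *m t0 i + z^t* *m z - E) <= e' ->
  V = \sum_i (t1 i)^t* *m (U1^t* *m U0) *m t0 i + z ->
  opnorm (V^t* *m V - E) <= (b%:R * b%:R + 4 * b%:R) * e + e'.
Proof.
move=> UU0 UU1 h0 h1 n0 ht hz hE ->.
set w := U1^t* *m U0; set a := \sum_i (t1 i)^t* *m w *m t0 i.
have nU0 : opnorm U0 <= 1 by rewrite -opnorm_adj; apply: opnorm_isom; rewrite trmxCK.
have nU1 : opnorm U1 <= 1 by rewrite -opnorm_adj; apply: opnorm_isom; rewrite trmxCK.
have nw : opnorm w <= 1.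
  by rewrite -[1]mulr1; apply: opnormM_le => //; rewrite opnorm_adj.
have nl i : opnorm ((t0 i)^t* *m w^t*) <= 1.
  by rewrite -[1]mulr1; apply: opnormM_le; rewrite opnorm_adj.
(* w is an exact partial isometry between the projections U0^* U0 and U1^* U1; replacing these by Y0
   and Y1 costs e each. *)
have wY : opnorm (w^t* *m Y1 *m w - Y0) <= 2 * e.
  have -> : w^t* *m Y1 *m w - Y0 =
      - (w^t* *m (U1^t* *m U1 - Y1) *m w) + (U0^t* *m U0 - Y0).
    have e1 : w^t* *m (U1^t* *m U1) *m w = U0^t* *m U0.
      rewrite /w trmxC_mul trmxCK -!mulmxA (mulmxA U1) UU1 mul1mx.
      by rewrite (mulmxA U1) UU1 mul1mx.
    by rewrite mulmxBr mulmxBl e1 opprB addrA subrK.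
  have hw : opnorm (- (w^t* *m (U1^t* *m U1 - Y1) *m w)) <= e.
    rewrite opnormN -[e]mulr1; apply: opnormM_le; last exact: nw.
    rewrite -[e]mul1r; apply: opnormM_le; last exact: h1.
    by rewrite opnorm_adj.
  by apply: le_trans (opnormD _ _) _; rewrite mulr_natl mulr2n; exact: lerD hw h0.
have aA : a^t* = \sum_i (t0 i)^t* *m w^t* *m t1 i.
  rewrite trmxC_sum; apply: eq_bigr => i _; by rewrite trmxC_mul trmxC_mul trmxCK mulmxA.
(* The relation between t1 i and the adjoint of t1 j collapses the double sum to its diagonal at a
   cost of e for each of the b^2 terms; the b diagonal terms then cost 2 e each by [wY]. *)
have saa : opnorm (a^t* *m a - \sum_i (t0 i)^t* *m Y0 *m t0 i) <= b%:R * b%:R * e + b%:R * (2 * e).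
  have -> : a^t* *m a - \sum_i (t0 i)^t* *m Y0 *m t0 i =
      \sum_i \sum_j (t0 i)^t* *m w^t* *m (t1 i *m (t1 j)^t* - (if i == j then Y1 else 0)) *m (w *m t0 j) +
      \sum_i (t0 i)^t* *m (w^t* *m Y1 *m w - Y0) *m t0 i.
    rewrite aA mulmx_suml -sumrB -big_split; apply: eq_bigr => i _ /=.
    rewrite mulmx_sumr mulmxBr mulmxBl addrA; congr (_ - _).
    rewrite [in RHS](eq_bigr (fun j => (t0 i)^t* *m w^t* *m t1 i *m ((t1 j)^t* *m w *m t0 j) -
       (t0 i)^t* *m w^t* *m (if i == j then Y1 else 0) *m (w *m t0 j))) => [|j _]; last first.
      by rewrite mulmxBr mulmxBl !mulmxA.
    rewrite sumrB [X in _ - X](bigD1 i) //= eqxx [X in _ - (_ + X)]big1 ?addr0 => [|j ji].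
      by rewrite !mulmxA subrK.
    by rewrite eq_sym (negbTE ji) mulmx0 mul0mx.
  apply: le_trans (opnormD _ _) _; apply: lerD.
    rewrite -mulrA; apply: opnorm_ord_sum => i; apply: opnorm_ord_sum => j.
    apply: le_trans (opnormM_le (opnormM_le (nl i) (ht i j)) (opnormM_le nw (n0 j))) _.
    by rewrite mul1r !mulr1.
  apply: opnorm_ord_sum => i; rewrite -[2 * e]mulr1; apply: opnormM_le => //.
  by rewrite -[2 * e]mul1r; apply: opnormM_le => //; rewrite opnorm_adj.
have saz : opnorm (a^t* *m z) <= b%:R * e.
  rewrite aA mulmx_suml; apply: opnorm_ord_sum => i; rewrite -mulmxA -[e]mul1r.
  exact: opnormM_le.
have sza : opnorm (z^t* *m a) <= b%:R * e.
  by rewrite -opnorm_adj trmxC_mul trmxCK.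
apply: le_trans (glue_bound _ _ _).
have -> : (a + z)^t* *m (a + z) - E = a^t* *m a - \sum_i (t0 i)^t* *m Y0 *m t0 i + a^t* *m z + z^t* *m a +
    (\sum_i (t0 i)^t* *m Y0 *m t0 i + z^t* *m z - E).
  by rewrite trmxC_add mulmxDl !mulmxDr (glue_split _ _ _ _ (\sum_i (t0 i)^t* *m Y0 *m t0 i)).
apply: le_trans (opnormD _ _) _; apply: lerD; last exact: hE.
apply: le_trans (opnormD _ _) _; apply: lerD; last exact: sza.
by apply: le_trans (opnormD _ _) _; exact: lerD saa saz.
Qed.

End Gluing.

Section LevelRanks.
Context {R : realType} {G : groupType} {d : nat -> nat} {b : nat} (d_pos : forall k, (0 < d k)%N).
Local Notation C := (R[i]).
Local Notation X := (mxseq R (Edim d b)).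
Local Notation EB m := (@Ebasis d b m).
Local Notation Tg k p := (Tagged (fun n : nat => 'I_(d n)) (i := k) p).
Local Notation IP k := (@invproj R d b k).
Local Notation TAU k c i := (@tau R d b k c i).
Local Notation QE k c := (@qe R d b k c).
Local Notation QS k := (@qs R d b k).

Definition lvl k c : X := diagseq (fun m (x : EB m) => (level_of x == k) && (copy_of x == c)).

(** The unit invariant vector has partial trace 1 / d_k over the factor H_k. This is what turns
    ranks in matrices over A into values of mu on the levels. *)
Lemma qe_lvl k c : (d k)%:R *: \sum_i QE k c i i = lvl k c.
Proof.
apply: ms_ent_ext => m x y; rewrite ent_scale ms_sumE ent_sum ent_Eop.
under eq_bigr => i _ do rewrite ent_Theta.
rewrite -mulr_suml mulrCA (mulrA (d k)%:R) [(d k)%:R * _]mulrC isqd_sqrC // mul1r.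
have [lx|lx] := eqVneq (level_of x) k; last first.
  rewrite andbF big1 ?mul0r // => i _; case: eqP => // hx.
  by case/eqP: lx; rewrite -hpart_level hx.
have [p hx] := level_hpart lx.
rewrite /ke; case: (mult x =P mult y) => [e|ne]; last first.
  rewrite mulr0; case: (x =P y) => // xy; by case: ne; rewrite xy.
have [q hy] := level_hpart (etrans (esym (mult_level e)) lx).
rewrite (eq_split hx hy) (introT eqP e) /= -natbM; congr (_ * _).
rewrite hx hy (bigD1 p) //= eqxx big1 ?addr0 => [|i ip].
  by rewrite eq_Tagged /= eq_sym.
by rewrite eq_Tagged /= eq_sym (negbTE ip).
Qed.

Context (pi : forall k, G -> 'M[C]_(d k)) (J : forall k, 'M[C]_(d k.+1, d k)).
Context (piU : forall k, mx_unitary_rep (pi k)) (piI : forall k, mx_irreducible_rep (pi k)).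
Context (pi_ineq : forall k l, k != l -> ~ mx_unitary_equiv (pi k) (pi l)).
Context (Jisom : forall k, (J k)^t* *m J k = 1%:M).
Context (S : seq G) (kappa : R) (S0 : (0 < size S)%N) (kappa0 : 0 <= kappa) (kappa1 : kappa < 1).
Context (gap : gap_bound S kappa).
Local Notation B := (algA pi J b).
Let HB : unital_Cstar_subalg B := algA_subalg piU Jisom.
Let qeB k c : inB B (QE k c) := inB_qe d_pos piU piI pi_ineq Jisom S0 kappa0 kappa1 gap (k := k) c.
Let tauB k c i : inB B (TAU k c i) :=
  inB_tau d_pos piU piI pi_ineq Jisom S0 kappa0 kappa1 gap (k := k) c i.
Let qsB k : inB B (QS k) := inB_qs d_pos piU piI pi_ineq Jisom S0 kappa0 kappa1 gap (k := k).

Lemma algA_lvl k c : B (lvl k c).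
Proof.
rewrite -qe_lvl; apply: (csub_scale HB); apply: (B_sum HB) => i _; exact: qeB.
Qed.

Context {D : nat} (psi : X -> 'M[C]_D) (Hpsi : ucp B psi).
Local Notation Psi := (bmap psi).
Local Notation Y k c := (bmap psi (QE k c)).

Lemma Y_adj k c : (Y k c)^t* = Y k c.
Proof. by rewrite -(Psi_adj HB Hpsi (@qeB k c)) qe_adj. Qed.

Lemma Y_trace k c : \tr (Y k c) = \tr (psi (lvl k c)) / (d k)%:R.
Proof.
have psi_lin : linear_on B psi by case: Hpsi.
have dk : (d k)%:R != 0 :> C by rewrite pnatr_eq0 -lt0n.
rewrite -qe_lvl (linear_onZ HB _ psi_lin); last by apply: (B_sum HB) => i _; exact: qeB.
rewrite (linear_on_sum HB _ psi_lin) => [|i _]; last exact: qeB.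
rewrite linearZ /= [X in X / _]mulrC mulfK // raddf_sum.
by rewrite /bmap mxtrace_mxblock.
Qed.

(** Y is positive, so its norm is at most its trace, which is the trace of psi at p_k^c, at most D,
    divided by d_k. *)
Lemma Y_small k c : opnorm (Y k c) <= D%:R / (d k)%:R.
Proof.
have dk : 0 < (d k)%:R :> R by rewrite ltr0n.
apply: le_trans (opnorm_psd_trace (Y_adj k c) _) _.
  move=> x; rewrite -(qe_mul d_pos) -{1}[QE k c]qe_adj; exact: (ucp_rdot HB Hpsi).
rewrite Y_trace; have -> : (d k)%:R^-1 = ((d k)%:R^-1)%:C :> C by rewrite fmorphV rmorph_nat.
have -> : complex.Re (\tr (psi (lvl k c)) * ((d k)%:R^-1)%:C) =
    complex.Re (\tr (psi (lvl k c))) / (d k)%:R.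
  by case: (\tr _) => p q /=; rewrite mulr0 subr0.
rewrite ler_pM2r ?invr_gt0 //; apply: le_trans (ler_norm _) _.
apply: le_trans (opnorm_mxtrace _) _; rewrite -[leRHS]mulr1 ler_wpM2l //.
have := Psi_contr HB Hpsi ler01 (inB_scalar HB (p := 1) (algA_lvl k c))
  (@mxbnd_scalar R d b 1 _ (diagseq_opnorm _)).
apply: le_trans; have := opnorm_submxblock (fun i j : 'I_1 => psi (((lvl k c)%:M : 'M[X]_1) i j)) ord0 ord0.
by rewrite mxE eqxx mulr1n.
Qed.

Section Ranks.
Context (delta : R) (delta0 : 0 <= delta)
  (b_small : (2 * b%:R * b%:R + 10 * b%:R + 4) * delta <= 8^-1).
Local Notation lm a := (lmul B psi delta a).
Context (mqe : forall k c, lm (QE k c)) (mtau : forall k c i, lm (TAU k c i))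
  (mtaua : forall k c i, lm (adjX (TAU k c i))) (mqs : forall k, lm (QS k))
  (mqsa : forall k, lm (adjX (QS k))).

Lemma Y_near_idem k c : opnorm (Y k c *m Y k c - Y k c) <= delta.
Proof.
rewrite opnormBC -{1}[QE k c](qe_mul d_pos); apply: mqe; first exact: qeB.
exact: qe_bnd.
Qed.

(** The projection near Y is presented by a coisometry, so that its rank is the number of rows and
    comparing ranks is comparing natural numbers. *)
Definition carrier k c r (U : 'M[C]_(r, \sum_(i < d k) D)) : Prop :=
  U *m U^t* = 1%:M /\ opnorm (U^t* *m U - Y k c) <= 2 * delta.

Definition ranks_agree k : Prop := forall r0 r1 (U0 : 'M[C]_(r0, _)) (U1 : 'M[C]_(r1, _)),
  carrier (k := k) false U0 -> carrier (k := k) true U1 -> r0 = r1.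

Lemma carrier_exists k c : exists r (U : 'M[C]_(r, \sum_(i < d k) D)), carrier c U.
Proof. by have [r [U h]] := near_projection (Y_adj k c) (Y_near_idem k c); exists r, U. Qed.

Lemma ranks_agree_large k : D%:R / (d k)%:R <= 8^-1 :> R -> ranks_agree k.
Proof.
move=> hk r0 r1 U0 U1 [h0 n0] [h1 n1].
have small c r (U : 'M[C]_(r, \sum_(i < d k) D)) : opnorm (U^t* *m U - Y k c) <= 2 * delta ->
    opnorm (U^t* *m U) <= 4^-1.
  move=> hU; rewrite -[U^t* *m U](subrK (Y k c)); apply: le_trans (opnormD _ _) _.
  rewrite addrC; apply: le_trans (small_delta (ler0n R b) delta0 b_small).
  by apply: lerD => //; apply: le_trans (Y_small k c) _.
(* Both projections have norm at most 1/4, so even the zero operator passes for a partial isometry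
   between them. *)
apply: (near_isometry_rank (V := 0) h0 h1).
  by rewrite mulmx0 sub0r opnormN; exact: small n0.
by rewrite mul0mx sub0r opnormN; exact: small n1.
Qed.

(** Apply Psi to the decomposition of q_k^c. Each letter costs delta for inserting q_(k+1) and delta
    for splitting the image of tau^* tau; the term coming from s costs one more delta. *)
Lemma glue_inner k c : opnorm (\sum_i (Psi (TAU k c i))^t* *m Y k.+1 c *m Psi (TAU k c i)
   + (if c then (Psi (QS k))^t* *m Psi (QS k) else Psi (QS k) *m (Psi (QS k))^t*) - Y k c)
  <= (2 * b%:R + 1) * delta.
Proof.
have psi_lin : linear_on B psi by case: Hpsi.
have qs2B : inB B (if c then adjX (QS k) *m QS k else QS k *m adjX (QS k)).
  by case: c; apply: (inBM HB) => //; exact: (inB_adj HB).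
have -> : Y k c = \sum_i Psi (adjX (TAU k c i) *m TAU k c i) +
    Psi (if c then adjX (QS k) *m QS k else QS k *m adjX (QS k)).
  rewrite -(bmap_sum HB psi_lin) => [|i]; last first.
    by apply: (inBM HB) => //; exact: (inB_adj HB).
  rewrite -(bmapD psi_lin); last exact: qs2B.
    rewrite -(tau_adj_tau d_pos); congr (Psi (_ + _)).
    by case: (c); rewrite ?(qs_adj_qs d_pos) ?(qs_qs_adj d_pos).
  by apply: (inB_sum HB) => i _; apply: (inBM HB) => //; exact: (inB_adj HB).
rewrite opprD addrACA -sumrB mulrDl mul1r; apply: le_trans (opnormD _ _) _; apply: lerD.
  rewrite [2 * _]mulrC -mulrA; apply: opnorm_ord_sum => i; rewrite mulr_natl mulr2n.
  apply: le_trans (opnorm_dist _ ((Psi (TAU k c i))^t* *m Psi (TAU k c i)) _) _; apply: lerD.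
    rewrite -mulmxA -mulmxBr -[delta]mul1r; apply: opnormM_le.
      by rewrite opnorm_adj; apply: (Psi_contr HB Hpsi ler01) => //; exact: tau_bnd.
    rewrite opnormBC -{1}(qe_tau d_pos); apply: mqe; [exact: tauB|exact: tau_bnd].
  rewrite opnormBC -(Psi_adj HB Hpsi (@tauB k c i)).
  by apply: mtaua; [exact: tauB|exact: tau_bnd].
rewrite opnormBC; case: (c); rewrite -(Psi_adj HB Hpsi (@qsB k)).
  by apply: mqsa; [exact: qsB|exact: qs_bnd].
by apply: mqs; [exact: (inB_adj HB)|apply: mxbnd_adj; exact: qs_bnd].
Qed.

Lemma glue_orth k c i j : opnorm (Psi (TAU k c i) *m (Psi (TAU k c j))^t* -
    (if i == j then Y k.+1 c else 0)) <= delta.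
Proof.
have psi_lin : linear_on B psi by case: Hpsi.
have -> : (if i == j then Y k.+1 c else 0) = Psi (TAU k c i *m adjX (TAU k c j)).
  by rewrite tau_tau_adj //; case: eqP => // _; rewrite (bmap0 HB psi_lin).
rewrite opnormBC -(Psi_adj HB Hpsi (@tauB k c j)); apply: mtau.
  exact: (inB_adj HB).
by apply: mxbnd_adj; exact: tau_bnd.
Qed.

Lemma tauPsi_le k c i : opnorm (Psi (TAU k c i)) <= 1.
Proof. by apply: (Psi_contr HB Hpsi ler01) => //; exact: tau_bnd. Qed.

(** Level k + 1 enters only through equality of ranks, which allows W1^* W0 to be formed from
    carriers chosen anew with error 2 delta. Hence no error is inherited from higher levels. *)
Lemma ranks_agree_step k : ranks_agree k.+1 -> ranks_agree k.
Proof.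
have psi_lin : linear_on B psi by case: Hpsi.
move=> IH r0 r1 U0 U1 [h0 n0] [h1 n1].
have [r [W0 w0]] := carrier_exists k.+1 false.
have [r' [W1 w1]] := carrier_exists k.+1 true.
have e := IH _ _ _ _ w0 w1; case: r' / e W1 w1 => W1 [hw1 nw1].
case: w0 => hw0 nw0.
(* V goes from copy 0 to copy 1, whereas s goes from copy 1 to copy 0; hence the adjoint on the top
   part. [gluing] is then used for V and for its adjoint. *)
pose V := \sum_i (Psi (TAU k true i))^t* *m (W1^t* *m W0) *m Psi (TAU k false i) +
  (Psi (QS k))^t*.
have d2 : delta <= 2 * delta by rewrite ler_peMl // ler1n.
have b1 : opnorm (V^t* *m V - Y k false) <=
   (b%:R * b%:R + 4 * b%:R) * (2 * delta) + (2 * b%:R + 1) * delta.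
  apply: (gluing hw0 hw1 nw0 nw1 (t0 := fun i => Psi (TAU k false i))
     (t1 := fun i => Psi (TAU k true i)) (z := (Psi (QS k))^t*)).
  - by move=> i; exact: tauPsi_le.
  - by move=> i j; apply: le_trans (glue_orth _ _ _ _) d2.
  - move=> i; apply: le_trans d2; rewrite -(Psi_adj HB Hpsi (@qsB k)) -opnormN.
    rewrite -[- _]add0r -(bmap0 HB psi_lin) -(tau_qs_adj d_pos k i); apply: mtau.
      exact: (inB_adj HB).
    by apply: mxbnd_adj; exact: qs_bnd.
  - by rewrite trmxCK; exact: (glue_inner k false).
  - by [].
have b2 : opnorm (V^t*^t* *m V^t* - Y k true) <=
   (b%:R * b%:R + 4 * b%:R) * (2 * delta) + (2 * b%:R + 1) * delta.
  apply: (gluing hw1 hw0 nw1 nw0 (t0 := fun i => Psi (TAU k true i))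
     (t1 := fun i => Psi (TAU k false i)) (z := Psi (QS k))).
  - by move=> i; exact: tauPsi_le.
  - by move=> i j; apply: le_trans (glue_orth _ _ _ _) d2.
  - move=> i; apply: le_trans d2; rewrite -opnormN.
    rewrite -[- _]add0r -(bmap0 HB psi_lin) -(tau_qs d_pos k i); apply: mtau.
      exact: qsB.
    exact: qs_bnd.
  - exact: (glue_inner k true).
  - rewrite /V trmxC_add trmxCK trmxC_sum; congr (_ + _); apply: eq_bigr => i _.
    by rewrite trmxC_mul trmxC_mul trmxC_mul !trmxCK !mulmxA.
rewrite trmxCK in b2.
have fin := glue_bound2 (ler0n R b) delta0 b_small.
apply: (near_isometry_rank (V := V) h0 h1); apply: le_trans fin.
  apply: le_trans (opnorm_dist _ (Y k false) _) _; apply: lerD; first exact: b1.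
  by rewrite opnormBC; exact: n0.
apply: le_trans (opnorm_dist _ (Y k true) _) _; apply: lerD; first exact: b2.
by rewrite opnormBC; exact: n1.
Qed.

Lemma ranks_agree_all (large : exists k1, forall k, (k1 <= k)%N -> D%:R / (d k)%:R <= 8^-1 :> R) k :
  ranks_agree k.
Proof.
have [k1 hk1] := large.
(* Start at level k1 + k, which is at least k1, and descend k1 steps; once the truncated difference
   reaches 0 it stays there. *)
suff h n : ranks_agree (k1 + k - n) by have := h k1; rewrite addKn.
elim: n => [|n IH].
  by apply: ranks_agree_large; apply: hk1; rewrite subn0 leq_addr.
have [lt|ge] := ltnP n (k1 + k)%N; first by apply: ranks_agree_step; rewrite -subSn.
by move: IH; rewrite (eqP ge) (_ : k1 + k - n.+1 = 0)%N //; apply/eqP; rewrite subn_eq0 ltnW.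
Qed.

(** Both traces of Y lie within d_k D * 2 delta of the common rank, d_k D being the size of the
    matrices. The factor d_k / D from [Y_trace] then yields 4 d_k^2 delta. *)
Lemma level_traces_close (large : exists k1, forall k, (k1 <= k)%N -> D%:R / (d k)%:R <= 8^-1 :> R) k :
  (0 < D)%N ->
  `|complex.Re (ntr (psi (lvl k false))) - complex.Re (ntr (psi (lvl k true)))| <=
  4 * (d k)%:R ^+ 2 * delta.
Proof.
move=> D0; have [r [U0 [h0 n0]]] := carrier_exists k false.
have [r' [U1 [h1 n1]]] := carrier_exists k true.
have e := ranks_agree_all large (conj h0 n0) (conj h1 n1).
case: r' / e U1 h1 n1 => U1 h1 n1.
have dk : 0 < (d k)%:R :> R by rewrite ltr0n.
have DR : 0 < D%:R :> R by rewrite ltr0n.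
have rE c : complex.Re (ntr (psi (lvl k c))) = complex.Re (\tr (Y k c)) * ((d k)%:R / D%:R).
  rewrite Re_ntr Y_trace.
  have -> : (d k)%:R^-1 = ((d k)%:R^-1)%:C :> C by rewrite fmorphV rmorph_nat.
  have -> : complex.Re (\tr (psi (lvl k c)) * ((d k)%:R^-1)%:C) =
      complex.Re (\tr (psi (lvl k c))) / (d k)%:R.
    by case: (\tr _) => p q /=; rewrite mulr0 subr0.
  by rewrite mulrA divfK // gt_eqF.
rewrite !rE -mulrBl normrM [X in _ * X]ger0_norm ?divr_ge0 //.
have tU (U : 'M[C]_(r, \sum_(i < d k) D)) : U *m U^t* = 1%:M -> complex.Re (\tr (U^t* *m U)) = r%:R.
  move=> hU; rewrite mxtrace_mulC hU mxtrace1.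
  have -> : r%:R = (r%:R)%:C :> C by rewrite rmorph_nat.
  by [].
have tb c (U : 'M[C]_(r, \sum_(i < d k) D)) : opnorm (U^t* *m U - Y k c) <= 2 * delta ->
   U *m U^t* = 1%:M -> `|r%:R - complex.Re (\tr (Y k c))| <= (d k * D)%:R * (2 * delta).
  move=> hU hU'; rewrite -(tU U hU') -raddfB -linearB.
  apply: le_trans (opnorm_mxtrace _) _.
  have -> : (\sum_(i < d k) D)%:R = (d k * D)%:R :> R by rewrite sum_nat_const card_ord.
  exact: ler_wpM2l.
have tot : `|complex.Re (\tr (Y k false)) - complex.Re (\tr (Y k true))| <=
    (d k * D)%:R * (2 * delta) + (d k * D)%:R * (2 * delta).
  apply: le_trans (ler_distD r%:R _ _) _; apply: lerD; last exact: tb n1 h1.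
  by rewrite distrC; exact: tb n0 h0.
apply: le_trans (ler_wpM2r _ tot) _; first by rewrite divr_ge0.
rewrite le_eqVlt; apply/orP; left; apply/eqP; rewrite natrM.
by field; rewrite gt_eqF.
Qed.

End Ranks.
End LevelRanks.

(** * Tails *)

Section Tails.
Context {R : realType} {G : groupType} {d : nat -> nat} {b : nat} (d_pos : forall k, (0 < d k)%N).
Local Notation C := (R[i]).
Local Notation X := (mxseq R (Edim d b)).
Local Notation EB m := (@Ebasis d b m).
Local Notation Tg k p := (Tagged (fun n : nat => 'I_(d n)) (i := k) p).
Context (pi : forall k, G -> 'M[C]_(d k)) (J : forall k, 'M[C]_(d k.+1, d k)).
Context (piU : forall k, mx_unitary_rep (pi k)) (piI : forall k, mx_irreducible_rep (pi k)).
Context (Jisom : forall k, (J k)^t* *m J k = 1%:M).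
Local Notation sig := (seq_sigma pi b).
Local Notation conjmx := (map_mx (@Num.conj C)).

Lemma sigma_level_adj g m : (sig g m)^t* = sig (g^-1)%g m.
Proof. exact: (congr1 (fun a : X => a m) (sigma_adj piU g)). Qed.

Lemma sigma_row_right g m (x y : EB m) (F : EB m -> C) :
  \sum_z F z * ent (sig g m) z y =
  \sum_q F (setp (x := y) q) * (pi (level_of y) g q (hcoord y))^*.
Proof.
transitivity ((\sum_z ent (sig (g^-1)%g m) y z * (F z)^*)^*).
  rewrite rmorph_sum; apply: eq_bigr => z _ /=.
  have -> : ent (sig (g^-1)%g m) y z = (ent (sig g m) z y)^*.
    by rewrite -sigma_level_adj ent_adj.
  by rewrite rmorphM /= !conjCK mulrC.
rewrite sigma_row rmorph_sum; apply: eq_bigr => q _ /=.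
by rewrite rmorphM /= !conjCK mulrC (rep_inv piU) !mxE.
Qed.

Section Gram.
Context {m m' : nat} (Z : 'M[C]_(Edim d b m', Edim d b m))
  (Zs : forall g, sig g m' *m Z = Z *m sig g m).
Local Notation P := (Z^t* *m Z).

Lemma gram_commutes g : sig g m *m P = P *m sig g m.
Proof.
have e : sig g m *m Z^t* = Z^t* *m sig g m'.
  have := congr1 (fun M : 'M[C]_(_, _) => M^t*) (Zs (g^-1)%g).
  by rewrite !trmxC_mul !sigma_level_adj invgK.
by rewrite mulmxA e -!mulmxA Zs.
Qed.

(** The block of Z^* Z over one multiplicity index commutes with conj(pi_l), so Schur applies after
    conjugating entries. *)
Lemma gram_scalar (x : EB m) : exists c : C, forall p q,
  ent P (setp (x := x) p) (setp (x := x) q) = (p == q)%:R * c.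
Proof.
pose M : 'M[C]_(d (level_of x)) := \matrix_(p, q) ent P (setp (x := x) p) (setp (x := x) q).
have Mc g : M *m conjmx (pi (level_of x) g) = conjmx (pi (level_of x) g) *m M.
  apply/matrixP => p q; rewrite !mxE.
  have := congr1 (fun A : 'M[C]_(Edim d b m) => ent A (setp (x := x) p) (setp (x := x) q)) (gram_commutes g).
  rewrite !ent_mul sigma_row (sigma_row_right _ x) => e.
  transitivity (\sum_q0 ent P (setp (x := x) p) (setp (x := x) q0) * (pi (level_of x) g q0 q)^*).
    by apply: eq_bigr => q' _; rewrite !mxE.
  rewrite -[LHS]e; apply: eq_bigr => p' _; by rewrite !mxE.
have [c hc] : exists c : C, conjmx M = c%:M.
  apply: (schur_scalar (piI (level_of x))) => g.
  have := congr1 (fun A : 'M[C]_(d (level_of x)) => conjmx A) (Mc g).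
  rewrite !map_mxM; have -> : conjmx (conjmx (pi (level_of x) g)) = pi (level_of x) g.
    by apply/matrixP => p q; rewrite !mxE conjCK.
  by [].
exists (c^*) => p q.
have /matrixP /(_ p q) := hc; rewrite !mxE => e.
have -> : ent P (setp (x := x) p) (setp (x := x) q) = (c *+ (p == q))^* by rewrite -e conjCK.
by case: (p == q); rewrite ?mulr1n ?mul1r // mulr0n mul0r conjC0.
Qed.

Lemma gram_off_diag (x y : EB m) : mult x = mult y -> x != y -> ent P y x = 0.
Proof.
move=> e xy; have [c hc] := gram_scalar x.
have [q hy] := level_hpart (esym (mult_level e)).
have ey : y = setp (x := x) q by apply: Ebasis_ext; rewrite ?hy // -e.
rewrite ey -{2}(setp_hcoord x) hc; case: eqP => [eq|]; last by rewrite mul0r.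
by case/eqP: xy; rewrite ey eq setp_hcoord.
Qed.

Lemma gram_diag (x : EB m) : exists2 c : R, 0 <= c & forall p, ent P (setp (x := x) p) (setp p) = c%:C.
Proof.
have [c hc] := gram_scalar x; have [r r0 hr] := adj_gram_diag Z (enum_rank x).
exists r => // p; rewrite hc eqxx mul1r -hr -[RHS]/(ent P x x).
by rewrite -{1 2}(setp_hcoord x) hc eqxx mul1r.
Qed.

End Gram.

Context (r : R) (rd : forall k, r * (d k.+1)%:R <= (d k)%:R) (c : bool) (i : 'I_b) (K : nat).

Definition tailp K c : X := diagseq (fun m (x : EB m) => (K <= level_of x)%N && (copy_of x == c)).

(* By Schur's lemma the blocks of a positive element of the commutant are scalars, and on them
   [taildiff] has trace [d k - r * d k.+1] at level k + 1. *)
Definition taildiff : X :=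
  seq_T J c i * tailp K c * ms_adj (seq_T J c i) - r%:C *: tailp K.+1 c.

Lemma ent_ms_sub (a a' : X) m (x y : EB m) : ent ((a - a') m) x y = ent (a m) x y - ent (a' m) x y.
Proof. by rewrite /ent !mxE. Qed.

Lemma ent_TpT m (x y : EB m) :
  ent ((seq_T J c i * tailp K c * ms_adj (seq_T J c i)) m) x y =
  \sum_z (K <= level_of z)%N%:R * (ent (seq_T J c i m) x z * (ent (seq_T J c i m) y z)^*).
Proof.
rewrite ent_ms_mul; apply: eq_bigr => z _; rewrite ent_ms_mul ent_ms_adj.
rewrite (bigD1 z) //= big1 ?addr0 => [|z' z'z]; last first.
  by rewrite [X in _ * X]ent_Eop (negbTE z'z) mulr0.
rewrite [ent (tailp K c m) z z]ent_Eop eqxx /=.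
case cz: (copy_of z == c); first by rewrite andbT mulrAC mulrC.
by rewrite andbF mulr0 mul0r [ent (seq_T J c i m) x z]ent_Eop cz andbF mul0r mul0r mulr0.
Qed.

Lemma taildiff_off m (x y : EB m) : mult x != mult y -> ent (taildiff m) x y = 0.
Proof.
move=> xy; rewrite ent_ms_sub ent_TpT ent_scale ent_Eop.
have -> : (x == y) = false by apply: contraNF xy => /eqP ->.
rewrite mulr0 subr0 big1 // => z _; rewrite !ent_Eop.
case: and3P => [[/eqP cx _ /eqP wx]|]; last by rewrite !mul0r mulr0.
case: and3P => [[/eqP cy _ /eqP wy]|]; last by rewrite mul0r conjC0 !mulr0.
case/eqP: xy; rewrite /mult cx cy; congr (_, _).
by move: wy; rewrite wx => -[].
Qed.

Lemma taildiff_diag m (x : EB m) : complex.Re (ent (taildiff m) x x) =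
  \sum_z (K <= level_of z)%N%:R * Normc.normc (ent (seq_T J c i m) x z) ^+ 2 -
  r * ((K < level_of x)%N && (copy_of x == c))%:R.
Proof.
rewrite ent_ms_sub ent_TpT ent_scale ent_Eop eqxx raddfB raddf_sum /=; congr (_ - _).
  apply: eq_bigr => z _; case: (ent _ x z) => p q /=.
  case: (K <= _)%N; rewrite ?mul0r ?mul1r /=; last by rewrite ?mul0r.
  rewrite sqr_sqrtr ?addr_ge0 ?sqr_ge0 //; ring.
case: (_ && _) => /=; ring.
Qed.

(** At level k + 1 > K the block of T_i p T_i^* has as trace the sum of all |J_k(p, q)|^2, which is
    d_k, against r d_(k+1) <= d_k. On all other blocks nothing is subtracted. *)
Lemma taildiff_level m k (km : (k <= m)%N) c' w :
  0 <= \sum_p complex.Re (ent (taildiff m) (bvec km c' p w) (bvec km c' p w)).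
Proof.
under eq_bigr => p _ do rewrite taildiff_diag.
rewrite sumrB subr_ge0.
have pos p : 0 <= \sum_z (K <= level_of z)%N%:R *
    Normc.normc (ent (seq_T J c i m) (bvec km c' p w) z) ^+ 2 :> R.
  by apply: sumr_ge0 => z _; rewrite mulr_ge0 // sqr_ge0.
have [Kk|kK] := ltnP K k; last first.
  rewrite big1 => [|p _]; last by rewrite /= mulr0.
  by apply: sumr_ge0 => p _; exact: pos.
have [cc|cc] := eqVneq c' c; last first.
  rewrite big1 => [|p _]; last by rewrite /= mulr0.
  by apply: sumr_ge0 => p _; exact: pos.
case: k km w pos Kk => // k km w pos Kk; rewrite ltnS in Kk.
rewrite (eq_bigr (fun=> r)) => [|p _]; last by rewrite /= mulr1.
rewrite sumr_const card_ord -mulr_natr; apply: le_trans (rd k) _.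
have sz : (size (i :: val w) + k = m)%N by rewrite /= size_tuple addSnnS subnK.
rewrite le_eqVlt; apply/orP; left; apply/eqP.
suff : (d k)%:R = \sum_p \sum_z ((K <= level_of z)%N%:R *
    Normc.normc (ent (seq_T J c i m) (bvec km c' p w) z) ^+ 2)%:C :> C.
  move/(congr1 (@complex.Re R)); rewrite raddf_sum /=.
  have -> : complex.Re ((d k)%:R : C) = (d k)%:R.
    by have -> : (d k)%:R = ((d k)%:R)%:C :> C by rewrite rmorph_nat.
  by move=> ->; apply: eq_bigr => p _; rewrite raddf_sum.
rewrite -(J_square Jisom); apply: eq_bigr => p _.
transitivity (\sum_(z : EB m | mult z == (c, i :: val w))
   (Normc.normc (hcoef (s := succn) (fun k => map_mx Num.conj (J k)) (Tg k.+1 p) (hpart z)) ^+ 2)%:C).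
  rewrite (sum_fiber c (fun h => (Normc.normc (hcoef (s := succn) (fun k => map_mx Num.conj (J k)) (Tg k.+1 p) h) ^+ 2)%:C) sz).
  apply: eq_bigr => q _; rewrite (hcoef_in (s := succn)) mxE.
  case: (J k p q) => u v /=; rewrite sqr_sqrtr ?addr_ge0 ?sqr_ge0 //.
  by apply/eqP; rewrite eq_complex /=; apply/andP; split; apply/eqP; ring.
have normc00 : Normc.normc (0 : C) = 0 by rewrite /= expr0n addr0 sqrtr0.
rewrite big_mkcond; apply: eq_bigr => z _; rewrite ent_Eop /mult xpair_eqE.
rewrite (_ : copy_of (bvec km c' p w) = c') // (_ : word_of (bvec km c' p w) = val w) // cc eqxx /=.
case: (copy_of z =P c) => [cz|_] /=; last by rewrite mul0r normc00 expr0n mulr0.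
case: eqP => [wz|_]; last by rewrite mul0r normc00 expr0n mulr0.
have lz : level_of z = k.
  by have := word_level z; rewrite wz => h; apply: (@addnI (size (i :: val w))); rewrite h sz.
by rewrite lz Kk !mul1r.
Qed.

(** [taildiff] has no entries between different multiplicity indices, and Z^* Z has none off the
    diagonal within one, so only diagonal entries pair. Along a block those of Z^* Z equal a
    constant t >= 0, which leaves t times a block trace. *)
Lemma taildiff_pos m m' (Z : 'M[C]_(Edim d b m', Edim d b m)) :
  (forall g, sig g m' *m Z = Z *m sig g m) ->
  0 <= complex.Re (\tr (taildiff m *m (Z^t* *m Z))).
Proof.
move=> Zs; rewrite mxtrace_ent.
have -> : \sum_x ent (taildiff m *m (Z^t* *m Z)) x x =
    \sum_x ent (taildiff m) x x * ent (Z^t* *m Z) x x.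
  apply: eq_bigr => x _; rewrite ent_mul (bigD1 x) //= big1 ?addr0 // => y yx.
  have [e|ne] := eqVneq (mult x) (mult y); last by rewrite taildiff_off ?mul0r.
  by rewrite (gram_off_diag Zs e) ?mulr0 // eq_sym.
rewrite (partition_big (fun x : EB m => (inord (level_of x) : 'I_m.+1)) xpredT) //=.
rewrite raddf_sum; apply: sumr_ge0 => k _ /=.
have km : (k <= m)%N by rewrite -ltnS.
rewrite (eq_bigl (fun x : EB m => level_of x == k)) => [|x]; last first.
  rewrite -val_eqE /= inordK // ltnS.
  by apply: leq_trans (leq_addl (size (word_of x)) _) _; rewrite word_level.
rewrite (sum_level km) raddf_sum; apply: sumr_ge0 => c' _.
rewrite exchange_big raddf_sum; apply: sumr_ge0 => w _ /=.
pose x0 := bvec km c' (Ordinal (d_pos k)) w.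
have [t t0 ht] := gram_diag Zs x0.
have -> : \sum_p ent (taildiff m) (bvec km c' p w) (bvec km c' p w) *
    ent (Z^t* *m Z) (bvec km c' p w) (bvec km c' p w) =
  (\sum_p ent (taildiff m) (bvec km c' p w) (bvec km c' p w)) * t%:C.
  by rewrite mulr_suml; apply: eq_bigr => p _; rewrite -(ht p).
have -> (z : C) : complex.Re (z * t%:C) = complex.Re z * t.
  by case: z => u v /=; rewrite mulr0 subr0.
apply: mulr_ge0 => //; rewrite raddf_sum; exact: taildiff_level.
Qed.

End Tails.

(** * Equality of the masses of the two copies *)

Section Conclusion.
Context {R : realType} {G : groupType} {d : nat -> nat} {b : nat} (d_pos : forall k, (0 < d k)%N).
Local Notation C := (R[i]).
Local Notation X := (mxseq R (Edim d b)).
Local Notation EB m := (@Ebasis d b m).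
Context (pi : forall k, G -> 'M[C]_(d k)) (J : forall k, 'M[C]_(d k.+1, d k)).
Context (piU : forall k, mx_unitary_rep (pi k)) (piI : forall k, mx_irreducible_rep (pi k)).
Context (pi_ineq : forall k l, k != l -> ~ mx_unitary_equiv (pi k) (pi l)).
Context (Jisom : forall k, (J k)^t* *m J k = 1%:M).
Context (S : seq G) (kappa : R) (S0 : (0 < size S)%N) (kappa0 : 0 <= kappa) (kappa1 : kappa < 1).
Context (gap : gap_bound S kappa).
Context (R0 : R) (R01 : 1 <= R0) (dR0 : forall k, (d k.+1)%:R <= R0 * (d k)%:R) (Rb : R0 < b%:R).
Context (d_large : forall M : nat, exists k1, forall k, (k1 <= k)%N -> (M <= d k)%N).
Local Notation B := (algA pi J b).
Let HB : unital_Cstar_subalg B := algA_subalg piU Jisom.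
Context (mu : X -> C) (mu_tr : tracial_state B mu).
Context {D : nat -> nat} {psi : forall j, X -> 'M[C]_(D j)}.
Context (Dpos : forall j, (0 < D j)%N) (Hpsi : forall j, ucp B (psi j)).
Context (psi_mul : forall x y, B x -> B y ->
  opnorm (psi j (x * y) - psi j x *m psi j y) @[j --> \oo] --> (0 : R)).
Context (psi_tr : forall x, B x -> (ntr (psi j x) : C^o) @[j --> \oo] --> (mu x : C^o)).

Let mu_lin : linear_on B (mu : X -> C^o). Proof. by case: mu_tr. Qed.

Let lvlB k c : B (lvl k c) :=
  algA_lvl d_pos piU piI pi_ineq Jisom S0 kappa0 kappa1 gap k c.

Lemma level_mu k : complex.Re (mu (lvl k false)) = complex.Re (mu (lvl k true)).
Proof.
apply/eqP; rewrite -subr_eq0 -normr_le0; apply/ler_addgt0Pr => e e0; rewrite add0r.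
pose M : R := 4 * (d k)%:R ^+ 2; pose Q : R := 2 * b%:R * b%:R + 10 * b%:R + 4.
have M0 : 0 < M by rewrite mulr_gt0 // exprn_gt0 // ltr0n.
have Q0 : 0 < Q by rewrite ltr_wpDl // addr_ge0 // !mulr_ge0.
have e3 : 0 < e / 3 by rewrite divr_gt0.
(* M is the factor in [level_traces_close] and Q that in the smallness condition of the gluing. Two
   further thirds of e pay for replacing mu by the trace of psi j in each copy. *)
pose dl := Num.min (e / 3 / M) (8^-1 / Q).
have dl0 : 0 < dl by rewrite lt_min !divr_gt0.
have n1 := near_multiplicative_rels d_pos piU piI pi_ineq Jisom S0 kappa0 kappa1 gap R01 dR0
   Hpsi psi_mul dl0.
have n2 := near_trace psi_tr (lvlB k false) e3.
have n3 := near_trace psi_tr (lvlB k true) e3.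
have [j [h1 [h2 h3]]] := filter_ex (filterI n1 (filterI n2 n3)).
have [m1 m2 m3 m4 m5] := h1.
have Qdl : Q * dl <= 8^-1.
  by rewrite mulrC -ler_pdivlMr // ge_min lexx orbT.
have Mdl : M * dl <= e / 3.
  by rewrite mulrC -ler_pdivlMr // ge_min lexx.
have large : exists k1, forall k, (k1 <= k)%N -> (D j)%:R / (d k)%:R <= 8^-1 :> R.
  have [k1 hk1] := d_large (8 * D j); exists k1 => l /hk1 h.
  rewrite ler_pdivrMr ?ltr0n // mulrC ler_pdivlMr // -natrM ler_nat mulnC; exact: h.
have h4 := level_traces_close d_pos piU piI pi_ineq Jisom S0 kappa0 kappa1 gap (Hpsi j)
  (ltW dl0) Qdl m1 m2 m3 m4 m5 large k (Dpos j).
apply: le_trans (ler_distD (complex.Re (ntr (psi j (lvl k false)))) _ _) _.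
have -> : e = e / 3 + (e / 3 + e / 3) by field.
apply: lerD; first by rewrite distrC; exact: ltW.
apply: le_trans (ler_distD (complex.Re (ntr (psi j (lvl k true)))) _ _) _.
by apply: lerD; [apply: le_trans h4 _|exact: ltW].
Qed.

Lemma ent_ms_add (a a' : X) m (x y : EB m) : ent ((a + a') m) x y = ent (a m) x y + ent (a' m) x y.
Proof. by rewrite /ent !mxE. Qed.

Lemma tailpE K c : tailp K c = seq_e d b c - \sum_(l < K) lvl l c :> X.
Proof.
apply: ms_ent_ext => m x y; rewrite ent_ms_sub ms_sumE ent_sum !ent_Eop.
under eq_bigr => l _ do rewrite ent_Eop.
case: (x == y) => /=; last by rewrite big1 // subr0.
case: (copy_of x == c); last by rewrite andbF big1 ?subr0 // => l _; rewrite andbF.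
rewrite andbT; under eq_bigr => l _ do rewrite andbT.
have [Kx|xK] := leqP K (level_of x).
  by rewrite big1 ?subr0 // => l _; rewrite gtn_eqF // (leq_trans (ltn_ord l)).
rewrite (bigD1 (Ordinal xK)) //= eqxx big1 ?addr0 ?subrr // => l.
by rewrite -val_eqE /= eq_sym => /negbTE ->.
Qed.

Lemma algA_tailp K c : B (tailp K c).
Proof.
rewrite tailpE; apply: (csub_add HB); first exact: algA_e.
by apply: (BN HB); apply: (B_sum HB) => l _; exact: lvlB.
Qed.

Lemma mu_diag_ge0 P : B (diagseq P) -> 0 <= mu (diagseq P).
Proof.
move=> PB; have [_ _ pos _] := mu_tr; have := pos _ PB.
by rewrite diagseq_adj diagseq_mul (diagseq_ext (Q := P)) // => m x; rewrite andbb.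
Qed.

Lemma Re_ge0 (z : C) : 0 <= z -> 0 <= complex.Re z.
Proof. by rewrite lecE /= => /andP[]. Qed.

Lemma mu_e_real c : mu (seq_e d b c) = (complex.Re (mu (seq_e d b c)))%:C.
Proof.
have := @mu_diag_ge0 (fun m x => copy_of x == c) (@algA_e R G d b pi J c).
by rewrite -seq_eE; case: (mu _) => p q; rewrite lecE /= => /andP[/eqP -> _].
Qed.

Lemma mu_taildiff c i K : 0 <= complex.Re (mu (taildiff J R0^-1 c i K)).
Proof.
have R00 : 0 < R0 by exact: lt_le_trans R01.
have rd k : R0^-1 * (d k.+1)%:R <= (d k)%:R by rewrite ler_pdivrMl.
have aB : B (taildiff J R0^-1 c i K).
  apply: (csub_add HB).
    apply: (csub_mul HB); last by apply: (csub_adj HB); exact: algA_T.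
    by apply: (csub_mul HB); [exact: algA_T|exact: algA_tailp].
  by apply: (BN HB); apply: (csub_scale HB); exact: algA_tailp.
have ah : ms_adj (taildiff J R0^-1 c i K) = taildiff J R0^-1 c i K.
  rewrite /taildiff ms_adjD -scaleNr ms_adjZ !ms_adjM ms_adjK !diagseq_adj mulrA.
  by congr (_ + _ *: _); rewrite rmorphN /= conj_realC.
have [L hL] := csub_bounded HB aB.
apply: (trace_commutant_ge0 HB psi_mul psi_tr Dpos Hpsi mu_tr (@algA_sigma R G d b pi J)
  (sigma_id piU) (sigma_mul piU) (sigma_unitary piU) S0 kappa0 kappa1 gap aB ah
  (le_trans (opnorm_ge0 _) (hL 0%N)) hL).
by move=> m m' Z; exact: (taildiff_pos d_pos piU piI Jisom rd).
Qed.

Local Notation t K c := (complex.Re (mu (tailp K c))).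

(** The tail p splits as the sum of p T_i^* T_i over all letters i plus a positive top part. By
    traciality mu(p T_i^* T_i) = mu(T_i p T_i^* ), which [mu_taildiff] bounds below; there are b
    letters. *)
Lemma tail_step c K : b%:R * (R0^-1 * t K.+1 c) <= t K c.
Proof.
have [_ _ _ muC] := mu_tr.
pose Di i : X := diagseq (fun m (x : EB m) =>
  [&& (K <= level_of x)%N, copy_of x == c & ohead (word_of x) == Some i]).
pose Dt : X := diagseq (fun m (x : EB m) =>
  [&& (K <= level_of x)%N, copy_of x == c & level_of x == m]).
have DiE i : tailp K c * (ms_adj (seq_T J c i) * seq_T J c i) = Di i.
  rewrite (seq_T_adj_T Jisom) diagseq_mul; apply: diagseq_ext => m x.
  by case: (copy_of x == c); rewrite ?andbF ?andbT.
have DtE : tailp K c * seq_F d b c = Dt.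
  rewrite seq_FE diagseq_mul; apply: diagseq_ext => m x.
  by case: (copy_of x == c); rewrite ?andbF ?andbT.
have DiB i : B (Di i).
  rewrite -DiE; apply: (csub_mul HB); first exact: algA_tailp.
  by apply: (csub_mul HB); [apply: (csub_adj HB)|]; exact: algA_T.
have DtB : B Dt.
  by rewrite -DtE; apply: (csub_mul HB); [exact: algA_tailp|exact: algA_F].
have sum : tailp K c = \sum_i Di i + Dt.
  apply: ms_ent_ext => m x y.
  rewrite ent_ms_add ms_sumE ent_sum !ent_Eop.
  under eq_bigr => i _ do rewrite ent_Eop.
  case: (x == y) => /=; last by rewrite big1 ?addr0.
  case: (K <= _)%N => /=; last by rewrite big1 ?addr0.
  case: (copy_of x == c) => /=; last by rewrite big1 ?addr0.
  rewrite top_level /nilp /=; case: (word_of x) => [|i w] /=; first by rewrite big1 ?add0r.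
  rewrite addr0 (bigD1 i) //= eqxx big1 ?addr0 // => i' i'i.
  by rewrite (_ : Some i == Some i' = (i == i')) // eq_sym (negbTE i'i).
have lin : t K c = \sum_i complex.Re (mu (Di i)) + complex.Re (mu Dt).
  rewrite sum (linear_onD mu_lin) //; last by apply: (B_sum HB).
  by rewrite (linear_on_sum HB _ mu_lin) // raddfD raddf_sum.
rewrite lin -[leLHS]addr0; apply: lerD; last exact: Re_ge0 (mu_diag_ge0 DtB).
rewrite -[X in X%:R * _](card_ord b) mulr_natl -sumr_const; apply: ler_sum => i _.
have := mu_taildiff c i K; rewrite /taildiff.
have TB := @algA_T R G d b pi J c i; have TaB := csub_adj HB TB; have pB := algA_tailp K c.
rewrite (linear_onB HB mu_lin); last first.
- by apply: (csub_scale HB); exact: algA_tailp.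
- by apply: (csub_mul HB) => //; apply: (csub_mul HB).
rewrite (linear_onZ HB _ mu_lin); last exact: algA_tailp.
rewrite -mulrA muC //; last exact: (csub_mul HB).
rewrite -mulrA DiE raddfB subr_ge0.
by case: (mu (tailp K.+1 c)) => p q /=; rewrite mul0r subr0.
Qed.

Lemma tail_ge0 K c : 0 <= t K c.
Proof. by apply: Re_ge0; apply: mu_diag_ge0; exact: algA_tailp. Qed.

Lemma tail_geometric K c : t K c <= (R0 / b%:R) ^+ K * t 0 c.
Proof.
have R00 : 0 < R0 by exact: lt_le_trans R01.
have b0 : 0 < b%:R :> R by exact: lt_trans Rb.
elim: K => [|K IH]; first by rewrite expr0 mul1r.
rewrite exprS -mulrA; apply: le_trans (ler_wpM2l _ IH); last by rewrite divr_ge0 ?ltW.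
rewrite -ler_pdivrMl ?divr_gt0 // invf_div -mulrA; exact: tail_step.
Qed.

(** Levels below K have equal mass in both copies, so the difference equals that of the two tails,
    which are nonnegative and tend to 0 because R0 < b. *)
Lemma mu_e_Re : complex.Re (mu (seq_e d b false)) = complex.Re (mu (seq_e d b true)).
Proof.
have R00 : 0 < R0 by exact: lt_le_trans R01.
have b0 : 0 < b%:R :> R by exact: lt_trans Rb.
have tE K c : t K c = complex.Re (mu (seq_e d b c)) - \sum_(l < K) complex.Re (mu (lvl l c)).
  rewrite tailpE (linear_onB HB mu_lin); last first.
  - by apply: (B_sum HB) => l _; exact: lvlB.
  - exact: algA_e.
  rewrite (linear_on_sum HB _ mu_lin) => [|l _]; last exact: lvlB.
  by rewrite raddfB raddf_sum.
have diff K : complex.Re (mu (seq_e d b false)) - complex.Re (mu (seq_e d b true)) =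
    t K false - t K true.
  rewrite !tE (eq_bigr (fun l : 'I_K => complex.Re (mu (lvl l true)))) => [|l _]; last exact: level_mu.
  by rewrite opprB addrA subrK.
have small c e : 0 < e -> exists K0, forall K, (K0 <= K)%N -> t K c <= e.
  move=> e0.
  have q1 : `|R0 / b%:R| < 1 by rewrite ger0_norm ?divr_ge0 ?ltW // ltr_pdivrMr // mul1r.
  have := @cvg_geometric _ (t 0 c) _ q1 => /cvgrPdist_lt /(_ _ e0) [K0 _ hK].
  exists K0 => K /hK; rewrite sub0r normrN /geometric /= => /ltW h.
  apply: le_trans (tail_geometric K c) _; rewrite mulrC; exact: le_trans (ler_norm _) h.
apply/eqP; rewrite -subr_eq0 -normr_le0; apply/ler_addgt0Pr => e e0; rewrite add0r.
have [K0 h0] := small false e e0; have [K1 h1] := small true e e0.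
rewrite (diff (maxn K0 K1)) ler_norml; apply/andP; split.
  rewrite -lerN2 opprK opprB; apply: le_trans (h1 _ (leq_maxr K0 K1)).
  by rewrite gerBl; exact: tail_ge0.
apply: le_trans (h0 _ (leq_maxl K0 K1)); rewrite gerBl; exact: tail_ge0.
Qed.

Lemma mu_e_half c : mu (seq_e d b c) = 2^-1.
Proof.
have [_ mu1 _ _] := mu_tr.
have e1 : seq_e d b false + seq_e d b true = 1 :> X.
  rewrite !seq_eE diagseq_add => [|m x]; last by case: (copy_of x).
  apply: ms_ent_ext => m x y; rewrite ent_Eop (_ : (1 : X) m = 1%:M) // ent1.
  by case: (copy_of x); rewrite ?orbT /= andbT.
have s : complex.Re (mu (seq_e d b false)) + complex.Re (mu (seq_e d b true)) = 1.
  by rewrite -raddfD -(linear_onD mu_lin) ?e1 ?mu1 //; exact: algA_e.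
have half : complex.Re (mu (seq_e d b c)) = 2^-1.
  have -> : complex.Re (mu (seq_e d b c)) = complex.Re (mu (seq_e d b true)).
    by case: (c); rewrite ?mu_e_Re.
  rewrite mu_e_Re in s; set z := complex.Re _ in s *.
  by rewrite -[z](mulfK (_ : 2 != 0)) // mulr_natr mulr2n s mul1r.
by rewrite mu_e_real half fmorphV rmorph_nat.
Qed.

End Conclusion.

Section Hypotheses.
Context {R : realType} {d : nat -> nat} (d_pos : forall k, (0 < d k)%N).

Lemma sup_ratio_bound (b : nat) : (forall k, (d k <= d k.+1)%N) ->
  (sup_ratio R d < b%:R%:E)%E ->
  exists R0 : R, [/\ 1 <= R0, R0 < b%:R & forall k, (d k.+1)%:R <= R0 * (d k)%:R].
Proof.
move=> dmono sup_b.
have ub k : (((d k.+1)%:R / (d k)%:R : R)%:E <= sup_ratio R d)%E.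
  by apply: ereal_sup_ubound; exists k.
have fin : sup_ratio R d \is a fin_num.
  rewrite fin_numElt; apply/andP; split; last by apply: lt_trans sup_b _; exact: ltry.
  by apply: lt_le_trans (ub 0%N); exact: ltNyr.
have ratio k : (d k.+1)%:R / (d k)%:R <= fine (sup_ratio R d).
  by rewrite -lee_fin fineK.
exists (fine (sup_ratio R d)); split.
- apply: le_trans (ratio 0%N); rewrite ler_pdivlMr ?ltr0n // mul1r ler_nat; exact: dmono.
- by rewrite -lte_fin fineK.
- by move=> k; rewrite -ler_pdivrMr ?ltr0n.
Qed.

End Hypotheses.

Theorem theorem4p1 (R : realType) (G : groupType)
    (d : nat -> nat) (pi : forall k, G -> 'M[R[i]]_(d k))
    (b : nat) (J : forall k, 'M[R[i]]_(d k.+1, d k)) :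
  countable [set: G] -> infinite_set [set: G] ->
  residually_finite G -> property_T R G ->
  lists_irreps pi ->
  d 0%N = 1%N -> (forall g, pi 0%N g = 1%:M) ->
  (forall k, (d k <= d k.+1)%N) ->
  d @ \oo --> \oo ->
  (sup_ratio R d < +oo)%E ->
  (sup_ratio R d < b%:R%:E)%E ->
  (forall k, (J k)^t* *m J k = 1%:M) ->
  forall mu : mxseq R (Edim d b) -> R[i],
    tracial_state (algA pi J b) mu -> quasidiagonal (algA pi J b) mu ->
    mu (seq_e d b false) = 2^-1 /\ mu (seq_e d b true) = 2^-1.
Proof.
move=> _ _ _ hT [irr list_uniq] _ _ dmono dlim _ sup_b Jisom mu mu_tr.
move=> [D [psi [Dpos Hpsi psi_mul psi_tr]]].
have piU k := proj1 (irr k); have piI k := proj2 (irr k).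
have d_pos k : (0 < d k)%N by case: (piI k).
(* The class of pi_k occurs in the list at k and, were it equivalent to pi_l, at l as well;
   uniqueness of the position forces k = l. *)
have pi_ineq k l : k != l -> ~ mx_unitary_equiv (pi k) (pi l).
  move=> kl e; have [k0 [_ h]] := list_uniq _ _ (piU k) (piI k).
  have ek : mx_unitary_equiv (pi k) (pi k).
    exists 1%:M; split=> [||g]; rewrite ?mulmx1 ?mul1mx //.
      by rewrite trmx1 map_mx1.
    by rewrite trmx1 map_mx1.
  by case/eqP: kl; rewrite -(h _ ek) -(h _ e).
have [R0 [R01 R0b dR0]] := sup_ratio_bound d_pos dmono sup_b.
have [S [kappa [S0 kappa0 kappa1 gap]]] := kazhdan_gap hT.
have d_large (M : nat) : exists k1, forall k, (k1 <= k)%N -> (M <= d k)%N.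
  have [k1 _ hk1] := dlim _ (nbhs_infty_ge M).
  by exists k1 => k /hk1.
have half := mu_e_half d_pos piU piI pi_ineq Jisom S0 kappa0 kappa1 gap R01 dR0 R0b d_large
  mu_tr Dpos Hpsi psi_mul psi_tr.
by split; exact: half.
Qed.
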